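(* Let $A=(a_{j,q})_{j\in\mathbb N,q\in\mathbb N_0}$ be a Köthe matrix. Then the following assertions are equivalent: (1) $\lambda^2(A)$ is isomorphic as a Fréchet space to some closed commutative ${}^*$-subalgebra of $\mathcal L(s',s)$; (2) the matrix $A$ satisfies the following conditions: (i) $\forall q\in\mathbb N_0\ \exists r\in\mathbb N_0:\ \sum_{j=1}^\infty\frac{a_{j,q}}{a_{j,r}}<\infty$, (ii) $\exists p\in\mathbb N_0\ \forall q\in\mathbb N_0\ \exists r\in\mathbb N_0\ \exists C>0\ \forall j\in\mathbb N:\ a_{j,q}^2\leq C a_{j,p}a_{j,r}$; (3) $\lambda^2(A)$ is a nuclear Fréchet space with the property (DN); (4) $\lambda^2(A)$ is a Fréchet space isomorphic to a closed subspace of $s$.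
   Context: $\mathbb N=\{1,2,\dots\}$, $\mathbb N_0=\mathbb N\cup\{0\}$; all spaces are over $\mathbb C$. A Fréchet space is a complete metrizable locally convex space; isomorphisms of Fréchet spaces are linear homeomorphisms. The space of rapidly decreasing sequences is the Fréchet space $s=\{\xi\in\mathbb C^{\mathbb N}: |\xi|_q:=(\sum_{j}|\xi_j|^2j^{2q})^{1/2}<\infty \text{ for all } q\in\mathbb N_0\}$ with the norms $(|\cdot|_q)_{q\in\mathbb N_0}$. Its strong dual is identified with $s'=\{\xi\in\mathbb C^{\mathbb N}: |\xi|'_q:=(\sum_j|\xi_j|^2j^{-2q})^{1/2}<\infty\text{ for some }q\in\mathbb N_0\}$. $\mathcal L(s',s)$ is the Fréchet ${}^*$-algebra (Fréchet space with continuous multiplication and involution) of all continuous linear operators $s'\to s$ with the topology of uniform convergence on bounded subsets of $s'$; since $s\subset\ell_2\subset s'$, each such operator restricts to a bounded operator on $\ell_2$, and the ${}^*$-algebra operations (composition and Hilbert space adjoint) are inherited from $\mathcal B(\ell_2)$. A Köthe matrix is a matrix $A=(a_{j,q})_{j\in\mathbb N,q\in\mathbb N_0}$ of nonnegative numbers such that for each $j$ there is $q$ with $a_{j,q}>0$, and $a_{j,q}\le a_{j,q+1}$ for all $j,q$. Then $\lambda^2(A)=\{\xi\in\mathbb C^{\mathbb N}:|\xi|_{\lambda^2(A),q}:=(\sum_j|\xi_j|^2a_{j,q}^2)^{1/2}<\infty\text{ for all }q\in\mathbb N_0\}$, a Fréchet space with the seminorms $|\cdot|_{\lambda^2(A),q}$.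 In quotients $a_{j,q}/a_{j,r}$ the convention is $0/0=0$ and $a/0=\infty$ for $a>0$. A Fréchet space $X$ with an increasing fundamental system of seminorms $(\|\cdot\|_q)_{q\in\mathbb N_0}$ has the property (DN) if there is a continuous norm $\|\cdot\|$ on $X$ such that for all $q\in\mathbb N_0$ there are $r\in\mathbb N_0$ and $C>0$ with $\|x\|_q^2\le C\|x\|\,\|x\|_r$ for all $x\in X$. *)

(* Defs.v *)
From HB Require Import structures.
From mathcomp Require Import all_boot all_order all_algebra.
From mathcomp Require Import complex.
From mathcomp Require Import ring lra.
From mathcomp Require Import all_classical all_reals all_analysis.

Set Implicit Arguments.
Unset Strict Implicit.
Unset Printing Implicit Defensive.

Import Order.TTheory GRing.Theory Num.Theory.
Import numFieldNormedType.Exports.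

Local Open Scope classical_set_scope.
Local Open Scope ring_scope.
Local Open Scope complex_scope.

Notation normc := ComplexField.Normc.normc.

Section seminorms.
Context {R : realType} {E : lmodType R[i]}.

Definition is_seminorm (p : E -> R) : Prop :=
  (forall x y, p (x + y) <= p x + p y) /\
  (forall (c : R[i]) x, p (c *: x) = normc c * p x).

Definition is_norm (p : E -> R) : Prop :=
  is_seminorm p /\ forall x, p x = 0 -> x = 0.

(* An increasing sequence of seminorms. *)
Definition is_graded (p : nat -> E -> R) : Prop :=
  (forall q, is_seminorm (p q)) /\ (forall q x, p q x <= p q.+1 x).

(* Alias of [E] carrying the locally convex topology for which the balls
   {y | p q (y - x) < e} form a neighbourhood basis of x. *)
Definition graded_space (p : nat -> E -> R) (_ : is_graded p) : Type := E.

End seminorms.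

Section graded_topology.
Context {R : realType} {E : lmodType R[i]} (p : nat -> E -> R).
Context (pG : is_graded p).

Local Notation X := (graded_space pG).
HB.instance Definition _ := GRing.Lmodule.on X.

Definition graded_nbhs (x : X) : set_system X :=
  filter_from [set qe : nat * R | 0 < qe.2]
    (fun qe => [set y | p qe.1 (y - x : E) < qe.2]).

HB.instance Definition _ := hasNbhs.Build X graded_nbhs.

Lemma gradedD q (x y : E) : p q (x + y) <= p q x + p q y.
Proof. by have [/(_ q)[h _] _] := pG; exact: h. Qed.
Lemma gradedZ q c (x : E) : p q (c *: x) = normc c * p q x.
Proof. by have [/(_ q)[_ h] _] := pG; exact: h. Qed.
Lemma graded0 q : p q 0 = 0.
Proof. by rewrite -(scale0r 0) gradedZ ComplexField.Normc.normc0 mul0r. Qed.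
Lemma gradedN q (x : E) : p q (- x) = p q x.
Proof.
by rewrite -scaleN1r gradedZ /= oppr0 expr0n/= addr0 sqrrN expr1n sqrtr1 mul1r.
Qed.
Lemma graded_ge0 q (x : E) : 0 <= p q x.
Proof.
have := gradedD q x (- x); rewrite subrr graded0 gradedN -mulr2n.
by rewrite pmulrn_lge0.
Qed.
Lemma graded_le q r (x : E) : (q <= r)%N -> p q x <= p r x.
Proof.
move=> /subnK <-; elim: (r - q)%N => [|k ih]; first by rewrite add0n.
by rewrite addSn (le_trans ih)//; case: pG.
Qed.

Let nbhs_filter (x : X) : ProperFilter (nbhs x).
Proof.
split.
  move=> [[q e]] /= e0 /(_ x); apply => /=.
  by rewrite subrr graded0.
apply: filter_from_filter; first by exists (0%N, 1) => /=.
move=> [q e] [r d] /= e0 d0.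
exists (maxn q r, Num.min e d) => /=; first by rewrite lt_min e0 d0.
move=> y /=; rewrite lt_min => /andP[ye yd]; split.
  by apply: le_lt_trans ye; apply: graded_le; rewrite leq_maxl.
by apply: le_lt_trans yd; apply: graded_le; rewrite leq_maxr.
Qed.

Let nbhs_singleton (x : X) (A : set X) : nbhs x A -> A x.
Proof. by move=> [[q e]] /= e0; apply => /=; rewrite subrr graded0. Qed.

Let nbhs_nbhs (x : X) (A : set X) : nbhs x A -> nbhs x (nbhs^~ A).
Proof.
move=> [[q e]] /= e0 xA; exists (q, e) => // y /= xy.
exists (q, e - p q (y - x : E)) => /=; first by rewrite subr_gt0.
move=> z /=; rewrite ltrBrDr => yz; apply: xA => /=.
rewrite (le_lt_trans _ yz)// (le_trans _ (gradedD _ _ _))//.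
by rewrite addrA subrK.
Qed.

HB.instance Definition _ := Nbhs_isNbhsTopological.Build X
  nbhs_filter nbhs_singleton nbhs_nbhs.

Let add_cts : continuous (fun x : X * X => x.1 + x.2).
Proof.
move=> [x y] U [[q e]] /= e0 xU.
exists ([set z | p q (z - x : E) < e / 2], [set z | p q (z - y : E) < e / 2]).
  by split; exists (q, e / 2) => //=; rewrite divr_gt0.
move=> [z t] [/= zx ty]; apply: xU => /=.
by rewrite opprD addrACA (le_lt_trans (gradedD _ _ _))// (splitr e) ltrD.
Qed.

Let scale_cts : continuous (fun z : R[i]^o * X => z.1 *: z.2).
Proof.
move=> [c x] U [[q e]] /= e0 xU.
pose d := e / 2 / (normc c + 1).
have nc0 : 0 <= normc c by case: (c) => a b /=; exact: sqrtr_ge0.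
have d0 : 0 < d by rewrite !divr_gt0// ltr_wpDl.
pose M := p q (x : E) + d.
have M0 : 0 < M by rewrite ltr_wpDl// graded_ge0.
exists (ball c (e / 2 / M)%:C, [set z | p q (z - x : E) < d]).
  split; last by exists (q, d).
  by apply: nbhsx_ballx; rewrite ltcR !divr_gt0.
move=> [b z] [/= bc zx]; apply: xU => /=.
have {}bc : normc (b - c) < e / 2 / M.
  by move: bc; rewrite /ball/= distrC normc_def ltcR; case: (b - c).
have -> : b *: z - c *: x = (b - c) *: z + c *: (z - x).
  by rewrite scalerBl scalerBr addrA subrK.
rewrite (le_lt_trans (gradedD _ _ _))// !gradedZ (splitr e) ltr_leD//.
  rewrite (@le_lt_trans _ _ (normc (b - c) * M))//.
    rewrite ler_wpM2l//; first by case: (b - c) => ? ? /=; exact: sqrtr_ge0.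
    rewrite -(subrK (x : E) z) (le_trans (gradedD _ _ _))// addrC /M lerD2l.
    exact: ltW.
  by rewrite -ltr_pdivlMr.
rewrite (@le_trans _ _ (normc c * d))//; first by rewrite ler_wpM2l// ltW.
rewrite /d mulrCA ger_pMr ?divr_gt0//.
by rewrite ler_pdivrMr ?mul1r ?lerDl// ltr_wpDl.
Qed.

Let loc_convex : exists2 B : set_system X,
  (forall b, b \in B -> convex_set b) & basis B.
Proof.
pose bl x q (e : R) := [set y : X | p q (y - x : E) < e].
exists [set B | exists x q e, 0 < e /\ B = bl x q e].
  move=> B /[!inE] -[x [q [e [e0 ->]]]]; apply/convex_setW => y z.
  rewrite !inE /bl/= => yx zx l l0 l1; rewrite inE/=.
  rewrite (_ : _ - x = l%:num *: (y - x) + (1 - l%:num) *: (z - x)); last first.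
    by rewrite !scalerBr addrACA -opprD -scalerDl [_ + (1 - _)]addrC subrK scale1r.
  have [t tE] : exists t : R, l%:num = t%:C.
    move: l0; case: (l%:num) => u v; rewrite ltcE /= => /andP[/eqP -> _].
    by exists u.
  move: l0 l1; rewrite tE ltcR -[1]/(1%:C) ltcR => t0 t1.
  have -> : 1 - t%:C = (1 - t)%:C by rewrite rmorphB.
  rewrite (le_lt_trans (gradedD _ _ _))// !gradedZ /= expr0n/= !addr0.
  rewrite !sqrtr_sqr !gtr0_norm ?subr_gt0//.
  rewrite (_ : e = t * e + (1 - t) * e) ?ltrD//; last by ring.
  - by rewrite ltr_pM2l.
  - by rewrite ltr_pM2l// subr_gt0.
split.
  move=> B [x [q [e [e0 ->]]]]; rewrite openE => y /= yx.
  rewrite /interior; exists (q, e - p q (y - x : E)) => /=; first by rewrite subr_gt0.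
  move=> z /=; rewrite ltrBrDr /bl/= => yz.
  rewrite (le_lt_trans _ yz)// (le_trans _ (gradedD _ _ _))//.
  by rewrite addrA subrK.
move=> x B [[q e]] /= e0 xB; exists (bl x q e) => //; split.
  by exists x, q, e.
by rewrite /bl/= subrr graded0.
Qed.

HB.instance Definition _ := @PreTopologicalLmod_isTvs.Build R[i] X
  add_cts scale_cts loc_convex.
HB.instance Definition _ :=
  PreTopologicalNmodule_isTopologicalNmodule.Build X add_cts.
HB.instance Definition _ :=
  TopologicalNmodule_isTopologicalLmodule.Build R[i] X scale_cts.
HB.instance Definition _ := Uniform_isTvs.Build R[i] X loc_convex.

End graded_topology.

Section weighted_l2.
Context {R : realType}.
Implicit Types (w : nat -> R) (xi eta : nat -> R[i]).

(* Sequences are indexed from 0: entry [j] is the entry of index j + 1 in the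
   1-based convention. *)

Definition wsum w xi : \bar R :=
  (\sum_(0 <= j <oo) (normc (xi j) ^+ 2 * w j ^+ 2)%:E)%E.

Definition wnorm w xi : R := Num.sqrt (fine (wsum w xi)).

Lemma normcD (x y : R[i]) : normc (x + y) <= normc x + normc y.
Proof.
by have := ler_normD x y; rewrite !normc_def -rmorphD lecR; case: x y => ? ? [].
Qed.

Lemma normc_ge0 (x : R[i]) : 0 <= normc x.
Proof. by case: x => ? ?; exact: sqrtr_ge0. Qed.

Let term_ge0 w xi j : (0 <= (normc (xi j) ^+ 2 * w j ^+ 2)%:E)%E.
Proof. by rewrite lee_fin mulr_ge0 ?sqr_ge0. Qed.

Lemma wsum_ge0 w xi : (0 <= wsum w xi)%E.
Proof. exact: nneseries_ge0. Qed.

Lemma wsumZ w c xi : wsum w (c *: xi) = ((normc c ^+ 2)%:E * wsum w xi)%E.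
Proof.
rewrite /wsum -nneseriesZl; last by move=> j _; exact: term_ge0.
by apply: eq_eseriesr => j _; rewrite ComplexField.Normc.normcM exprMn -mulrA EFinM.
Qed.

Lemma wsum0 w : wsum w 0 = 0%E.
Proof.
apply: eseries0 => j _ _.
by rewrite ComplexField.Normc.normc0 expr0n mul0r.
Qed.

Let wsumD_weighted w xi eta (a b : R) : 0 < a -> 0 < b ->
  (wsum w (xi + eta)%R <=
   ((a + b) / a)%:E * wsum w xi + ((a + b) / b)%:E * wsum w eta)%E.
Proof.
move=> a0 b0; have ab0 : 0 < a + b by rewrite addr_gt0.
rewrite /wsum -!nneseriesZl; try by move=> j _; exact: term_ge0.
rewrite -nneseriesD; first last.
- by move=> j _ _; rewrite mule_ge0 ?term_ge0// lee_fin divr_ge0// ltW.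
- by move=> j _ _; rewrite mule_ge0 ?term_ge0// lee_fin divr_ge0// ltW.
apply: lee_nneseries => [j _ _|j _]; first exact: term_ge0.
rewrite -!EFinM -EFinD lee_fin ![_ / _ * (_ * _)]mulrA -mulrDl ler_wpM2r ?sqr_ge0//.
set x : R := normc (xi j); set y : R := normc (eta j).
rewrite (@le_trans _ _ ((x + y) ^+ 2))//.
  by rewrite ler_pXn2r ?nnegrE ?addr_ge0 ?normc_ge0// normcD.
rewrite -subr_ge0.
have -> : (a + b) / a * x * x + (a + b) / b * y * y - (x + y) ^+ 2 =
  (b * x - a * y) ^+ 2 / (a * b).
  by field; rewrite ?gt_eqF.
by rewrite divr_ge0 ?sqr_ge0// ltW// mulr_gt0.
Qed.

Lemma wsumD_lty w xi eta : (wsum w xi < +oo)%E -> (wsum w eta < +oo)%E ->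
  (wsum w (xi + eta)%R < +oo)%E.
Proof.
move=> hx hy; rewrite (le_lt_trans (wsumD_weighted w xi eta ltr01 ltr01))//.
by rewrite lte_add_pinfty// lte_mul_pinfty// ?lee_fin// divr_ge0// addr_ge0.
Qed.

Lemma wsumZ_lty w c xi : (wsum w xi < +oo)%E -> (wsum w (c *: xi)%R < +oo)%E.
Proof. by move=> hx; rewrite wsumZ lte_mul_pinfty// lee_fin sqr_ge0. Qed.

Lemma wnormZ w c xi : (wsum w xi < +oo)%E ->
  wnorm w (c *: xi) = normc c * wnorm w xi.
Proof.
move=> hx; have fx : wsum w xi \is a fin_num by rewrite ge0_fin_numE ?wsum_ge0.
rewrite /wnorm wsumZ fineM//.
rewrite /= sqrtrM ?sqr_ge0// sqrtr_sqr ger0_norm// ?normc_ge0//.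
Qed.

Lemma wnormD w xi eta : (wsum w xi < +oo)%E -> (wsum w eta < +oo)%E ->
  wnorm w (xi + eta) <= wnorm w xi + wnorm w eta.
Proof.
move=> hx hy.
have fx : wsum w xi \is a fin_num by rewrite ge0_fin_numE ?wsum_ge0.
have fy : wsum w eta \is a fin_num by rewrite ge0_fin_numE ?wsum_ge0.
have fxy : wsum w (xi + eta) \is a fin_num.
  by rewrite ge0_fin_numE ?wsum_ge0// wsumD_lty.
apply/ler_addgt0Pr => e e0.
set a := wnorm w xi; set b := wnorm w eta.
have a0 : 0 <= a by exact: sqrtr_ge0.
have b0 : 0 <= b by exact: sqrtr_ge0.
pose a' := a + e / 2; pose b' := b + e / 2.
have e20 : 0 < e / 2 by rewrite divr_gt0.
have a'0 : 0 < a' by rewrite ltr_wpDl.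
have b'0 : 0 < b' by rewrite ltr_wpDl.
have -> : a + b + e = a' + b' by rewrite /a' /b' addrACA -splitr.
rewrite -[leRHS]ger0_norm; last by rewrite addr_ge0// ltW.
rewrite -sqrtr_sqr ler_wsqrtr//.
have := wsumD_weighted w xi eta a'0 b'0.
rewrite -(fineK fx) -(fineK fy) -(fineK fxy) -!EFinM -EFinD lee_fin => /le_trans; apply.
have ea : fine (wsum w xi) = a ^+ 2 by rewrite sqr_sqrtr// fine_ge0// wsum_ge0.
have eb : fine (wsum w eta) = b ^+ 2 by rewrite sqr_sqrtr// fine_ge0// wsum_ge0.
have ab0 : 0 <= a' + b' by rewrite addr_ge0// ltW.
rewrite ea eb [leRHS]expr2 [leRHS]mulrDr lerD// -mulrA ler_wpM2l//.
  by rewrite mulrC ler_pdivrMr// -expr2 ler_pXn2r ?nnegrE ?(ltW a'0)// lerDl ltW.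
by rewrite mulrC ler_pdivrMr// -expr2 ler_pXn2r ?nnegrE ?(ltW b'0)// lerDl ltW.
Qed.

Lemma wsum_le w1 w2 xi : (forall j, 0 <= w1 j <= w2 j) ->
  (wsum w1 xi <= wsum w2 xi)%E.
Proof.
move=> h; apply: lee_nneseries => [j _ _|j _]; first exact: term_ge0.
have /andP[h0 h12] := h j.
by rewrite lee_fin ler_wpM2l ?sqr_ge0// ler_pXn2r// nnegrE// (le_trans h0).
Qed.

Lemma wnorm_le w1 w2 xi : (forall j, 0 <= w1 j <= w2 j) ->
  (wsum w2 xi < +oo)%E -> wnorm w1 xi <= wnorm w2 xi.
Proof.
move=> h fx; rewrite ler_wsqrtr// fine_le ?wsum_le// ge0_fin_numE ?wsum_ge0//.
exact: le_lt_trans (wsum_le _ h) fx.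
Qed.

End weighted_l2.

Record koethe_matrix (R : realType) := KoetheMatrix {
  koethe_val :> nat -> nat -> R;
  koethe_ge0 : forall j q, 0 <= koethe_val j q;
  koethe_gt0 : forall j, exists q, 0 < koethe_val j q;
  koethe_le : forall j q, koethe_val j q <= koethe_val j q.+1 }.

Section lambda2.
Context {R : realType} (A : koethe_matrix R).

Definition lambda2_pred : {pred nat -> R[i]} :=
  mem [set xi | forall q, (wsum (A ^~ q) xi < +oo)%E].

Record lambda2 : Type := Lambda2 {
  lambda2_val :> nat -> R[i];
  lambda2_valP : lambda2_val \in lambda2_pred }.

Lemma lambda2_fin q (x : lambda2) : (wsum (A ^~ q) x < +oo)%E.
Proof. by have := lambda2_valP x; rewrite inE => /(_ q). Qed.

HB.instance Definition _ := [isSub for lambda2_val].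
HB.instance Definition _ := [Choice of lambda2 by <:].

Let lambda2_submod_closed : submod_closed lambda2_pred.
Proof.
split=> [|c x y]; rewrite !inE; first by move=> q; rewrite wsum0 ltry.
by move=> hx hy q; rewrite wsumD_lty// wsumZ_lty.
Qed.
HB.instance Definition _ := GRing.isSubmodClosed.Build _ _ lambda2_pred
  lambda2_submod_closed.
HB.instance Definition _ := [SubChoice_isSubLmodule of lambda2 by <:].

Definition lambda2_norm (q : nat) (x : lambda2) : R := wnorm (A ^~ q) x.

Lemma lambda2_graded : is_graded lambda2_norm.
Proof.
split=> [q|q x].
  by split=> [x y|c x]; [apply: wnormD|apply: wnormZ]; exact: lambda2_fin.
by apply: wnorm_le (lambda2_fin _ _) => j; rewrite koethe_ge0 koethe_le.
Qed.

HB.instance Definition _ := Tvs.copy lambda2 (graded_space lambda2_graded).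

End lambda2.
Arguments lambda2_norm {R} A q x.

(* a / b with the conventions 0 / 0 = 0 and a / 0 = +oo for a > 0. *)
Definition koethe_quot {R : realType} (a b : R) : \bar R :=
  if a == 0 then 0%E else if b == 0 then +oo%E else (a / b)%:E.

Section rapidly_decreasing.
Context (R : realType).

Let rapid_weight j q : R := j.+1%:R ^+ q.

Let rapid_ge0 j q : 0 <= rapid_weight j q.
Proof. exact: exprn_ge0. Qed.
Let rapid_gt0 j : exists q, 0 < rapid_weight j q.
Proof. by exists 0%N; rewrite /rapid_weight expr0. Qed.
Let rapid_le j q : rapid_weight j q <= rapid_weight j q.+1.
Proof. by rewrite /rapid_weight ler_weXn2l// ler1n. Qed.

Definition rapid_matrix : koethe_matrix R :=
  KoetheMatrix rapid_ge0 rapid_gt0 rapid_le.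

(* s = lambda^2(j^q): the seminorms are literally those of s. *)
Definition sspace : Type := lambda2 rapid_matrix.
HB.instance Definition _ := Tvs.on sspace.

End rapidly_decreasing.

(* Bounded sets of a topological vector space: those absorbed by every
   neighbourhood of 0. *)
Definition vn_bounded {K : numDomainType} {E : preTopologicalLmodType K}
    (M : set E) : Prop :=
  forall U : set E, nbhs 0 U ->
    exists2 c : K, 0 < c & M `<=` [set c *: u | u in U].

Section dual.
Context (R : realType).

Let dual_weight q j : R := (j.+1%:R ^+ q)^-1.

Definition sdual_pred : {pred nat -> R[i]} :=
  mem [set xi | exists q, (wsum (dual_weight q) xi < +oo)%E].

Record sdual : Type := SDual {
  sdual_val :> nat -> R[i];
  sdual_valP : sdual_val \in sdual_pred }.

HB.instance Definition _ := [isSub for sdual_val].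
HB.instance Definition _ := [Choice of sdual by <:].

Let dual_weight_le q r j : (q <= r)%N -> 0 <= dual_weight r j <= dual_weight q j.
Proof.
move=> qr; rewrite invr_ge0 exprn_ge0//= lef_pV2 ?posrE ?exprn_gt0//.
by rewrite ler_weXn2l// ler1n.
Qed.

Let sdual_submod_closed : submod_closed sdual_pred.
Proof.
split=> [|c x y]; rewrite !inE; first by exists 0%N; rewrite wsum0 ltry.
move=> [q hx] [r hy]; exists (maxn q r).
apply: wsumD_lty; [apply: wsumZ_lty; apply: le_lt_trans hx|
  apply: le_lt_trans hy]; apply: wsum_le => j; apply: dual_weight_le.
- exact: leq_maxl.
- exact: leq_maxr.
Qed.
HB.instance Definition _ := GRing.isSubmodClosed.Build _ _ sdual_pred
  sdual_submod_closed.
HB.instance Definition _ := [SubChoice_isSubLmodule of sdual by <:].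

(* The identification of xi in s' with the functional x |-> sum_j xi_j x_j on s;
   the strong topology of s' is uniform convergence of these functionals on
   the bounded subsets of s. *)
Definition sdual_pairing (xi : sdual) :
    {family (@vn_bounded _ (sspace R)), sspace R -> R[i]^o} :=
  fun x => limn (series (fun j => xi j * x j : R[i]^o)).

HB.instance Definition _ := Topological.copy sdual
  (initial_topology sdual_pairing).

(* The inclusion of s in s'. *)
Definition s_incl (x : sspace R) : sdual.
Proof.
exists x; rewrite inE; exists 0%N.
rewrite (_ : dual_weight 0 = rapid_matrix R ^~ 0%N); first exact: lambda2_fin.
by apply/funext => j; rewrite /dual_weight /= expr0 invr1.
Defined.

Definition in_l2 (xi : nat -> R[i]) : Prop := (wsum (fun=> 1%R) xi < +oo)%E.

Definition l2_dot (xi eta : nat -> R[i]) : R[i]^o :=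
  limn (series (fun j => xi j * (eta j)^* : R[i]^o)).

(* Continuous linear operators from s' to s. *)
Definition Lss_pred : {pred sdual -> sspace R} :=
  mem [set T | linear T /\ continuous T].

Record Lss : Type := MkLss {
  Lss_val :> sdual -> sspace R;
  Lss_valP : Lss_val \in Lss_pred }.

HB.instance Definition _ := [isSub for Lss_val].
HB.instance Definition _ := [Choice of Lss by <:].

Let Lss_submod_closed : submod_closed Lss_pred.
Proof.
split=> [|c S T]; rewrite !inE.
  split=> [a x y|x]; first by rewrite /= scaler0 addr0.
  exact: (@cst_continuous _ _ (0 : sspace R)).
move=> [Sl Sc] [Tl Tc]; split=> [a x y|x].
  rewrite !fctE Sl Tl !scalerDr !scalerA [c * a]mulrC -!addrA.
  by congr (_ + _); rewrite addrCA.
have cS : (c *: S y : sspace R) @[y --> x] --> c *: S x.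
  apply: (@continuous_comp _ _ _ (fun y => (c : R[i]^o, S y))
    (fun z : R[i]^o * sspace R => z.1 *: z.2)); last exact: scale_continuous.
  apply: (@cvg_pair _ _ _ _ (nbhs (c : R[i]^o)) (nbhs (S x))); last exact: Sc.
    exact: nbhs_filter.
  by move=> U /nbhs_singleton Uc; apply: (@filterE _ (nbhs x)).
apply: (@continuous_comp _ _ _ (fun y => (c *: S y, T y))
  (fun z : sspace R * sspace R => z.1 + z.2)); last exact: add_continuous.
by apply: (@cvg_pair _ _ _ _ (nbhs (c *: S x)) (nbhs (T x)));
  [exact: nbhs_filter|exact: cS|exact: Tc].
Qed.
HB.instance Definition _ := GRing.isSubmodClosed.Build _ _ Lss_pred
  Lss_submod_closed.
HB.instance Definition _ := [SubChoice_isSubLmodule of Lss by <:].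

(* Topology of uniform convergence on the bounded subsets of s'. *)
Definition Lss_fun (T : Lss) :
  {family (@vn_bounded _ sdual), sdual -> sspace R} := T.

HB.instance Definition _ := Topological.copy Lss (initial_topology Lss_fun).

End dual.

Section algebra.
Context {R : realType}.
Implicit Types (S T U : Lss R) (B : set (Lss R)).

(* U = S \o T in L(s', s), s being embedded in s'. *)
Definition is_comp S T U : Prop := forall xi, U xi = S (s_incl (T xi)).

(* S is the Hilbert space adjoint of T, both restricted to l_2; an element of
   L(s', s) is determined by this restriction, l_2 being dense in s'. *)
Definition is_adjoint T S : Prop := forall xi eta : sdual R,
  in_l2 xi -> in_l2 eta -> l2_dot (T xi) eta = l2_dot xi (S eta).

Definition is_subspace {E : lmodType R[i]} (B : set E) : Prop :=
  B 0 /\ forall (c : R[i]) x y, B x -> B y -> B (c *: x + y).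

Definition is_star_subalgebra B : Prop :=
  [/\ is_subspace B,
      forall S T, B S -> B T -> exists2 U, B U & is_comp S T U
    & forall T, B T -> exists2 S, B S & is_adjoint T S].

Definition is_commutative B : Prop :=
  forall S T, B S -> B T -> forall xi, S (s_incl (T xi)) = T (s_incl (S xi)).

End algebra.

Section frechet.
Context {R : realType}.

(* Linear homeomorphism of E onto the subspace B of F. *)
Definition isomorphic_onto (E : preTopologicalLmodType R[i])
    {F : preTopologicalLmodType R[i]} (B : set F) : Prop :=
  exists (f : E -> F) (g : F -> E),
    [/\ linear f, range f = B, cancel f g, continuous f & {within B, continuous g}].

Definition metrizable (T : topologicalType) : Prop :=
  exists d : T -> T -> R,
    [/\ forall x y, d x y = 0 <-> x = y,
        forall x y, d x y = d y x,
        forall x y z, d x z <= d x y + d y z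
      & forall x, nbhs x =
          filter_from [set e : R | 0 < e] (fun e => [set y | d x y < e])].

Definition complete_space (T : uniformType) : Prop :=
  forall F : set_system T, ProperFilter F -> cauchy F -> exists x : T, F --> x.

(* Local convexity is part of [tvsType]. *)
Definition is_frechet (E : tvsType R[i]) : Prop :=
  metrizable E /\ complete_space E.

(* [p] is an increasing fundamental system of seminorms of [E]. *)
Definition property_DN (E : tvsType R[i]) (p : nat -> E -> R) : Prop :=
  exists nu : E -> R,
    [/\ is_norm nu, continuous nu
      & forall q, exists (r : nat) (C : R), 0 < C /\
          forall x, p q x ^+ 2 <= C * nu x * p r x].

(* (F, iota) is the Banach space completion of E / ker p normed by p. *)
Definition local_banach {E : lmodType R[i]} (p : E -> R)
    (F : completeNormedModType R[i]) (iota : E -> F) : Prop :=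
  [/\ linear iota, forall x, `|iota x| = (p x)%:C & dense (range iota)].

Definition nuclear_operator {E F : normedModType R[i]} (T : E -> F) : Prop :=
  exists (lam : nat -> R[i]) (phi : nat -> E -> R[i]^o) (y : nat -> F),
    [/\ (\sum_(0 <= k <oo) (normc (lam k))%:E < +oo)%E,
        forall k, linear (phi k) /\ forall x, `|phi k x| <= `|x|,
        forall k, `|y k| <= 1
      & forall x, series (fun k => (lam k * phi k x) *: y k) @ \oo --> T x].

(* For every q some canonical map E_r -> E_q between local Banach spaces is
   nuclear; [p] is an increasing fundamental system of seminorms of [E]. *)
Definition nuclear (E : tvsType R[i]) (p : nat -> E -> R) : Prop :=
  forall q, exists2 r, (q <= r)%N &
    exists (Er Eq : completeNormedModType R[i])
           (ir : E -> Er) (iq : E -> Eq) (T : Er -> Eq),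
      [/\ local_banach (p r) ir, local_banach (p q) iq,
          nuclear_operator T & forall x, T (ir x) = iq x].

End frechet.

(* Main.v *)
From HB Require Import structures.
Require Import Defs.
From mathcomp Require Import all_boot all_order all_algebra.
From mathcomp Require Import complex.
From mathcomp Require Import ring lra.
From mathcomp Require Import all_classical all_reals all_analysis.

(** All implications pass through the two conditions on the matrix, the
    summability of the quotients a_jq / a_jr and the inequality
    a_jq^2 <= C a_jp a_jr.

    From a closed subspace to the matrix.  Both s and L(s', s) consist of all
    functions on a countable index set (N, respectively N x N, through the
    matrix entries of an operator) that decay faster than every power of a
    weight w with summable w^-2, topologised by the norms sup |t_i| w_i^q
    ([sspace_model], [Lss_model]).  Evaluating an embedding of lambda^2(A) into
    such a space on the unit vectors, the inequality
    |y|_r^2 <= |y|_0 |y|_2r gives the second condition ([embedding_DN]), and the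
    fact that the inclusion between two consecutive weighted spaces is
    Hilbert-Schmidt gives the first one ([embedding_summable]).

    From the matrix to a subspace.  Dividing by a_jp and absorbing the constants
    turns the second condition into b_jq^2 <= b_j(q+1) with b_j0 = 1
    ([koethe_frame]).  Then there are vectors f_j in s with pairwise disjoint
    supports, hence orthogonal in l^2, whose q-th norms are equivalent to b_jq
    up to a shift of q: the vector f_j has one entry for each k, of size
    2^-k b_jk n^-k at a position n = n(j, k) with b_jk <= n <= D_k b_j(k+3)
    ([coef_ge], [coef_le]).  That such positions can be chosen without collisions
    is where the summability enters ([rank1_le], [pos_inj]).  The closed span of
    the f_j in s, and the closed span of the rank one operators
    f_j (x) f_j in L(s', s), are both isomorphic to lambda^2(A)
    ([pattern_isomorphic]); the second one is a commutative *-algebra because the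
    f_j are orthogonal and real.

    Nuclearity and (DN).  The norm of index p is a dominating norm and the local
    Banach spaces are l^2 spaces between which the canonical maps are diagonal
    ([koethe_nuclear], [koethe_property_DN]).  Conversely, the trace of a
    nuclear diagonal map bounds the sum of its entries ([nuclear_koethe]), and
    (DN) evaluated on unit vectors is the second condition
    ([property_DN_koethe]). *)

Set Implicit Arguments.
Unset Strict Implicit.
Unset Printing Implicit Defensive.

Import Order.TTheory GRing.Theory Num.Theory.
Import numFieldNormedType.Exports.

Local Open Scope classical_set_scope.
Local Open Scope ring_scope.
Local Open Scope complex_scope.

(** * Complex sequences *)

Section complex_sequences.
Context {R : realType}.
Implicit Types (z : R[i]).

Lemma normcR (x : R) : normc x%:C = `|x|.
Proof. by rewrite /= expr0n/= addr0 sqrtr_sqr. Qed.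

Lemma normcB z1 z2 : normc (z1 - z2) = normc (z2 - z1).
Proof. by rewrite -[LHS]normcN opprB. Qed.

Lemma normc_sum (I : Type) (s : seq I) (F : I -> R[i]) :
  normc (\sum_(i <- s) F i) <= \sum_(i <- s) normc (F i).
Proof.
elim/big_ind2 : _ => //; first by rewrite ComplexField.Normc.normc0.
by move=> x1 x2 y1 y2 h1 h2; rewrite (le_trans (normcD _ _))// lerD.
Qed.

Lemma normc_conj z : normc (z^*)%C = normc z.
Proof. by case: z => a b /=; rewrite sqrrN. Qed.

Lemma mulc_conj z : z * (z^*)%C = (normc z ^+ 2)%:C.
Proof.
case: z => a b /=; rewrite sqr_sqrtr ?addr_ge0 ?sqr_ge0//.
by apply/eqP; rewrite eq_complex /=; apply/andP; split; apply/eqP; ring.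
Qed.

Lemma norm_normc z : `|z| = (normc z)%:C.
Proof. by rewrite normc_def; case: z. Qed.

Lemma cvg_complexP (T : Type) (F : set_system T) (FF : Filter F)
    (h : T -> R[i]^o) (l : R[i]) :
  h x @[x --> F] --> (l : R[i]^o) <->
  forall e : R, 0 < e -> \forall x \near F, normc (h x - l) <= e.
Proof.
split=> [/cvgrPdist_le hl e e0|hl].
  have e0' : 0 < e%:C by rewrite ltcR.
  near=> x; rewrite normcB -lecR -norm_normc; near: x.
  exact: hl.
apply/cvgrPdist_le => -[e e'] /=; rewrite ltcE /= => /andP[/eqP -> e0].
near=> x; rewrite norm_normc normcB lecR; near: x; exact: hl.
Unshelve. all: by end_near. Qed.

Lemma normc_ReIm z : normc z <= `|complex.Re z| + `|complex.Im z|.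
Proof.
case: z => a b /=; rewrite -[leRHS]ger0_norm ?addr_ge0// -sqrtr_sqr.
rewrite ler_wsqrtr// sqrrD !real_normK ?num_real// addrAC lerDl.
by rewrite mulrn_wge0// mulr_ge0.
Qed.

Lemma Re_le_normc z : `|complex.Re z| <= normc z.
Proof. by case: z => a b /=; rewrite -sqrtr_sqr ler_wsqrtr// lerDl sqr_ge0. Qed.

Lemma Im_le_normc z : `|complex.Im z| <= normc z.
Proof. by case: z => a b /=; rewrite -sqrtr_sqr ler_wsqrtr// lerDr sqr_ge0. Qed.

(** Completeness of the complex numbers for filters, inherited from the real
    and imaginary parts. *)
Lemma cauchy_complex (T : Type) (F : set_system T) (FF : ProperFilter F)
    (h : T -> R[i]) :
  (forall e : R, 0 < e -> exists2 A, F A &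
     forall x y, A x -> A y -> normc (h x - h y) <= e) ->
  exists l : R[i], forall e : R, 0 < e ->
     \forall x \near F, normc (h x - l) <= e.
Proof.
move=> hC.
have part (g : R[i] -> R) : (forall x y, `|g x - g y| <= normc (x - y)) ->
    exists l : R, forall e : R, 0 < e -> \forall x \near F, `|g (h x) - l| <= e.
  move=> gh; have : cvg (g (h x) @[x --> F]).
    apply: cauchy_cvg; apply/cauchy_exP => e e0.
    have [|A FA Ah] := hC (e / 2); first by rewrite divr_gt0.
    have [x Ax] := filter_ex FA; exists (g (h x)).
    suff : F [set y | `|g (h x) - g (h y)| < e] by [].
    apply: filterS FA => y Ay /=.
    rewrite (le_lt_trans (gh _ _))// (le_lt_trans (Ah _ _ Ax Ay))//.
    by rewrite ltr_pdivrMr// ltr_pMr// ltr1n.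
  move=> /cvg_ex[l /cvgrPdist_le hl]; exists l => e e0.
  by near=> x; rewrite distrC; near: x; exact: hl.
have [|a ha] := part (@complex.Re R).
  by move=> x y; rewrite -raddfB; exact: Re_le_normc.
have [|b hb] := part (@complex.Im R).
  by move=> x y; rewrite -raddfB; exact: Im_le_normc.
exists (Complex a b) => e e0; near=> x.
rewrite (le_trans (normc_ReIm _))//= (splitr e) lerD//.
  have -> : complex.Re (h x - Complex a b) = complex.Re (h x) - a by rewrite raddfB.
  by near: x; apply: ha; rewrite divr_gt0.
have -> : complex.Im (h x - Complex a b) = complex.Im (h x) - b by rewrite raddfB.
by near: x; apply: hb; rewrite divr_gt0.
Unshelve. all: by end_near. Qed.

(** The k-th term is at most 2 / k.+1 - 2 / k.+2, and these differences
    telescope. *)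
Lemma sum_inv_sq (m n : nat) :
  \sum_(m <= k < n) (k.+1%:R ^+ 2)^-1 <= 2 / m.+1%:R :> R.
Proof.
have [nm|mn] := leqP n m; first by rewrite big_geq// divr_ge0.
suff : \sum_(m <= k < n) (k.+1%:R ^+ 2)^-1 <= 2 / m.+1%:R - 2 / n.+1%:R :> R.
  by move=> /le_trans; apply; rewrite gerBl divr_ge0.
have /subnKC <- := ltnW mn; elim: (n - m)%N => [|k ih].
  by rewrite addn0 big_geq// subrr.
rewrite addnS big_nat_recr ?leq_addr//= (le_trans (lerD ih (lexx _)))//.
rewrite -subr_ge0; set t : R := (m + k).+1%:R.
have t1 : 1 <= t by rewrite ler1n.
have -> : (m + k).+2%:R = t + 1 :> R by rewrite -natr1.
rewrite (_ : _ - _ = (t - 1) / (t ^+ 2 * (t + 1))); last first.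
  by field; rewrite !gt_eqF//; lra.
by rewrite divr_ge0//; [lra|rewrite mulr_ge0 ?sqr_ge0//; lra].
Qed.

(** The rate of convergence depends on the terms only through C; this is what
    makes limits of series uniform over bounded sets further on. *)
Lemma series_complex (x : nat -> R[i]) (C : R) :
  (forall n, normc (x n) * n.+1%:R ^+ 2 <= C) ->
  exists l : R[i], (forall N, normc (l - \sum_(0 <= k < N) x k) <= 2 * C / N.+1%:R)
    /\ limn (series (x : nat -> R[i]^o)) = l.
Proof.
move=> hx.
have C0 : 0 <= C by rewrite (le_trans _ (hx 0%N))// mulr_ge0 ?normc_ge0.
have tail m n : (m <= n)%N ->
    normc (\sum_(0 <= k < n) x k - \sum_(0 <= k < m) x k) <= 2 * C / m.+1%:R.
  move=> mn; rewrite (big_cat_nat (n := m))//= addrAC subrr add0r.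
  rewrite (le_trans (normc_sum _ _))//.
  rewrite (@le_trans _ _ (\sum_(m <= k < n) C * (k.+1%:R ^+ 2)^-1))//.
    by apply: ler_sum => k _; rewrite ler_pdivlMr// exprn_gt0.
  by rewrite -mulr_sumr mulrAC [_ * C]mulrC ler_wpM2l// sum_inv_sq.
have small e : 0 < e -> \forall N \near \oo, 2 * C / N.+1%:R <= e.
  move=> e0; near=> N; rewrite ler_pdivrMr// -ler_pdivrMl//.
  rewrite (@le_trans _ _ N%:R)// ?ler_nat//.
  by near: N; exact: nbhs_infty_ger.
have [|l hl] := @cauchy_complex nat \oo _ (fun N => \sum_(0 <= k < N) x k).
  move=> e e0; have [M _ hM] := small _ e0.
  exists [set n | (M <= n)%N]; first by exists M.
  move=> m n /= Mm Mn; have [mn|/ltnW nm] := leqP m n.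
    by rewrite normcB (le_trans (tail _ _ mn))// hM.
  by rewrite (le_trans (tail _ _ nm))// hM.
exists l; split=> [N|].
  apply/ler_addgt0Pl => e e0; have [M _ hM] := hl _ e0.
  pose n := maxn M N.
  rewrite -(subrKA (\sum_(0 <= k < n) x k)) (le_trans (normcD _ _))// lerD//.
    by rewrite normcB hM//= leq_maxl.
  by rewrite tail// leq_maxr.
apply: cvg_lim => //; apply/cvg_complexP => e e0; exact: hl.
Unshelve. all: by end_near. Qed.

End complex_sequences.

(** * Weighted square sums *)

Section weighted_sums.
Context {R : realType}.
Implicit Types (w : nat -> R) (x : nat -> R[i]).

Lemma wnorm_ge0 w x : 0 <= wnorm w x.
Proof. exact: sqrtr_ge0. Qed.

Lemma wsum_psum w x N :
  ((\sum_(0 <= j < N) normc (x j) ^+ 2 * w j ^+ 2)%:E <= wsum w x)%E.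
Proof.
rewrite -sumEFin /wsum; apply: nneseries_lim_ge => j _ _.
by rewrite lee_fin mulr_ge0 ?sqr_ge0.
Qed.

Lemma wnorm_sqr w x : (wsum w x < +oo)%E -> (wnorm w x ^+ 2)%:E = wsum w x.
Proof.
move=> hx; rewrite sqr_sqrtr ?fine_ge0 ?wsum_ge0// fineK//.
by rewrite ge0_fin_numE ?wsum_ge0.
Qed.

Lemma psum_le_wnorm w x N : (wsum w x < +oo)%E ->
  \sum_(0 <= j < N) normc (x j) ^+ 2 * w j ^+ 2 <= wnorm w x ^+ 2.
Proof. by move=> hx; rewrite -lee_fin wnorm_sqr// wsum_psum. Qed.

Lemma wsum_bound w x (c : R) : 0 <= c ->
  (forall N, \sum_(0 <= j < N) normc (x j) ^+ 2 * w j ^+ 2 <= c ^+ 2) ->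
  (wsum w x < +oo)%E /\ wnorm w x <= c.
Proof.
move=> c0 h; have hle : (wsum w x <= (c ^+ 2)%:E)%E.
  apply: lime_le.
    by apply: is_cvg_nneseries => j _ _; rewrite lee_fin mulr_ge0 ?sqr_ge0.
  by near=> N; rewrite sumEFin lee_fin.
have hlt : (wsum w x < +oo)%E by rewrite (le_lt_trans hle)// ltry.
split=> //; rewrite -[leRHS]ger0_norm// -sqrtr_sqr ler_wsqrtr//.
by rewrite -lee_fin fineK// ge0_fin_numE ?wsum_ge0.
Unshelve. all: by end_near. Qed.

Lemma wnorm_coord w x j : (wsum w x < +oo)%E -> 0 <= w j ->
  normc (x j) * w j <= wnorm w x.
Proof.
move=> hx wj; rewrite -(@ler_pXn2r _ 2)// ?nnegrE ?mulr_ge0 ?normc_ge0 ?wnorm_ge0//.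
rewrite exprMn (le_trans _ (psum_le_wnorm j.+1 hx))// big_nat_recr//= lerDr.
by rewrite sumr_ge0// => i _; rewrite mulr_ge0 ?sqr_ge0.
Qed.

Lemma wsum_finite w x N : (forall j, (N <= j)%N -> x j = 0) ->
  wsum w x = (\sum_(0 <= j < N) normc (x j) ^+ 2 * w j ^+ 2)%:E.
Proof.
move=> h; apply/eqP; rewrite eq_le wsum_psum andbT.
set S := \sum_(_ <= _ < _) _.
have S0 : 0 <= S by apply: sumr_ge0 => i _; rewrite mulr_ge0 ?sqr_ge0.
have [|hlt] := @wsum_bound w x (Num.sqrt S) (sqrtr_ge0 _).
  move=> M; rewrite sqr_sqrtr//; have [MN|/ltnW NM] := leqP M N.
    rewrite /S [leRHS](big_cat_nat (n := M))//= lerDl.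
    by apply: sumr_ge0 => i _; rewrite mulr_ge0 ?sqr_ge0.
  rewrite (big_cat_nat (n := N))//= gerDl big_nat_cond big1// => i.
  rewrite andbT => /andP[Ni _].
  by rewrite h// ComplexField.Normc.normc0 expr0n mul0r.
rewrite -(wnorm_sqr hlt) lee_fin => /(@lerXn2r _ 2); rewrite !nnegrE.
by rewrite wnorm_ge0 sqrtr_ge0 (sqr_sqrtr S0); apply.
Qed.

Lemma wnorm_finite w x N : (forall j, (N <= j)%N -> x j = 0) ->
  wnorm w x ^+ 2 = \sum_(0 <= j < N) normc (x j) ^+ 2 * w j ^+ 2.
Proof.
move=> h; apply: EFin_inj; rewrite wnorm_sqr (wsum_finite _ h)//; exact: ltry.
Qed.

(** Fatou's lemma for weighted square sums: the Cauchy estimate between h s and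
    h t passes to the limit in t on every finite partial sum. *)
Lemma wsum_cvg (T : Type) (F : set_system T) (FF : ProperFilter F)
    (h : T -> nat -> R[i]) (l : nat -> R[i]) w (A : set T) (e : R) :
  (forall j, 0 <= w j) ->
  (forall j d, 0 < d -> \forall x \near F, normc (h x j - l j) <= d) ->
  F A ->
  (forall s t : T, A s -> A t ->
     (wsum w (h s - h t)%R < +oo)%E /\ wnorm w (h s - h t) <= e) ->
  forall s, A s -> (wsum w (h s - l)%R < +oo)%E /\ wnorm w (h s - l) <= e.
Proof.
move=> w0 hl FA hA x Ax.
have e0 : 0 <= e by have [_] := hA x x Ax Ax; apply: le_trans; exact: wnorm_ge0.
apply: wsum_bound => // N.
(* The error of size d in each of N coordinates costs d * sqrt D; the summand 1
   keeps D positive. *)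
pose D := (\sum_(0 <= j < N) w j ^+ 2 + 1 : R).
have D0 : 0 < D by rewrite ltr_wpDl// sumr_ge0// => i _; exact: sqr_ge0.
suff key d : 0 < d -> Num.sqrt (\sum_(0 <= j < N) normc ((h x - l) j) ^+ 2 * w j ^+ 2)
    <= e + d * Num.sqrt D.
  set S := \sum_(_ <= _ < _) _ in key *.
  have S0 : 0 <= S by apply: sumr_ge0 => i _; rewrite mulr_ge0 ?sqr_ge0.
  rewrite -[S]sqr_sqrtr// ler_pXn2r ?nnegrE ?sqrtr_ge0//.
  apply/ler_addgt0Pr => d d0; have sD0 : 0 < Num.sqrt D by rewrite sqrtr_gt0.
  by rewrite (le_trans (key (d / Num.sqrt D) _)) ?divr_gt0// divfK// gt_eqF.
move=> d0.
have /filter_ex[y [Ay yl]] : \forall y \near F, A y /\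
    forall j, (j < N)%N -> normc (h y j - l j) <= d.
  apply: filterI => //; elim: N {D D0} => [|N ih].
    by apply: filterE => y j.
  apply: filterS2 ih (hl N d d0) => y hy hN j.
  by rewrite ltnS leq_eqVlt => /orP[/eqP ->|/hy].
pose u := (fun j => if (j < N)%N then (h x - h y) j else 0) : nat -> R[i].
pose v := (fun j => if (j < N)%N then (h y - l) j else 0) : nat -> R[i].
have u0 j : (N <= j)%N -> u j = 0 by rewrite /u leqNgt => /negbTE ->.
have v0 j : (N <= j)%N -> v j = 0 by rewrite /v leqNgt => /negbTE ->.
have uv0 j : (N <= j)%N -> (u + v) j = 0.
  by move=> Nj; rewrite fctE u0 ?v0 ?addr0.
have fu : (wsum w u < +oo)%E by rewrite (wsum_finite _ u0) ltry.
have fv : (wsum w v < +oo)%E by rewrite (wsum_finite _ v0) ltry.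
have -> : Num.sqrt (\sum_(0 <= j < N) normc ((h x - l) j) ^+ 2 * w j ^+ 2) =
    wnorm w (u + v).
  rewrite /wnorm (wsum_finite _ uv0)/=; congr Num.sqrt.
  apply: eq_big_nat => j /andP[_ jN].
  by rewrite /u /v !fctE jN addrA subrK.
rewrite (le_trans (wnormD fu fv))// lerD//.
  have [hf hle] := hA x y Ax Ay; apply: le_trans hle.
  rewrite -(@ler_pXn2r _ 2)// ?nnegrE ?wnorm_ge0//.
  rewrite (wnorm_finite _ u0) (le_trans _ (psum_le_wnorm N hf))//.
  by rewrite le_eqVlt; apply/orP; left; apply/eqP/eq_big_nat => j /andP[_ jN];
    rewrite /u jN.
rewrite -(@ler_pXn2r _ 2)// ?nnegrE ?wnorm_ge0 ?mulr_ge0 ?sqrtr_ge0 ?(ltW d0)//.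
rewrite (wnorm_finite _ v0) exprMn (sqr_sqrtr (ltW D0)) mulrDr mulr_sumr.
rewrite ler_wpDr ?mulr1 ?sqr_ge0//; apply: ler_sum_nat => j /andP[_ jN].
rewrite ler_wpM2r ?sqr_ge0// /v jN ler_pXn2r ?nnegrE ?normc_ge0 ?(ltW d0)//.
exact: yl.
Qed.

(** Summability of the quotients amounts to a bound on real partial sums; the
    convention on zero denominators is harmless once a vanishing b_j forces
    a_j to vanish. *)
Lemma koethe_quot_bound (a b : nat -> R) (K : R) :
  (forall j, 0 <= a j) -> (forall j, a j != 0 -> 0 < b j) ->
  (forall N, \sum_(0 <= j < N) a j / b j <= K) ->
  (\sum_(0 <= j <oo) koethe_quot (a j) (b j) < +oo)%E.
Proof.
move=> a0 b0 h; have qE j : koethe_quot (a j) (b j) = (a j / b j)%:E.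
  rewrite /koethe_quot; case: eqVneq => [->|aj]; first by rewrite mul0r.
  by rewrite gt_eqF// b0.
apply: (@le_lt_trans _ _ K%:E); last exact: ltry.
apply: lime_le.
  apply: is_cvg_nneseries => j _ _; rewrite qE lee_fin.
  have [->|aj] := eqVneq (a j) 0; first by rewrite mul0r.
  by rewrite divr_ge0// ltW// b0.
near=> N; rewrite (eq_bigr (fun j => (a j / b j)%:E)); last by move=> j _; rewrite qE.
by rewrite sumEFin lee_fin.
Unshelve. all: by end_near. Qed.

Lemma koethe_quot_psum (a b : nat -> R) :
  (forall j, 0 <= a j) -> (forall j, 0 <= b j) ->
  (\sum_(0 <= j <oo) koethe_quot (a j) (b j) < +oo)%E ->
  exists K : R, forall N, \sum_(0 <= j < N) a j / b j <= K.
Proof.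
move=> a0 b0; set S := (\sum_(_ <= _ <oo) _)%E => hS.
have q0 j : (0 <= koethe_quot (a j) (b j))%E.
  by rewrite /koethe_quot; case: eqP => // _; case: eqP => // _; rewrite lee_fin divr_ge0.
have qE j : ((a j / b j)%:E <= koethe_quot (a j) (b j))%E.
  rewrite /koethe_quot; case: eqVneq => [->|_]; first by rewrite mul0r.
  by case: eqP => // _; exact: leey.
have S0 : (0 <= S)%E by apply: nneseries_ge0 => j _ _; exact: q0.
exists (fine S) => N; rewrite -lee_fin fineK ?ge0_fin_numE// -sumEFin.
rewrite (@le_trans _ _ (\sum_(0 <= j < N) koethe_quot (a j) (b j))%E)//.
  by apply: lee_sum => j _; exact: qE.
by apply: nneseries_lim_ge => j _ _; exact: q0.
Qed.

End weighted_sums.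

(** * The spaces lambda^2(A) *)

Section lambda2_theory.
Context {R : realType} (A : koethe_matrix R).
Implicit Types (x y : lambda2 A).

Lemma koethe_homo j q r : (q <= r)%N -> A j q <= A j r.
Proof.
move=> /subnK <-; elim: (r - q)%N => [|k ih]; first by rewrite add0n.
by rewrite addSn (le_trans ih)// koethe_le.
Qed.

Lemma lambda2P (c : R[i]) x y j : (c *: x + y) j = c * x j + y j.
Proof. by []. Qed.

Lemma lambda2B x y j : (x - y) j = x j - y j.
Proof. by []. Qed.

Lemma lambda2_eqP x y : (forall j, x j = y j) -> x = y.
Proof. by move=> h; apply: val_inj; apply/funext => j; exact: h. Qed.

Definition lambda2_of (xi : nat -> R[i])
    (h : forall q, (wsum (A ^~ q) xi < +oo)%E) : lambda2 A.
Proof. by exists xi; rewrite inE. Defined.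

Let trunc_lty (z : nat -> R[i]) N q :
  (wsum (A ^~ q) (fun j => if (j < N)%N then z j else 0%R) < +oo)%E.
Proof.
by rewrite (@wsum_finite _ _ _ N) ?ltry// => j; rewrite leqNgt => /negbTE ->.
Qed.

Definition lambda2_trunc (z : nat -> R[i]) N : lambda2 A :=
  lambda2_of (trunc_lty z N).

Definition lambda2_delta n : lambda2 A :=
  lambda2_trunc (fun j => (j == n)%:R) n.+1.

Lemma lambda2_deltaE n j : lambda2_delta n j = (j == n)%:R.
Proof.
rewrite /=; case: ltnP => // nj; rewrite (_ : (j == n) = false)//.
by apply/negbTE; rewrite neq_ltn nj orbT.
Qed.

Lemma lambda2_truncE z N :
  lambda2_trunc z N = \sum_(0 <= j < N) z j *: lambda2_delta j.
Proof.
elim: N => [|N ih]; first by rewrite big_geq//; apply: lambda2_eqP.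
rewrite big_nat_recr//= -ih addrC; apply: lambda2_eqP => j.
rewrite lambda2P lambda2_deltaE /= ltnS leq_eqVlt; case: eqVneq => [->|_] /=.
  by rewrite ltnn mulr1 addr0.
by rewrite mulr0 add0r.
Qed.

Lemma lambda2_norm_trunc q z N : lambda2_norm A q (lambda2_trunc z N) ^+ 2 =
  \sum_(0 <= j < N) normc (z j) ^+ 2 * A j q ^+ 2.
Proof.
rewrite /lambda2_norm (@wnorm_finite _ _ _ N) => [|j]; last first.
  by rewrite /= leqNgt => /negbTE ->.
by apply: eq_big_nat => j /andP[_ /= ->].
Qed.

Lemma lambda2_norm_delta q n : lambda2_norm A q (lambda2_delta n) = A n q.
Proof.
apply/eqP; rewrite -(@eqrXn2 _ 2)// ?wnorm_ge0 ?koethe_ge0//.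
rewrite lambda2_norm_trunc big_nat_recr//= eqxx ComplexField.Normc.normc1.
rewrite expr1n mul1r big_nat_cond big1 ?add0r// => j.
rewrite andbT => /andP[_ jn]; rewrite ltn_eqF//.
by rewrite ComplexField.Normc.normc0 expr0n mul0r.
Qed.

Lemma lambda2_coord q x j : normc (x j) * A j q <= lambda2_norm A q x.
Proof. by apply: wnorm_coord; [exact: lambda2_fin|exact: koethe_ge0]. Qed.

Lemma lambda2_norm_le q r x : (q <= r)%N -> lambda2_norm A q x <= lambda2_norm A r x.
Proof. exact: (graded_le (lambda2_graded A)). Qed.

Lemma lambda2_norm_ge0 q x : 0 <= lambda2_norm A q x.
Proof. exact: wnorm_ge0. Qed.

Lemma lambda2_normZ q c x : lambda2_norm A q (c *: x) = normc c * lambda2_norm A q x.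
Proof. exact: (gradedZ (lambda2_graded A)). Qed.

Lemma lambda2_norm0 q : lambda2_norm A q 0 = 0.
Proof. exact: (graded0 (lambda2_graded A)). Qed.

Lemma nbhs_lambda2P x (U : set (lambda2 A)) : nbhs x U <->
  exists q e, 0 < e /\ forall y, lambda2_norm A q (y - x) < e -> U y.
Proof.
split=> [[[q e] /= e0 h]|[q [e [e0 h]]]]; first by exists q, e.
by exists (q, e).
Qed.

Lemma entourage_lambda2P (E : set (lambda2 A * lambda2 A)) : entourage E <->
  exists q e, 0 < e /\ forall x y, lambda2_norm A q (x - y) < e -> E (x, y).
Proof.
split=> [[U [[[q e] /= e0 hU] h]]|[q [e [e0 h]]]].
  exists q, e; split=> // x y xy; have := h (x, y); rewrite !inE; apply.
  by apply: hU => /=; rewrite subr0.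
exists [set y | lambda2_norm A q y < e]; split; last first.
  by move=> [x y]; rewrite !inE /=; exact: h.
by exists (q, e) => //= y; rewrite /= subr0.
Qed.

End lambda2_theory.

(** * The two conditions on a matrix *)

Definition koethe_summable {R : realType} (A : koethe_matrix R) : Prop :=
  forall q : nat, exists r : nat,
    (\sum_(0 <= j <oo) koethe_quot (A j q) (A j r) < +oo)%E.

Definition koethe_DN {R : realType} (A : koethe_matrix R) : Prop :=
  exists p : nat, forall q : nat, exists (r : nat) (C : R), 0 < C /\
    forall j, A j q ^+ 2 <= C * A j p * A j r.

Section koethe_conditions.
Context {R : realType} (A : koethe_matrix R).

(** A vanishing a_jp would make a_jq vanish for every q. *)
Lemma koethe_DN_gt0 p : (forall q, exists (r : nat) (C : R), 0 < C /\
    forall j, A j q ^+ 2 <= C * A j p * A j r) -> forall j, 0 < A j p.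
Proof.
move=> h j; have [q aq] := koethe_gt0 A j; have [r [C [C0 /(_ j)]]] := h q.
rewrite lt_neqAle koethe_ge0 andbT; case: eqVneq => // <-.
by rewrite mulr0 mul0r leNgt exprn_gt0.
Qed.

Lemma koethe_quot_ge0 (a b : R) : 0 <= a -> 0 <= b -> (0 <= koethe_quot a b)%E.
Proof.
move=> a0 b0; rewrite /koethe_quot; case: eqP => // _; case: eqP => // _.
by rewrite lee_fin divr_ge0.
Qed.

Lemma koethe_quot_le (a b c : R) : 0 <= a -> 0 <= b -> b <= c ->
  (koethe_quot a c <= koethe_quot a b)%E.
Proof.
move=> a0 b0 bc; rewrite /koethe_quot; case: eqP => // _.
have [b00|b00] := eqVneq b 0; first by rewrite leey.
have b0' : 0 < b by rewrite lt_def b00.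
rewrite gt_eqF ?(lt_le_trans b0')// lee_fin ler_wpM2l// lef_pV2 ?posrE//.
exact: lt_le_trans bc.
Qed.

(** Increasing r only decreases the quotients, so r can be taken beyond a level
    p from which on the matrix has no zeros. *)
Lemma koethe_summable_bound p q : koethe_summable A ->
  exists2 r, (p <= r)%N & exists K : R, forall N, \sum_(0 <= j < N) A j q / A j r <= K.
Proof.
move=> /(_ q)[r hr]; exists (maxn p r); rewrite ?leq_maxl//.
apply: koethe_quot_psum => [j|j|]; [exact: koethe_ge0|exact: koethe_ge0|].
apply: le_lt_trans hr; apply: lee_nneseries => [j _ _|j _].
  by apply: koethe_quot_ge0; exact: koethe_ge0.
by apply: koethe_quot_le; rewrite ?koethe_ge0// koethe_homo// leq_maxr.
Qed.

End koethe_conditions.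

(** Coordinates co identifying E with the space of all functions on I that decay
    faster than every power of w, with the topology of the weighted sup norms.
    Both s and L(s', s) are of this form.  By the summability of w^-2 the sup
    norms could be replaced by weighted l^2 norms; sup norms are the choice for
    which the model of L(s', s) is as simple as that of s. *)
Record sup_model {R : realType} (E : preTopologicalLmodType R[i])
    (I : choiceType) (w : I -> R) (co : E -> I -> R[i]) : Prop := SupModel {
  model_lin : forall c x y i, co (c *: x + y) i = c * co x i + co y i ;
  model_inj : forall x y, (forall i, co x i = co y i) -> x = y ;
  model_rapid : forall x q, exists C : R, forall i, normc (co x i) * w i ^+ q <= C ;
  model_surj : forall t : I -> R[i],
    (forall q, exists C : R, forall i, normc (t i) * w i ^+ q <= C) ->
    exists x, forall i, co x i = t i ;
  model_nbhs : forall x (U : set E), nbhs x U <-> exists q (e : R), 0 < e /\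
    forall y, (forall i, normc (co y i - co x i) * w i ^+ q <= e) -> U y ;
  model_ge1 : forall i, 1 <= w i ;
  model_sum : exists W : R, forall s : seq I, uniq s ->
    \sum_(i <- s) (w i ^+ 2)^-1 <= W }.

(** * Embeddings of lambda^2(A) into rapidly decreasing functions *)

Section linear_maps.
Context {R : realType} {E F : lmodType R[i]} (f : E -> F) (fl : linear f).

Lemma lin0 : f 0 = 0.
Proof. by have := fl (-1) 0 0; rewrite scaler0 addr0 scaleN1r addNr. Qed.

Lemma linZ c x : f (c *: x) = c *: f x.
Proof. by have := fl c x 0; rewrite lin0 !addr0. Qed.

Lemma linD x y : f (x + y) = f x + f y.
Proof. by have := fl 1 x y; rewrite !scale1r. Qed.

Lemma linB x y : f (x - y) = f x - f y.
Proof. by rewrite linD -scaleN1r linZ scaleN1r. Qed.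

Lemma linsum (K : nat) (c : nat -> R[i]) (x : nat -> E) :
  f (\sum_(0 <= k < K) c k *: x k) = \sum_(0 <= k < K) c k *: f (x k).
Proof.
elim: K => [|K ih]; first by rewrite !big_geq// lin0.
by rewrite !big_nat_recr//= linD linZ ih.
Qed.

End linear_maps.

Section embedding.
Context {R : realType} (A : koethe_matrix R).
Context {E : preTopologicalLmodType R[i]} {I : choiceType} (i0 : I).
Context (w : I -> R) (co : E -> I -> R[i]) (mE : sup_model w co).

Lemma model0 i : co 0 i = 0.
Proof.
by have := model_lin mE (-1) 0 0 i; rewrite scaler0 addr0 mulN1r addNr.
Qed.

Lemma modelZ c x i : co (c *: x) i = c * co x i.
Proof. by have := model_lin mE c x 0 i; rewrite addr0 model0 addr0. Qed.

Lemma modelD x y i : co (x + y) i = co x i + co y i.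
Proof. by have := model_lin mE 1 x y i; rewrite scale1r mul1r. Qed.

Lemma modelB x y i : co (x - y) i = co x i - co y i.
Proof. by rewrite modelD -scaleN1r modelZ mulN1r. Qed.

Lemma model_wgt0 i q : 0 < w i ^+ q.
Proof. by rewrite exprn_gt0// (lt_le_trans ltr01)// (model_ge1 mE). Qed.

Context (B : set E) (f : lambda2 A -> E) (g : E -> lambda2 A).
Context (fl : linear f) (fB : range f = B) (fg : cancel f g).
Context (fc : continuous f) (gc : {within B, continuous g}).

(** Scaling x to a seminorm just below e turns continuity at 0 into an estimate;
    as the seminorm of x may vanish, the scaling factor is e / (|x| + d e) with an
    arbitrary d > 0. *)
Lemma embedding_up r : exists (q : nat) (C : R), 0 < C /\ forall x i,
  normc (co (f x) i) * w i ^+ r <= C * lambda2_norm A q x.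
Proof.
have /fc : nbhs (f 0) [set y | forall i, normc (co y i - co (f 0) i) * w i ^+ r <= 1].
  by apply/(model_nbhs mE); exists r, 1.
move=> /nbhs_lambda2P[q [e [e0 h]]]; exists q, e^-1; rewrite invr_gt0; split=> //.
move=> x i; apply/ler_addgt0Pr => d d0; set p := lambda2_norm A q x.
have p0 : 0 <= p by exact: lambda2_norm_ge0.
have t0 : 0 < p + d * e by rewrite ltr_wpDl// mulr_gt0.
have := h ((e / (p + d * e))%:C *: x); rewrite subr0 lambda2_normZ normcR.
rewrite ger0_norm ?divr_ge0 ?(ltW e0) ?(ltW t0)// -/p.
have -> : e / (p + d * e) * p < e.
  by rewrite -mulrA gtr_pMr// mulrC ltr_pdivrMr// mul1r ltrDl mulr_gt0.
move=> /(_ isT)/= /(_ i); rewrite (lin0 fl) model0 subr0 (linZ fl) modelZ.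
rewrite ComplexField.Normc.normcM normcR.
rewrite ger0_norm ?divr_ge0 ?(ltW e0) ?(ltW t0)// -mulrA -ler_pdivlMl ?divr_gt0//.
rewrite mulr1 invf_div => /le_trans; apply.
by rewrite mulrDl mulfK ?gt_eqF// mulrC.
Qed.

(** The same scaling for the inverse, with the weighted sup norm of f x replaced
    by any upper bound c. *)
Lemma embedding_lo q : exists (r : nat) (C : R), 0 < C /\ forall x c,
  (forall i, normc (co (f x) i) * w i ^+ r <= c) -> lambda2_norm A q x <= C * c.
Proof.
have Bf0 : B (f 0) by rewrite -fB; exists 0.
have : nbhs (g (f 0)) [set y | lambda2_norm A q (y - g (f 0)) < 1].
  by apply/nbhs_lambda2P; exists q, 1.
move/subspace_continuousP : gc => /(_ _ Bf0) /[apply].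
rewrite fg => /(model_nbhs mE)[r [e [e0 hg]]]; exists r, e^-1.
have {hg}h y : (forall i, normc (co y i - co (f 0) i) * w i ^+ r <= e) -> B y ->
    lambda2_norm A q (g y) < 1.
  by move=> h1 h2; have := hg y h1 h2; rewrite /= subr0.
rewrite invr_gt0; split=> // x c hc; apply/ler_addgt0Pr => d d0.
have c0 : 0 <= c.
  by rewrite (le_trans _ (hc i0))// mulr_ge0 ?normc_ge0// ltW// model_wgt0.
have t0 : 0 < c + d * e by rewrite ltr_wpDl// mulr_gt0.
have := h (f ((e / (c + d * e))%:C *: x)); rewrite fg lambda2_normZ normcR.
rewrite ger0_norm ?divr_ge0 ?(ltW e0) ?(ltW t0)//.
have hB : B (f ((e / (c + d * e))%:C *: x)) by rewrite -fB; eexists.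
move=> H; have {H} : e / (c + d * e) * lambda2_norm A q x < 1.
  apply: H; last exact: hB.
  move=> i; rewrite (lin0 fl) model0 subr0 (linZ fl) modelZ.
  rewrite ComplexField.Normc.normcM normcR.
  rewrite ger0_norm ?divr_ge0 ?(ltW e0) ?(ltW t0)// -mulrA.
  rewrite (le_trans (ler_wpM2l _ (hc i))) ?divr_ge0 ?(ltW e0) ?(ltW t0)//.
  by rewrite -mulrA ger_pMr// mulrC ler_pdivrMr// mul1r lerDl mulr_ge0 ?ltW.
rewrite -ltr_pdivlMl ?divr_gt0// mulr1 invf_div => /ltW/le_trans; apply.
by rewrite mulrDl mulfK ?gt_eqF// mulrC.
Qed.

(** On unit vectors: |f x|_r^2 <= |f x|_0 |f x|_2r, since
    (t w^r)^2 = t (t w^2r). *)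
Lemma embedding_DN : koethe_DN A.
Proof.
have [p [C0 [C00 h0]]] := embedding_up 0.
exists p => q; have [r [C [C_gt0 hlo]]] := embedding_lo q.
have [r' [C' [C'_gt0 hup]]] := embedding_up (r + r).
exists r', (C ^+ 2 * (C0 * C')); split; first by rewrite !mulr_gt0 ?exprn_gt0.
move=> j; pose x := lambda2_delta A j.
have pr0 : 0 <= C0 * A j p * (C' * A j r').
  by rewrite !mulr_ge0 ?koethe_ge0// ltW.
have := hlo x (Num.sqrt (C0 * A j p * (C' * A j r'))).
rewrite lambda2_norm_delta => H.
have {H} : A j q <= C * Num.sqrt (C0 * A j p * (C' * A j r')).
  apply: H => i; rewrite -(@ler_pXn2r _ 2)// ?nnegrE ?sqrtr_ge0//; last first.
    by rewrite mulr_ge0 ?normc_ge0// ltW// model_wgt0.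
  rewrite sqr_sqrtr// exprMn -exprM muln2 -addnn expr2 -mulrA.
  have := h0 x i; rewrite expr0 mulr1 lambda2_norm_delta => h0x.
  rewrite ler_pM ?normc_ge0 ?mulr_ge0 ?normc_ge0 ?(ltW (model_wgt0 _ _))//.
  by have := hup x i; rewrite lambda2_norm_delta.
move=> /(@lerXn2r _ 2); rewrite !nnegrE koethe_ge0 mulr_ge0 ?sqrtr_ge0 ?(ltW C_gt0)//.
move=> /(_ isT isT); rewrite exprMn sqr_sqrtr//.
by rewrite (_ : C ^+ 2 * (C0 * A j p * _) = C ^+ 2 * (C0 * C') * A j p * A j r')//; ring.
Qed.

Lemma embedding_lin (z : nat -> R[i]) N i :
  co (f (lambda2_trunc A z N)) i =
  \sum_(0 <= j < N) z j * co (f (lambda2_delta A j)) i.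
Proof.
rewrite lambda2_truncE; elim: N => [|N ih].
  by rewrite !big_geq// (lin0 fl) model0.
by rewrite !big_nat_recr//= (linD fl) modelD ih (linZ fl) modelZ.
Qed.

(** The Hilbert-Schmidt argument.  Normalise u_j = f e_j / a_jr'.  For a fixed
    coordinate i, boundedness of f on l^2 combinations of the e_j / a_jr' gives
    sum_j |u_j(i)|^2 <= C w_i^(-2r-2) (usum).  On the other hand a_jq is
    controlled by one coordinate ii j of f e_j at which the sup norm of weight r
    is almost attained; grouping the j with the same ii j, the sum of the
    (a_jq / a_jr')^2 is at most C sum_i w_i^(2r) w_i^(-2r-2), which is finite. *)
Lemma embedding_square_summable p q : (forall j, 0 < A j p) ->
  exists2 r, (p <= r)%N & exists K : R, forall N,
    \sum_(0 <= j < N) (A j q / A j r) ^+ 2 <= K.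
Proof.
move=> Ap; have [r [C [C_gt0 hlo]]] := embedding_lo q.
have [r0 [C' [C'_gt0 hup0]]] := embedding_up r.+1.
pose r' := maxn p r0; have hup x i : normc (co (f x) i) * w i ^+ r.+1 <= C' * lambda2_norm A r' x.
  by rewrite (le_trans (hup0 _ _))// ler_wpM2l ?(ltW C'_gt0)// lambda2_norm_le// leq_maxr.
have Ar j : 0 < A j r' by rewrite (lt_le_trans (Ap j))// koethe_homo// leq_maxl.
exists r'; first exact: leq_maxl.
have [W hW] := model_sum mE.
pose u j i := co (f (lambda2_delta A j)) i / (A j r')%:C.
have normu j i : normc (u j i) = normc (co (f (lambda2_delta A j)) i) / A j r'.
  rewrite /u ComplexField.Normc.normcM ComplexField.Normc.normcV normcR.
  by rewrite gtr0_norm.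
(* Test on the combination whose coefficients are the conjugates of the
   u j i: its image has the sum S as i-th coordinate, and its norm is the square
   root of S. *)
have usum N i : \sum_(0 <= j < N) normc (u j i) ^+ 2 <= C' ^+ 2 / (w i ^+ r.+1) ^+ 2.
  set S := \sum_(_ <= _ < _) _; have S0 : 0 <= S by apply: sumr_ge0 => j _; exact: sqr_ge0.
  pose z j := (u j i)^*%C / (A j r')%:C.
  have := hup (lambda2_trunc A z N) i; rewrite embedding_lin.
  have -> : \sum_(0 <= j < N) z j * co (f (lambda2_delta A j)) i = S%:C.
    rewrite /S rmorph_sum; apply: eq_bigr => j _.
    transitivity ((normc (u j i) ^+ 2)%:C) => //.
    rewrite -mulc_conj /z; move: ((u j i)^*%C) => v.
    by rewrite /u [RHS]mulrC mulrA mulrAC.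
  rewrite normcR ger0_norm// => hS.
  have : S * w i ^+ r.+1 <= C' * Num.sqrt S.
    apply: (le_trans hS); rewrite ler_wpM2l ?(ltW C'_gt0)//.
    rewrite -(@ler_pXn2r _ 2)// ?nnegrE ?sqrtr_ge0 ?lambda2_norm_ge0//.
    rewrite (sqr_sqrtr S0) lambda2_norm_trunc ler_sum// => j _.
    rewrite /z ComplexField.Normc.normcM ComplexField.Normc.normcV normcR normc_conj.
    by rewrite gtr0_norm// -exprMn divfK// gt_eqF.
  move=> /(@lerXn2r _ 2); rewrite !nnegrE mulr_ge0 ?(ltW (model_wgt0 _ _))//.
  rewrite mulr_ge0 ?sqrtr_ge0 ?(ltW C'_gt0)// => /(_ isT isT).
  rewrite !exprMn sqr_sqrtr//; have [->|Sn0] := eqVneq S 0.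
    by move=> _; rewrite divr_ge0 ?sqr_ge0.
  rewrite expr2 -mulrA mulrC ler_pM2r ?lt_def ?Sn0// => SW.
  by rewrite ler_pdivlMr// exprn_gt0// model_wgt0.
have ex j : exists i, A j q <= 2 * C * (normc (co (f (lambda2_delta A j)) i) * w i ^+ r).
  (* Otherwise the lower estimate would give a_jq <= a_jq / 2; when a_jq = 0 any
     coordinate will do. *)
  apply: contrapT => /forallNP nex.
  have aq0 : 0 < A j q.
    rewrite lt_def koethe_ge0 andbT; apply/eqP => aq0; apply: (nex i0).
    by rewrite aq0 !mulr_ge0 ?normc_ge0 ?(ltW C_gt0) ?(ltW (model_wgt0 _ _)).
  have := hlo (lambda2_delta A j) (A j q / (2 * C)); rewrite lambda2_norm_delta => H.
  have : A j q <= C * (A j q / (2 * C)).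
    apply: H => i; rewrite ler_pdivlMr ?mulr_gt0// mulrC leNgt; apply/negP => /ltW.
    exact: nex.
  rewrite invfM mulrCA -[2^-1 / C]mulrC mulVKf ?gt_eqF//.
  by move: aq0; lra.
have [ii hii] := boolp.choice ex.
have W0 : 0 <= W by have := hW [::] isT; rewrite big_nil.
exists ((2 * C) ^+ 2 * (C' ^+ 2 * W)) => N.
pose s := undup [seq ii j | j <- index_iota 0 N].
have step j : (A j q / A j r') ^+ 2 <=
    (2 * C) ^+ 2 * (w (ii j) ^+ r) ^+ 2 * normc (u j (ii j)) ^+ 2.
  rewrite -!exprMn ler_pXn2r ?nnegrE ?divr_ge0 ?koethe_ge0//; last first.
    by rewrite !mulr_ge0 ?normc_ge0 ?(ltW C_gt0) ?(ltW (model_wgt0 _ _)).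
  rewrite normu ler_pdivrMr// mulrA divfK ?gt_eqF//.
  by rewrite (le_trans (hii j))// -!mulrA ler_pM2l// ler_pM2l// mulrC.
rewrite (le_trans (ler_sum _ (fun j _ => step j)))//.
have -> : \sum_(0 <= j < N) (2 * C) ^+ 2 * (w (ii j) ^+ r) ^+ 2 * normc (u j (ii j)) ^+ 2
  = \sum_(i <- s) (2 * C) ^+ 2 * (w i ^+ r) ^+ 2 *
       \sum_(0 <= j < N | ii j == i) normc (u j i) ^+ 2.
  under [RHS]eq_bigr do rewrite mulr_sumr big_mkcond.
  rewrite exchange_big; apply: eq_big_nat => j jN /=.
  rewrite (bigD1_seq (ii j)) ?undup_uniq//=; last first.
    by rewrite mem_undup map_f// mem_index_iota.
  by rewrite eqxx big1 ?addr0// => i; rewrite eq_sym => /negbTE ->.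
rewrite mulrA; apply: (@le_trans _ _ (\sum_(i <- s) (2 * C) ^+ 2 * C' ^+ 2 * (w i ^+ 2)^-1)).
  apply: ler_sum => i _; rewrite -[leLHS]mulrA -[leRHS]mulrA ler_wpM2l ?sqr_ge0//.
  rewrite (@le_trans _ _ ((w i ^+ r) ^+ 2 * (C' ^+ 2 / (w i ^+ r.+1) ^+ 2)))//.
    rewrite ler_wpM2l ?sqr_ge0// (le_trans _ (usum N i))// [leRHS](bigID (fun j => ii j == i))/=.
    by rewrite lerDl sumr_ge0// => j _; exact: sqr_ge0.
  rewrite [w i ^+ r.+1]exprSr; have := model_wgt0 i r; have := model_wgt0 i 1.
  rewrite expr1 => /gt_eqF b0 /gt_eqF a0.
  by rewrite le_eqVlt; apply/orP; left; apply/eqP; field; rewrite b0 a0.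
by rewrite -mulr_sumr ler_wpM2l ?hW ?undup_uniq// mulr_ge0 ?sqr_ge0.
Qed.

(** A product of two square summable sequences is summable. *)
Lemma embedding_summable : koethe_summable A.
Proof.
have [p hp] := embedding_DN; have Ap := koethe_DN_gt0 hp.
move=> q; have [r pr [K hK]] := embedding_square_summable q Ap.
have [r' pr' [K' hK']] := embedding_square_summable r Ap.
have Ar j : 0 < A j r by rewrite (lt_le_trans (Ap j))// koethe_homo.
have Ar' j : 0 < A j r' by rewrite (lt_le_trans (Ap j))// koethe_homo.
exists r'; apply: (@koethe_quot_bound _ _ _ (K + K')) => [j|j _|N].
  - exact: koethe_ge0.
  - exact: Ar'.
rewrite (le_trans _ (lerD (hK N) (hK' N)))// -big_split/= ler_sum// => j _.
set x := A j q / A j r; set y := A j r / A j r'.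
have -> : A j q / A j r' = x * y by rewrite /x /y mulrA divfK// gt_eqF.
have := sqr_ge0 (x - y); have := sqr_ge0 x; have := sqr_ge0 y; nra.
Qed.

End embedding.

Lemma isomorphic_onto_koethe {R : realType} (A : koethe_matrix R)
    (E : preTopologicalLmodType R[i]) (I : choiceType) (i0 : I)
    (w : I -> R) (co : E -> I -> R[i]) (B : set E) :
  sup_model w co -> isomorphic_onto (lambda2 A) B ->
  koethe_summable A /\ koethe_DN A.
Proof.
move=> mE [f [g [fl fB fg fc gc]]]; split.
  exact: (embedding_summable i0 mE fl fB fg fc gc).
exact: (embedding_DN i0 mE fl fB fg fc gc).
Qed.

(** * Series converging at a prescribed rate *)

Section absolutely_summable.
Context {R : realType}.
Implicit Types (x y : nat -> R[i]) (l : R[i]).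

(** Convergence to l at rate 1 / N.  As a relation it composes with linear
    operations without convergence side conditions, and the series below all
    have terms decaying like n^-2, hence this rate. *)
Definition ssum x l : Prop := exists C : R,
  forall N, normc (l - \sum_(0 <= k < N) x k) <= C / N.+1%:R.

Lemma small_inv (C e : R) : 0 < e -> exists N : nat, C / N.+1%:R <= e.
Proof.
move=> e0; have [N _ hN] := nbhs_infty_ger (e^-1 * C).
exists N; rewrite ler_pdivrMr// -ler_pdivrMl//.
by rewrite (le_trans (hN N _))//= ler_nat.
Qed.

Lemma approx_uniq (Q : nat -> R[i]) l l' (C C' : R) :
  (forall N, normc (l - Q N) <= C / N.+1%:R) ->
  (forall N, normc (l' - Q N) <= C' / N.+1%:R) -> l = l'.
Proof.
move=> hC hC'; apply/eqP; rewrite -subr_eq0; apply/eqP.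
apply: ComplexField.Normc.eq0_normc; apply/eqP; rewrite eq_le normc_ge0 andbT.
apply/ler_addgt0Pr => e e0; rewrite add0r.
have [N hN] := small_inv (C + C') e0; apply: le_trans hN.
rewrite -(subrKA (Q N)) (le_trans (normcD _ _))//.
by rewrite mulrDl lerD// normcB.
Qed.

Lemma ssum_uniq x l l' : ssum x l -> ssum x l' -> l = l'.
Proof. by move=> [C hC] [C' hC']; exact: approx_uniq hC hC'. Qed.

Lemma ssum_conj x l : ssum x l -> ssum (fun n => (x n)^*%C) (l^*%C).
Proof.
move=> [C hC]; exists C => N; apply: le_trans (hC N).
by rewrite -rmorph_sum -rmorphB normc_conj.
Qed.

Lemma ssum0 x : (forall n, x n = 0) -> ssum x 0.
Proof.
move=> h; exists 0 => N; rewrite big1 ?subrr ?ComplexField.Normc.normc0 ?mul0r//.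
Qed.

Lemma ssum_lin a x y l l' : ssum x l -> ssum y l' ->
  ssum (fun n => a * x n + y n) (a * l + l').
Proof.
move=> [C hC] [C' hC']; exists (normc a * C + C') => N.
have -> : a * l + l' - \sum_(0 <= k < N) (a * x k + y k) =
  a * (l - \sum_(0 <= k < N) x k) + (l' - \sum_(0 <= k < N) y k).
  by rewrite big_split -mulr_sumr /= mulrBr opprD addrACA.
rewrite (le_trans (normcD _ _))// mulrDl lerD//.
by rewrite ComplexField.Normc.normcM -mulrA ler_wpM2l ?normc_ge0.
Qed.

(** The constant only has to dominate the finitely many nonzero errors. *)
Lemma ssum_finite x N : (forall n, (N <= n)%N -> x n = 0) ->
  ssum x (\sum_(0 <= k < N) x k).
Proof.
move=> h.
exists (\sum_(0 <= M < N)
  normc (\sum_(0 <= k < N) x k - \sum_(0 <= k < M) x k) * M.+1%:R) => M.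
rewrite ler_pdivlMr//; have [MN|NM] := ltnP M N.
  rewrite [leRHS](big_cat_nat (n := M))//=; last exact: ltnW.
  rewrite [X in _ <= _ + X]big_ltn// addrCA lerDl.
  by rewrite addr_ge0// sumr_ge0// => i _; rewrite mulr_ge0 ?normc_ge0.
rewrite [X in _ - X](big_cat_nat (n := N))//= opprD addrA subrr sub0r.
rewrite big_nat_cond big1 ?oppr0 ?ComplexField.Normc.normc0 ?mul0r.
  by rewrite sumr_ge0// => i _; rewrite mulr_ge0 ?normc_ge0.
by move=> i; rewrite andbT => /andP[Ni _]; exact: h.
Qed.

Lemma eq_ssum x y l : x =1 y -> ssum x l -> ssum y l.
Proof. by move=> /funext ->. Qed.

Lemma ssum_lim x l : ssum x l -> limn (series (x : nat -> R[i]^o)) = l.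
Proof.
move=> [C hC]; apply: cvg_lim => //; apply/cvg_complexP => e e0.
have [N hN] := small_inv C e0; exists N => // n /= Nn; apply: le_trans hN.
have C0 : 0 <= C by have := le_trans (normc_ge0 _) (hC 0%N); rewrite divr1.
rewrite normcB (le_trans (hC n))// ler_wpM2l//.
by rewrite lef_pV2 ?posrE// ler_nat.
Qed.

Lemma ssum_tail x l (C : R) : (forall n, normc (x n) * n.+1%:R ^+ 2 <= C) ->
  ssum x l -> forall N, normc (l - \sum_(0 <= k < N) x k) <= 2 * C / N.+1%:R.
Proof.
move=> hx xl; have [l' [h' _]] := series_complex hx.
by rewrite (ssum_uniq xl (_ : ssum x l'))//; exists (2 * C).
Qed.

Lemma ssum_le x l (C : R) : (forall n, normc (x n) * n.+1%:R ^+ 2 <= C) ->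
  ssum x l -> normc l <= 2 * C.
Proof.
by move=> hx xl; have := ssum_tail hx xl 0; rewrite big_geq// subr0 divr1.
Qed.

Lemma ssum_limn x (C : R) : (forall n, normc (x n) * n.+1%:R ^+ 2 <= C) ->
  ssum x (limn (series (x : nat -> R[i]^o))).
Proof.
by move=> hx; have [l [hl e]] := series_complex hx; rewrite e; exists (2 * C).
Qed.

End absolutely_summable.

(** * Initial topologies and uniform convergence *)

Section topology_lemmas.

Lemma nbhs_initialP (S : choiceType) (T : topologicalType) (f : S -> T)
    (x : initial_topology f) (U : set S) :
  nbhs x U <-> exists2 V, nbhs (f x) V & f @^-1` V `<=` U.
Proof.
split=> [|[V xV VU]]; last first.
  by apply: filterS VU _; exact: (@initial_continuous _ _ f x).
rewrite nbhsE => -[B [[A oA <-] Ax] BU]; exists A => //; exists A => //; split.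
Qed.

(** The sets on the right form a filter because fam is stable under unions, and
    this filter converges to f uniformly on each member of fam; so it contains
    every neighbourhood of f. *)
Lemma nbhs_familyP (U : choiceType) (V : uniformType) (fam : set U -> Prop)
    (f : {family fam, U -> V}) (O : set {family fam, U -> V}) :
  (forall A B, fam A -> fam B -> fam (A `|` B)) -> fam set0 ->
  nbhs f O <-> exists A E, [/\ fam A, entourage E &
    forall g : U -> V, (forall y, A y -> E (f y, g y)) -> O g].
Proof.
move=> famU fam0; split=> [|[A [E [fA eE h]]]]; last first.
  by apply: filterS (fam_nbhs f eE fA) => g; exact: h.
pose D := [set AE : set U * set (V * V) | fam AE.1 /\ entourage AE.2].
pose F : set_system (U -> V) :=
  filter_from D (fun AE => [set g | forall y, AE.1 y -> AE.2 (f y, g y)]).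
have FF : Filter F.
  apply: filter_from_filter; first by exists (set0, setT); split => //; exact: filterT.
  move=> [A E] [A' E'] [/= fA eE] [/= fA' eE'].
  exists (A `|` A', E `&` E'); first by split => /=; [exact: famU|exact: filterI].
  move=> g /= h; split=> y Ay; first by have [] := h y (or_introl Ay).
  by have [] := h y (or_intror Ay).
have : {family fam, F --> f}.
  apply/fam_cvgP => A fA O' /uniform_nbhs[E [eE hE]].
  by exists (A, E) => // g hg; apply: hE.
move=> /[apply] -[[A E] [/= fA eE] h]; exists A, E; split=> // g hg; exact: h.
Qed.

Lemma entourage_complexP (R : realType) (E : set (R[i]^o * R[i]^o)) :
  entourage E <-> exists2 e : R, 0 < e &
    forall x y : R[i], normc (x - y) < e -> E (x, y).
Proof.
have ballE (x y : R[i]) (e : R) : ball (x : R[i]^o) e%:C y = (normc (x - y) < e).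
  by rewrite -ltcR -norm_normc.
rewrite -entourage_ballE; split=> [[[e e'] /= e0 h]|[e e0 h]].
  move: e0 h; rewrite ltcE /= => /andP[/eqP -> e0] h.
  by exists e => // x y xy; apply: h; rewrite /= ballE.
apply: (ex_intro2 _ _ (e%:C : R[i])); first by rewrite /= ltcR.
by move=> [x y] /=; rewrite ballE; exact: h.
Qed.

End topology_lemmas.

(** * The space s *)

Section rapid_model.
Context {R : realType}.
Implicit Types (x : sspace R) (t : nat -> R[i]).

Definition idx (n : nat) : R := n.+1%:R.

Lemma idx_ge1 n : 1 <= idx n.
Proof. by rewrite /idx ler1n. Qed.

Lemma idx_gt0 n : 0 < idx n.
Proof. by rewrite /idx. Qed.

Lemma idxX_gt0 n q : 0 < idx n ^+ q.
Proof. by rewrite exprn_gt0// idx_gt0. Qed.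

Definition rapid t := forall q, exists C : R, forall n, normc (t n) * idx n ^+ q <= C.

(** One extra power of the index pays for the passage from sup to l^2 norms. *)
Lemma rapid_norm t q (c : R) : (forall n, normc (t n) * idx n ^+ q.+1 <= c) ->
  (wsum (rapid_matrix R ^~ q) t < +oo)%E /\ wnorm (rapid_matrix R ^~ q) t <= 2 * c.
Proof.
move=> h; have c0 : 0 <= c.
  by rewrite (le_trans _ (h 0%N))// mulr_ge0 ?normc_ge0// ltW// idxX_gt0.
apply: wsum_bound; rewrite ?mulr_ge0// => N.
rewrite (@le_trans _ _ (\sum_(0 <= k < N) c ^+ 2 * (k.+1%:R ^+ 2)^-1))//.
  apply: ler_sum => k _; rewrite /= -exprMn ler_pdivlMr ?exprn_gt0// -exprMn.
  rewrite ler_pXn2r ?nnegrE ?mulr_ge0 ?normc_ge0 ?exprn_ge0//.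
  by rewrite -mulrA -exprSr; exact: h.
rewrite -mulr_sumr (le_trans (ler_wpM2l _ (sum_inv_sq 0 N))) ?sqr_ge0//.
by rewrite divr1 exprMn mulrC ler_wpM2r ?sqr_ge0// -natrX ler_nat.
Qed.

Lemma rapid_coord x n q : normc (x n) * idx n ^+ q <= lambda2_norm (rapid_matrix R) q x.
Proof. exact: lambda2_coord. Qed.

Lemma sspace_rapid x : rapid x.
Proof. by move=> q; exists (lambda2_norm (rapid_matrix R) q x) => n; exact: rapid_coord. Qed.

Lemma rapid_fin t : rapid t -> forall q, (wsum (rapid_matrix R ^~ q) t < +oo)%E.
Proof. by move=> h q; have [C hC] := h q.+1; have [] := rapid_norm hC. Qed.

Definition sspace_of t (h : rapid t) : sspace R := lambda2_of (rapid_fin h).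

Lemma uniq_sub_sum (I : eqType) (s t : seq I) (F : I -> R) :
  (forall i, 0 <= F i) -> uniq s -> uniq t -> {subset s <= t} ->
  \sum_(i <- s) F i <= \sum_(i <- t) F i.
Proof.
move=> F0 us ut st; rewrite [leRHS](bigID (mem s))/=.
have -> : \sum_(i <- s) F i = \sum_(i <- t | i \in s) F i.
  rewrite -[RHS]big_filter; apply: perm_big; apply: uniq_perm.
  - exact: us.
  - exact: filter_uniq.
  - by move=> i; rewrite mem_filter; case: (boolP (i \in s)) => // /st ->.
by rewrite lerDl sumr_ge0.
Qed.

Lemma idx_sum (s : seq nat) : uniq s -> \sum_(i <- s) (idx i ^+ 2)^-1 <= 2.
Proof.
move=> us; pose N := (\max_(i <- s) i).+1.
rewrite (@le_trans _ _ (\sum_(0 <= i < N) (idx i ^+ 2)^-1))//.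
  apply: uniq_sub_sum => //; rewrite ?iota_uniq//.
    by move=> i; rewrite invr_ge0 sqr_ge0.
  by move=> i si; rewrite mem_index_iota /N ltnS leq_bigmax_seq.
by rewrite (le_trans (sum_inv_sq 0 N))// divr1.
Qed.

Lemma sspace_model : @sup_model R (sspace R) nat idx (fun x n => x n).
Proof.
split=> //.
- by move=> x y; exact: lambda2_eqP.
- by move=> x; exact: sspace_rapid.
- by move=> t ht; exists (sspace_of ht).
- move=> x U; split=> [/nbhs_lambda2P|] [q [e [e0 h]]].
    exists q.+1, (e / 4); split; first by rewrite divr_gt0.
    move=> y hy; apply: h; have [_ /le_lt_trans] := rapid_norm hy; apply.
    by rewrite mulrCA gtr_pMr// ltr_pdivrMr// mul1r ltr_nat.
  apply/nbhs_lambda2P; exists q, e; split=> // y hy; apply: h => n.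
  by rewrite (le_trans _ (ltW hy))//; exact: (@rapid_coord (y - x)).
- by move=> n; exact: idx_ge1.
- by exists 2; exact: idx_sum.
Qed.

End rapid_model.

Section model_bounded.
Context {R : realType} {E : preTopologicalLmodType R[i]} {I : choiceType}.
Context (w : I -> R) (co : E -> I -> R[i]) (mE : sup_model w co).

Lemma model_boundedP (M : set E) : vn_bounded M <->
  forall q, exists C : R, forall x, M x -> forall i, normc (co x i) * w i ^+ q <= C.
Proof.
split=> [bM q|h U U0].
  have := bM [set y | forall i, normc (co y i) * w i ^+ q <= 1].
  case.
    apply/(model_nbhs mE); exists q, 1; split=> // y hy i.
    by have := hy i; rewrite (model0 mE) subr0.
  move=> c c0 hc; exists (normc c) => x /hc[u hu <-] i.
  rewrite (modelZ mE) ComplexField.Normc.normcM -mulrA.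
  by rewrite -[leRHS]mulr1 ler_wpM2l ?normc_ge0.
have [q [e [e0 hU]]] := (model_nbhs mE 0 U).1 U0; have [C hC] := h q.
pose a := (`|C| + 1) / e; have a0 : 0 < a by rewrite divr_gt0// ltr_wpDl.
exists a%:C; first by rewrite ltcR.
move=> x Mx; exists (a^-1%:C *: x); last first.
  by rewrite scalerA -rmorphM divff ?gt_eqF// scale1r.
apply: hU => i; rewrite (model0 mE) subr0 (modelZ mE) ComplexField.Normc.normcM.
rewrite normcR ger0_norm ?invr_ge0 ?(ltW a0)// -mulrA ler_pdivrMl//.
rewrite (le_trans (hC x Mx i))// /a divfK ?gt_eqF//.
by rewrite (le_trans (ler_norm C))// lerDl.
Qed.

End model_bounded.

(** * The dual s' and its bounded sets *)

Section dual_space.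
Context {R : realType}.
Implicit Types (xi eta : sdual R) (x : sspace R) (M : set (sspace R)).
Local Notation idx := (@idx R).

Lemma sdual_eqP xi eta : (forall n, xi n = eta n) -> xi = eta.
Proof. by move=> h; apply: val_inj; apply/funext => j; exact: h. Qed.

Lemma sdual_growth xi : exists r (C : R), 0 <= C /\
  forall n, normc (xi n) <= C * idx n ^+ r.
Proof.
have := sdual_valP xi; rewrite inE => -[r hr]; exists r.
exists (wnorm (fun j => (idx j ^+ r)^-1) xi); split=> [|n]; first exact: wnorm_ge0.
rewrite -ler_pdivrMr ?idxX_gt0//.
by apply: (wnorm_coord (w := fun j => (idx j ^+ r)^-1)) => //; rewrite invr_ge0 ltW// idxX_gt0.
Qed.

Lemma growth_mul (t u : nat -> R[i]) r (C D : R) : 0 <= C ->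
  (forall n, normc (t n) <= C * idx n ^+ r) ->
  (forall n, normc (u n) * idx n ^+ r.+2 <= D) ->
  forall n, normc (t n * u n) * n.+1%:R ^+ 2 <= C * D.
Proof.
move=> C0 ht hu n; rewrite ComplexField.Normc.normcM.
rewrite (@le_trans _ _ (C * idx n ^+ r * normc (u n) * idx n ^+ 2))//.
  rewrite ler_wpM2r ?(ltW (idxX_gt0 _ _))// ler_wpM2r ?normc_ge0//.
have -> : C * idx n ^+ r * normc (u n) * idx n ^+ 2 = C * (normc (u n) * idx n ^+ r.+2).
  by rewrite -(addn2 r) exprD; ring.
by rewrite ler_wpM2l.
Qed.

Lemma pairing_ssum xi x : ssum (fun n => xi n * x n) (sdual_pairing xi x).
Proof.
have [r [C [C0 hC]]] := sdual_growth xi; have [D hD] := sspace_rapid x r.+2.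
exact: ssum_limn (growth_mul C0 hC hD).
Qed.

Lemma pairing_lin c xi eta x :
  sdual_pairing (c *: xi + eta) x = c * sdual_pairing xi x + sdual_pairing eta x.
Proof.
apply: ssum_uniq (pairing_ssum _ _) _.
apply: eq_ssum (ssum_lin c (pairing_ssum xi x) (pairing_ssum eta x)) => n.
by rewrite /= mulrDl mulrA.
Qed.

Lemma pairing0 x : sdual_pairing 0 x = 0.
Proof.
by have := pairing_lin (-1) 0 0 x; rewrite scaler0 addr0 mulN1r addNr.
Qed.

Lemma pairingZ c xi x : sdual_pairing (c *: xi) x = c * sdual_pairing xi x.
Proof. by have := pairing_lin c xi 0 x; rewrite pairing0 !addr0. Qed.

Lemma pairingB xi eta x :
  sdual_pairing (xi - eta) x = sdual_pairing xi x - sdual_pairing eta x.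
Proof.
have := pairing_lin (-1) eta xi x; rewrite mulN1r scaleN1r addrC => ->.
by rewrite addrC.
Qed.

Lemma pairing_le xi x r (C D : R) : 0 <= C ->
  (forall n, normc (xi n) <= C * idx n ^+ r) ->
  (forall n, normc (x n) * idx n ^+ r.+2 <= D) ->
  normc (sdual_pairing xi x) <= 2 * (C * D).
Proof.
by move=> C0 hC hD; apply: ssum_le (growth_mul C0 hC hD) (pairing_ssum xi x).
Qed.

(** Boundedness in s, coordinatewise: it is preserved by unions, and it is
    checked by hand on the explicit sets that occur below. *)
Definition sbounded M := forall q, exists C : R,
  forall x, M x -> forall n, normc (x n) * idx n ^+ q <= C.

Lemma sboundedP M : vn_bounded M <-> sbounded M.
Proof. exact: (model_boundedP (@sspace_model R)). Qed.

Lemma sboundedU M N : sbounded M -> sbounded N -> sbounded (M `|` N).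
Proof.
move=> hM hN q; have [C hC] := hM q; have [D hD] := hN q.
exists (Num.max C D) => x [Mx|Nx] n; rewrite le_max; first by rewrite hC.
by rewrite hD ?orbT.
Qed.

Lemma sbounded0 : sbounded set0.
Proof. by move=> q; exists 0. Qed.

Lemma nbhs_sdualP xi (U : set (sdual R)) : nbhs xi U <->
  exists M (e : R), [/\ sbounded M, 0 < e & forall eta,
    (forall x, M x -> normc (sdual_pairing (eta - xi) x) <= e) -> U eta].
Proof.
have bU : forall A B : set (sspace R), vn_bounded A -> vn_bounded B -> vn_bounded (A `|` B).
  by move=> A B /sboundedP hA /sboundedP hB; apply/sboundedP; exact: sboundedU.
have b0 : @vn_bounded _ (sspace R) set0 by apply/sboundedP; exact: sbounded0.
split=> [/nbhs_initialP[V /(nbhs_familyP _ _ bU b0)[M [E [bM]]]]|].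
  move=> /entourage_complexP[e e0 hE] h VU.
  exists M, (e / 2); split=> [||eta heta]; [exact/sboundedP|by rewrite divr_gt0|].
  apply: VU; apply: h => x Mx; apply: hE; rewrite normcB -pairingB.
  by rewrite (le_lt_trans (heta x Mx))// ltr_pdivrMr// ltr_pMr// ltr1n.
move=> [M [e [bM e0 h]]]; apply/nbhs_initialP.
exists [set g | forall x, M x -> normc (sdual_pairing xi x - g x) < e].
  apply/(nbhs_familyP _ _ bU b0).
  exists M, [set xy | normc (xy.1 - xy.2) < e]; split=> //; first exact/sboundedP.
  by apply/entourage_complexP; exists e.
by move=> eta heta; apply: h => x Mx; rewrite pairingB normcB ltW// heta.
Qed.

(** Equicontinuity of a set of functionals: a common polynomial bound. *)
Definition sgrowth (K : set (sdual R)) := exists r (C : R), 0 <= C /\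
  forall xi, K xi -> forall n, normc (xi n) <= C * idx n ^+ r.

Let trunc_lty (z : nat -> R[i]) N :
  exists q, (wsum (fun j => (j.+1%:R ^+ q)^-1)%R (fun j => if (j < N)%N then z j else 0%R) < +oo)%E.
Proof.
exists 0%N.
by rewrite (@wsum_finite _ _ _ N) ?ltry// => j; rewrite leqNgt => /negbTE ->.
Qed.

Definition sdual_trunc (z : nat -> R[i]) N : sdual R :=
  SDual (mem_set (trunc_lty z N)).

Definition sdual_delta n : sdual R := sdual_trunc (fun j => (j == n)%:R) n.+1.

Lemma sdual_deltaE n j : sdual_delta n j = (j == n)%:R.
Proof.
rewrite /=; case: ltnP => // nj; rewrite (_ : (j == n) = false)//.
by apply/negbTE; rewrite neq_ltn nj orbT.
Qed.

Lemma sdual_truncE z N :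
  sdual_trunc z N = \sum_(0 <= j < N) z j *: sdual_delta j.
Proof.
elim: N => [|N ih]; first by rewrite big_geq//; apply: sdual_eqP.
rewrite big_nat_recr//= -ih addrC; apply: sdual_eqP => j.
rewrite -[RHS]/(z N * sdual_delta N j + sdual_trunc z N j) sdual_deltaE /=.
rewrite ltnS leq_eqVlt; case: eqVneq => [->|_] /=.
  by rewrite ltnn mulr1 addr0.
by rewrite mulr0 add0r.
Qed.

Lemma pairing_delta n x : sdual_pairing (sdual_delta n) x = x n.
Proof.
apply: ssum_uniq (pairing_ssum _ _) _.
have h j : (n.+1 <= j)%N -> sdual_delta n j * x j = 0.
  by move=> nj; rewrite sdual_deltaE gtn_eqF// mul0r.
suff -> : x n = \sum_(0 <= j < n.+1) sdual_delta n j * x j by exact: ssum_finite.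
rewrite big_nat_recr//= eqxx ltnSn mul1r big_nat_cond big1 ?add0r// => j.
by rewrite andbT => /andP[_ jn]; rewrite (ltn_trans jn)// ltn_eqF// mul0r.
Qed.

Lemma pairing_pick xi n (c : R[i]) x : (forall j, x j = c * (j == n)%:R) ->
  sdual_pairing xi x = xi n * c.
Proof.
move=> hx; apply: ssum_uniq (pairing_ssum _ _) _.
have h j : (n.+1 <= j)%N -> xi j * x j = 0.
  by move=> nj; rewrite hx gtn_eqF// !mulr0.
suff -> : xi n * c = \sum_(0 <= j < n.+1) xi j * x j by exact: ssum_finite.
rewrite big_nat_recr//= hx eqxx mulr1 big_nat_cond big1 ?add0r// => j.
by rewrite andbT => /andP[_ jn]; rewrite hx ltn_eqF// !mulr0.
Qed.

Lemma sgrowth_bounded (K : set (sdual R)) : sgrowth K -> vn_bounded K.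
Proof.
move=> [r [C [C0 hK]]] U /nbhs_sdualP[M [e [bM e0 hU]]].
have [D hD] := bM r.+2; pose a := (2 * (C * `|D|) + 1) / e.
have a0 : 0 < a by rewrite divr_gt0// ltr_wpDl// !mulr_ge0.
exists a%:C; first by rewrite ltcR.
move=> xi Kxi; exists (a^-1%:C *: xi); last first.
  by rewrite scalerA -rmorphM divff ?gt_eqF// scale1r.
apply: hU => x Mx; rewrite subr0 pairingZ ComplexField.Normc.normcM.
rewrite normcR ger0_norm ?invr_ge0 ?(ltW a0)// ler_pdivrMl//.
have hx n : normc (x n) * idx n ^+ r.+2 <= `|D| by rewrite (le_trans (hD x Mx n))// ler_norm.
rewrite (le_trans (pairing_le C0 (hK xi Kxi) hx))// /a divfK ?gt_eqF//.
by rewrite lerDl.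
Qed.

(** A gliding hump.  If K has no common polynomial bound, then for each q some
    xi_q in K satisfies |xi_q(n_q)| > q (n_q + 1)^q at some n_q.  The vectors
    (n_q + 1)^-q e_(n_q) form a bounded subset M of s, because for a fixed weight
    r all but the first r of them have r-th norm at most 1.  But K pairs
    unboundedly with M, so K is not absorbed by the polar of M. *)
Lemma bounded_sgrowth (K : set (sdual R)) : vn_bounded K -> sgrowth K.
Proof.
move=> bK; apply: contrapT => /forallNP nK.
have ex q : exists p : sdual R * nat, K p.1 /\ q%:R * idx p.2 ^+ q < normc (p.1 p.2).
  apply: contrapT => /forallNP nex; apply: (nK q); exists q%:R; split=> // xi Kxi n.
  by rewrite leNgt; apply/negP => h; apply: (nex (xi, n)).
have [p hp] := boolp.choice ex.
have rap (n : nat) (c : R[i]) : rapid (fun j => c * (j == n)%:R).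
  move=> r; exists (normc c * idx n ^+ r) => j; case: (eqVneq j n) => [->|_].
    by rewrite mulr1.
  rewrite mulr0 ComplexField.Normc.normc0 mul0r mulr_ge0 ?normc_ge0//.
  exact: ltW (idxX_gt0 _ _).
pose z q : sspace R := sspace_of (rap (p q).2 ((idx (p q).2 ^+ q)^-1)%:C).
pose M := range z.
have bM : sbounded M.
  move=> r; exists (\sum_(0 <= q < r) idx (p q).2 ^+ r + 1) => _ [q _ <-] n /=.
  have S0 N : 0 <= \sum_(0 <= q < N) idx (p q).2 ^+ r.
    by apply: sumr_ge0 => k _; exact: ltW (idxX_gt0 _ _).
  case: (eqVneq n (p q).2) => [->|_]; last first.
    by rewrite mulr0 ComplexField.Normc.normc0 mul0r addr_ge0.
  rewrite mulr1 normcR gtr0_norm ?invr_gt0 ?idxX_gt0//.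
  have [rq|qr] := leqP r q.
    rewrite (@le_trans _ _ 1)// ?lerDr// ler_pdivrMl ?idxX_gt0// mulr1.
    by rewrite ler_weXn2l// idx_ge1.
  rewrite (@le_trans _ _ (idx (p q).2 ^+ r))//.
    rewrite ler_piMl ?(ltW (idxX_gt0 _ _))// invf_le1 ?idxX_gt0//.
    by rewrite exprn_ege1// idx_ge1.
  rewrite ler_wpDr// (big_cat_nat (n := q.+1))//= big_nat_recr//=.
  rewrite -addrA addrCA lerDl addr_ge0//.
  by apply: sumr_ge0 => k _; exact: ltW (idxX_gt0 _ _).
pose U := [set eta : sdual R | forall x, M x -> normc (sdual_pairing eta x) <= 1].
have [|c c0 hc] := bK U.
  by apply/nbhs_sdualP; exists M, 1; split=> // eta h x Mx; rewrite -[eta]subr0 h.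
have [q _ hq] := nbhs_infty_ger (normc c).
have [Kq hpq] := hp q; have [u hu ue] := hc _ Kq.
have := hu (z q); rewrite -(@ler_pM2l _ (normc c)); last first.
  rewrite lt_def normc_ge0 andbT; apply/eqP => /ComplexField.Normc.eq0_normc c00.
  by move: c0; rewrite c00 ltxx.
rewrite -ComplexField.Normc.normcM -pairingZ ue mulr1 => H.
have {H} : normc (sdual_pairing (p q).1 (z q)) <= normc c by apply: H; exists q.
rewrite (@pairing_pick _ (p q).2 ((idx (p q).2 ^+ q)^-1)%:C)//.
rewrite ComplexField.Normc.normcM normcR gtr0_norm ?invr_gt0 ?idxX_gt0//.
rewrite ler_pdivrMr ?idxX_gt0// => H.
have := le_lt_trans (ler_wpM2r (ltW (idxX_gt0 _ _)) (hq q (leqnn q))) hpq.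
by move/lt_le_trans => /(_ _ H); rewrite ltxx.
Qed.

Lemma sbounded_sdualP (K : set (sdual R)) : vn_bounded K <-> sgrowth K.
Proof. by split; [exact: bounded_sgrowth|exact: sgrowth_bounded]. Qed.

End dual_space.

(** * The space L(s', s) as a space of rapidly decreasing matrices *)

Section smooth_operators.
Context {R : realType}.
Local Notation idx := (@idx R).
Local Notation sspace := (sspace R).
Local Notation sdual := (sdual R).

Lemma sgrowthU (K L : set sdual) : sgrowth K -> sgrowth L -> sgrowth (K `|` L).
Proof.
move=> [r [C [C0 hK]]] [r' [C' [C0' hL]]].
exists (maxn r r'), (Num.max C C'); split=> [|xi]; first by rewrite le_max C0.
by move=> [/hK|/hL] h n; apply: (le_trans (h n)); rewrite ler_pM ?(ltW (idxX_gt0 _ _))//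
  ?le_max ?lexx ?orbT// ler_weXn2l ?idx_ge1 ?leq_maxl ?leq_maxr.
Qed.

Lemma sgrowth0 : sgrowth (set0 : set sdual).
Proof. by exists 0%N, 0. Qed.

Section one_operator.
Context (T : sdual -> sspace) (Tl : linear T) (Tc : continuous T).

(** Continuity at 0, scaled: the q-th norm of T xi is at most a constant times
    the supremum of xi over one bounded subset of s. *)
Lemma operator_bound q : exists M (e : R), [/\ sbounded M, 0 < e & forall xi (d : R),
  0 < d -> (forall x, M x -> normc (sdual_pairing xi x) <= d) ->
  forall m, normc (T xi m) * idx m ^+ q <= d / e].
Proof.
have : nbhs (T 0) [set y : sspace | forall m, normc (y m - T 0 m) * idx m ^+ q <= 1].
  by apply/(model_nbhs (@sspace_model R)); exists q, 1.
move=> /Tc /nbhs_sdualP[M [e [bM e0 h]]]; exists M, e; split=> // xi d d0 hd m.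
have a0 : 0 < e / d by rewrite divr_gt0.
have := h ((e / d)%:C *: xi) => H.
have {H} : normc (T ((e / d)%:C *: xi) m - T 0 m) * idx m ^+ q <= 1.
  apply: H => x Mx; rewrite subr0 pairingZ ComplexField.Normc.normcM normcR.
  by rewrite gtr0_norm// -mulrA ler_piMr ?(ltW e0)// ler_pdivrMl// mulr1 hd.
rewrite (lin0 Tl) (linZ Tl) [X in X - _](_ : _ = (e / d)%:C * T xi m)//.
rewrite subr0 ComplexField.Normc.normcM normcR gtr0_norm// -mulrA.
by rewrite -ler_pdivlMl// mulr1 invf_div.
Qed.

Definition entry (m n : nat) : R[i] := T (sdual_delta n) m.

Lemma operator_trunc (z : nat -> R[i]) N m :
  T (sdual_trunc z N) m = \sum_(0 <= n < N) z n * entry m n.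
Proof.
rewrite sdual_truncE; elim: N => [|N ih]; first by rewrite !big_geq// (lin0 Tl).
by rewrite !big_nat_recr//= (linD Tl) (linZ Tl) -ih.
Qed.

(** The truncations of xi converge to xi uniformly on bounded subsets of s, at
    rate 1 / N; hence T is determined by its matrix. *)
Lemma operator_ssum (xi : sdual) m : ssum (fun n => entry m n * xi n) (T xi m).
Proof.
have [M [e [bM e0 h]]] := operator_bound 0.
have [r [C [C0 hC]]] := sdual_growth xi; have [D hD] := bM r.+2.
pose D' := `|D| + 1; have D'0 : 0 < D' by rewrite ltr_wpDl.
exists (2 * (C * D' + 1) / e) => N.
have -> : T xi m - \sum_(0 <= k < N) entry m k * xi k = T (xi - sdual_trunc xi N) m.
  rewrite (linB Tl); transitivity (T xi m - T (sdual_trunc xi N) m) => //.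
  by rewrite operator_trunc; congr (_ - _); apply: eq_bigr => k _; rewrite mulrC.
rewrite mulrAC -[leLHS]mulr1 -(expr0 (idx m)); apply: h => [|x Mx].
  by rewrite divr_gt0// mulr_gt0// ltr_wpDl// mulr_ge0// ltW.
rewrite pairingB.
have -> : sdual_pairing (sdual_trunc xi N) x = \sum_(0 <= k < N) xi k * x k.
  apply: ssum_uniq (pairing_ssum _ _) _.
  have -> : \sum_(0 <= k < N) xi k * x k = \sum_(0 <= k < N) sdual_trunc xi N k * x k.
    by apply: eq_big_nat => k /andP[_ kN]; rewrite /= kN.
  by apply: ssum_finite => n; rewrite /= leqNgt => /negbTE ->; rewrite mul0r.
have hx n : normc (x n) * idx n ^+ r.+2 <= D'.
  by rewrite (le_trans (hD x Mx n))// (le_trans (ler_norm _))// lerDl.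
rewrite (le_trans (ssum_tail (growth_mul C0 hC hx) (pairing_ssum xi x) N))//.
by rewrite ler_wpM2r// ler_wpM2l// lerDl.
Qed.

(** On a bounded subset of s the n-th unit vector is of size (n + 1)^-q for
    every q. *)
Lemma operator_rapid q : exists C : R, forall m n,
  normc (entry m n) * (idx m * idx n) ^+ q <= C.
Proof.
have [M [e [bM e0 h]]] := operator_bound q.
have [D hD] := bM q; pose D' := `|D| + 1; have D'0 : 0 < D' by rewrite ltr_wpDl.
exists (D' / e) => m n; rewrite exprMn mulrA -ler_pdivlMr ?idxX_gt0//.
rewrite mulrAC; apply: h => [|x Mx]; first by rewrite divr_gt0 ?idxX_gt0.
rewrite pairing_delta ler_pdivlMr ?idxX_gt0//.
by rewrite (le_trans (hD x Mx n))// (le_trans (ler_norm _))// lerDl.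
Qed.

End one_operator.

Lemma operator_eqP (S T : sdual -> sspace) : linear S -> continuous S ->
  linear T -> continuous T -> (forall m n, entry S m n = entry T m n) -> S = T.
Proof.
move=> Sl Sc Tl Tc h; apply/funext => xi; apply: lambda2_eqP => m.
apply: ssum_uniq (operator_ssum Sl Sc xi m) _.
by apply: eq_ssum (operator_ssum Tl Tc xi m) => n; rewrite h.
Qed.

Lemma Lss_linear (T : Lss R) : linear T.
Proof. by have := Lss_valP T; rewrite inE => -[]. Qed.

Lemma Lss_continuous (T : Lss R) : continuous T.
Proof. by have := Lss_valP T; rewrite inE => -[]. Qed.

Section operator_of_entries.
Context (t : nat -> nat -> R[i]).
Context (ht : forall q, exists C : R, forall m n,
  normc (t m n) * (idx m * idx n) ^+ q <= C).

Lemma entries_two q r : exists C : R, 0 <= C /\ forall m n,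
  normc (t m n) * idx m ^+ q * idx n ^+ r <= C.
Proof.
have [C hC] := ht (maxn q r); exists C; split=> [|m n].
  rewrite (le_trans _ (hC 0%N 0%N))// mulr_ge0 ?normc_ge0// exprn_ge0//.
  by rewrite mulr_ge0// ltW// idx_gt0.
apply: le_trans (hC m n); rewrite -mulrA ler_wpM2l ?normc_ge0// exprMn.
by rewrite ler_pM ?(ltW (idxX_gt0 _ _))// ler_weXn2l ?idx_ge1// ?leq_maxl ?leq_maxr.
Qed.

Definition op_fun (xi : sdual) (m : nat) : R[i] :=
  limn (series (fun n => t m n * xi n : R[i]^o)).

Let op_term (xi : sdual) q : exists2 C : R, 0 <= C & forall m n,
  normc (t m n * xi n) * n.+1%:R ^+ 2 * idx m ^+ q <= C.
Proof.
have [r [D [D0 hD]]] := sdual_growth xi; have [C [C0 hC]] := entries_two q r.+2.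
exists (C * D) => [|m n]; first exact: mulr_ge0.
rewrite ComplexField.Normc.normcM.
rewrite (@le_trans _ _ (normc (t m n) * (D * idx n ^+ r) * idx n ^+ 2 * idx m ^+ q))//.
  do 2 rewrite ler_wpM2r ?(ltW (idxX_gt0 _ _))//.
  by rewrite ler_wpM2l ?normc_ge0.
have -> : normc (t m n) * (D * idx n ^+ r) * idx n ^+ 2 * idx m ^+ q =
    normc (t m n) * idx m ^+ q * idx n ^+ r.+2 * D.
  by rewrite -(addn2 r) exprD; ring.
by rewrite ler_wpM2r.
Qed.

Lemma op_ssum (xi : sdual) m : ssum (fun n => t m n * xi n) (op_fun xi m).
Proof.
have [C _ hC] := op_term xi 0; apply: (@ssum_limn _ _ C) => n.
by have := hC m n; rewrite expr0 mulr1.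
Qed.

Let op_rapid (xi : sdual) : rapid (op_fun xi).
Proof.
move=> q; have [C C0 hC] := op_term xi q; exists (2 * C) => m.
rewrite -ler_pdivlMr ?idxX_gt0// -mulrA; apply: ssum_le (op_ssum xi m) => n.
by rewrite ler_pdivlMr ?idxX_gt0.
Qed.

Definition operator_of (xi : sdual) : sspace := sspace_of (op_rapid xi).

Lemma operator_of_linear : linear operator_of.
Proof.
move=> c xi eta; apply: lambda2_eqP => m; rewrite /= -[RHS]/(c * op_fun xi m + op_fun eta m).
apply: ssum_uniq (op_ssum _ _) _.
apply: eq_ssum (ssum_lin c (op_ssum xi m) (op_ssum eta m)) => n.
transitivity (t m n * (c * xi n + eta n)) => //; ring.
Qed.

Let row_rapid q m : rapid (fun n => t m n * (idx m ^+ q)%:C).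
Proof.
move=> r; have [C [C0 hC]] := entries_two q r; exists C => n.
by rewrite ComplexField.Normc.normcM normcR gtr0_norm ?idxX_gt0.
Qed.

(** The q-th norm of the image of xi is the supremum of xi over the rows of t
    scaled by (m + 1)^q, and these rows form a bounded subset of s. *)
Lemma operator_of_continuous : continuous operator_of.
Proof.
move=> xi U /(model_nbhs (@sspace_model R))[q [e [e0 hU]]].
pose z m : sspace := sspace_of (row_rapid q m).
apply/nbhs_sdualP; exists (range z), e; split=> // [r|eta heta].
  have [C [C0 hC]] := entries_two q r; exists C => _ [m _ <-] n /=.
  by rewrite ComplexField.Normc.normcM normcR gtr0_norm ?idxX_gt0.
apply: hU => m; have := heta (z m) (ex_intro2 _ _ m I erefl).
have -> : sdual_pairing (eta - xi) (z m) = (idx m ^+ q)%:C * (operator_of (eta - xi) m).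
  apply: ssum_uniq (pairing_ssum _ _) _.
  have := ssum_lin ((idx m ^+ q)%:C) (op_ssum (eta - xi) m)
    (@ssum0 R (fun=> 0) (fun=> erefl)).
  by rewrite addr0; apply: eq_ssum => n /=; ring.
rewrite ComplexField.Normc.normcM normcR gtr0_norm ?idxX_gt0//.
by rewrite (linB operator_of_linear) mulrC.
Qed.

Definition Lss_of : Lss R :=
  MkLss (mem_set (conj operator_of_linear operator_of_continuous) : operator_of \in @Lss_pred R).

Lemma Lss_ofE m n : entry Lss_of m n = t m n.
Proof.
apply: ssum_uniq (op_ssum _ _) _.
have h j : (n.+1 <= j)%N -> t m j * sdual_delta n j = 0.
  by move=> nj; rewrite sdual_deltaE gtn_eqF// mulr0.
suff -> : t m n = \sum_(0 <= j < n.+1) t m j * sdual_delta n j by exact: ssum_finite.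
rewrite big_nat_recr//= eqxx ltnSn mulr1 big_nat_cond big1 ?add0r// => j.
by rewrite andbT => /andP[_ jn]; rewrite (ltn_trans jn)// ltn_eqF// mulr0.
Qed.

End operator_of_entries.

Lemma nbhs_LssP (T : Lss R) (U : set (Lss R)) : nbhs T U <->
  exists K q (e : R), [/\ sgrowth K, 0 < e & forall S : Lss R,
    (forall xi m, K xi -> normc (S xi m - T xi m) * idx m ^+ q <= e) -> U S].
Proof.
have bU : forall A B : set sdual, vn_bounded A -> vn_bounded B -> vn_bounded (A `|` B).
  by move=> A B /sbounded_sdualP hA /sbounded_sdualP hB; apply/sbounded_sdualP; exact: sgrowthU.
have b0 : @vn_bounded _ sdual set0 by apply/sbounded_sdualP; exact: sgrowth0.
split=> [/nbhs_initialP[V /(nbhs_familyP _ _ bU b0)[K [E [bK]]]]|].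
  move=> /entourage_lambda2P[q [e [e0 hE]]] h VU.
  exists K, q.+1, (e / 4); split=> [||S hS]; [exact/sbounded_sdualP|by rewrite divr_gt0|].
  apply: VU; apply: h => xi Kxi; apply: hE.
  have [|_ /le_lt_trans] := @rapid_norm R (T xi - S xi : sspace) q (e / 4); last apply.
    by move=> m; have := hS xi m Kxi; rewrite normcB.
  by rewrite mulrCA gtr_pMr// ltr_pdivrMr// mul1r ltr_nat.
move=> [K [q [e [bK e0 h]]]]; apply/nbhs_initialP.
exists [set g | forall xi, K xi -> lambda2_norm (rapid_matrix R) q (T xi - g xi) < e].
  apply/(nbhs_familyP _ _ bU b0).
  exists K, [set xy | lambda2_norm (rapid_matrix R) q (xy.1 - xy.2) < e].
  split=> //; first exact/sbounded_sdualP.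
  by apply/entourage_lambda2P; exists q, e.
move=> S hS; apply: h => xi m Kxi; apply: le_trans (ltW (hS xi Kxi)).
by rewrite normcB; exact: (@rapid_coord R (T xi - S xi)).
Qed.

(** The weight on N x N: its q-th power is the product of the q-th powers in
    both variables, and its inverse square has a finite double sum. *)
Definition idx2 (p : nat * nat) : R := idx p.1 * idx p.2.

Lemma idx2_sum (s : seq (nat * nat)) : uniq s -> \sum_(i <- s) (idx2 i ^+ 2)^-1 <= 4.
Proof.
move=> us; pose N := (\max_(i <- s) (i.1 + i.2)).+1.
rewrite (@le_trans _ _ (\sum_(i <- [seq (m, n) | m <- index_iota 0 N, n <- index_iota 0 N])
    (idx2 i ^+ 2)^-1))//.
  apply: uniq_sub_sum => //.
  - by move=> i; rewrite invr_ge0 sqr_ge0.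
  - by apply: allpairs_uniq => [||[a b] [c d] _ _ /= [-> ->]]; rewrite ?iota_uniq.
  - move=> i si; have iN : (i.1 + i.2 < N)%N 
      by rewrite ltnS; exact: (@leq_bigmax_seq _ s xpredT (fun i => i.1 + i.2)%N).
    apply/allpairsP; exists i; rewrite !mem_index_iota/=; split; last by case: (i).
      by rewrite (leq_ltn_trans _ iN)// leq_addr.
    by rewrite (leq_ltn_trans _ iN)// leq_addl.
rewrite big_allpairs /=.
have S0 : 0 <= \sum_(0 <= n < N) (n.+1%:R ^+ 2)^-1 :> R.
  by apply: sumr_ge0 => n _; rewrite invr_ge0 sqr_ge0.
have S2 : \sum_(0 <= n < N) (n.+1%:R ^+ 2)^-1 <= 2 :> R.
  by rewrite (le_trans (sum_inv_sq 0 N))// divr1.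
rewrite (eq_bigr (fun m => (m.+1%:R ^+ 2)^-1 * \sum_(0 <= n < N) (n.+1%:R ^+ 2)^-1)); last first.
  by move=> m _; rewrite mulr_sumr; apply: eq_bigr => n _; rewrite /idx2 exprMn invfM.
by rewrite -mulr_suml (_ : 4 = 2 * 2 :> R) ?ler_pM// -natrM.
Qed.

Definition Lss_co (T : Lss R) (p : nat * nat) : R[i] := entry T p.1 p.2.

Lemma Lss_eqP (S T : Lss R) : (forall p, Lss_co S p = Lss_co T p) -> S = T.
Proof.
move=> h; apply: val_inj; apply: operator_eqP; try exact: Lss_linear;
  try exact: Lss_continuous.
by move=> m n; exact: (h (m, n)).
Qed.

(** A neighbourhood of T is given by a bounded subset of s', which has a common
    polynomial bound, so a weight of higher order on the entries controls it.
    Conversely the vectors (n + 1)^q e_n form a bounded subset of s' on which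
    uniform smallness in the norm q is smallness of the entries. *)
Lemma Lss_model : @sup_model R (Lss R) (nat * nat)%type idx2 Lss_co.
Proof.
split=> //.
- exact: Lss_eqP.
- move=> T q; have [C hC] := operator_rapid (@Lss_linear T) (@Lss_continuous T) q.
  by exists C => -[m n]; exact: hC.
- move=> t ht; have ht' q : exists C : R, forall m n,
      normc (t (m, n)) * (idx m * idx n) ^+ q <= C.
    by have [C hC] := ht q; exists C => m n; exact: (hC (m, n)).
  by exists (Lss_of ht') => -[m n]; rewrite /Lss_co Lss_ofE.
- move=> T U; split=> [/nbhs_LssP[K [q [e [[r [C [C0 hK]]] e0 h]]]]|[q [e [e0 h]]]].
    exists (maxn q r.+2), (e / (2 * (C + 1))).
    have C1 : 0 < 2 * (C + 1) by rewrite mulr_gt0// ltr_wpDl.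
    split=> [|S hS]; first by rewrite divr_gt0.
    apply: h => xi m Kxi.
    have := ssum_lin (-1) (operator_ssum (@Lss_linear T) (@Lss_continuous T) xi m)
      (operator_ssum (@Lss_linear S) (@Lss_continuous S) xi m).
    rewrite mulN1r addrC => hs.
    rewrite -ler_pdivlMr ?idxX_gt0//.
    have -> : e / idx m ^+ q = 2 * (e / (2 * (C + 1)) / idx m ^+ q * (C + 1)).
      by field; rewrite ?gt_eqF ?idxX_gt0 ?ltr_wpDl.
    apply: ssum_le hs => n.
    have -> : -1 * (entry T m n * xi n) + entry S m n * xi n =
      (Lss_co S (m, n) - Lss_co T (m, n)) * xi n by rewrite /Lss_co /=; ring.
    rewrite ComplexField.Normc.normcM.
    set a := normc (_ - _); have a0 : 0 <= a by exact: normc_ge0.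
    have := hS (m, n); rewrite -/a /idx2 /= => ha.
    rewrite (@le_trans _ _ (a * (C * idx n ^+ r) * idx n ^+ 2))//.
      by rewrite ler_wpM2r ?(ltW (idxX_gt0 _ _))// ler_wpM2l// hK.
    have -> : a * (C * idx n ^+ r) * idx n ^+ 2 = a * idx n ^+ r.+2 * C.
      by rewrite -(addn2 r) exprD; ring.
    apply: ler_pM; [|exact: C0| |by rewrite lerDl].
      by apply: mulr_ge0 => //; exact: ltW (idxX_gt0 _ _).
    rewrite ler_pdivlMr ?idxX_gt0//; apply: le_trans ha.
    rewrite -mulrA ler_wpM2l// exprMn mulrC.
    by rewrite ler_pM ?(ltW (idxX_gt0 _ _))// ler_weXn2l ?idx_ge1// ?leq_maxl ?leq_maxr.
  apply/nbhs_LssP.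
  exists [set xi | exists n, xi = (idx n ^+ q)%:C *: sdual_delta n], q, e; split=> //.
    exists q, 1; split=> // _ [n ->] j.
    have -> : sdual_val ((idx n ^+ q)%:C *: sdual_delta n) j = (idx n ^+ q)%:C * (j == n)%:R.
      by rewrite -sdual_deltaE.
    rewrite mul1r.
    case: eqVneq => [->|_]; last first.
      by rewrite mulr0 ComplexField.Normc.normc0 ltW// idxX_gt0.
    by rewrite mulr1 normcR gtr0_norm ?idxX_gt0.
  move=> S hS; apply: h => -[m n]; have := hS _ m (ex_intro _ n erefl).
  rewrite (linZ (@Lss_linear S)) (linZ (@Lss_linear T)).
  have e1 (T' : Lss R) : lambda2_val ((idx n ^+ q)%:C *: T' (sdual_delta n) : sspace) m =
    (idx n ^+ q)%:C * Lss_co T' (m, n) by [].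
  rewrite !e1 -mulrBr ComplexField.Normc.normcM normcR gtr0_norm ?idxX_gt0//.
  have -> : idx2 (m, n) ^+ q = idx m ^+ q * idx n ^+ q by rewrite /idx2 exprMn.
  set a := normc _ => H; apply: le_trans H.
  by rewrite [leLHS]mulrC [leRHS]mulrAC [idx n ^+ q * _]mulrC.
- by move=> [m n]; rewrite /idx2 mulr_ege1// idx_ge1.
- by exists 4; exact: idx2_sum.
Qed.

End smooth_operators.

(** * Diagonal subspaces *)

(** The matrix A normalised by u and refined along a subsequence of its levels,
    so that the constants disappear: b_j0 = 1 and b_jq^2 <= b_j(q+1).  Then b is
    increasing with b >= 1, products and powers of its entries are dominated by
    entries at higher levels, and summability of 1 / b_j1 alone gives
    summability of the quotients at all levels. *)
Record squaring_frame {R : realType} (A : koethe_matrix R) (u : nat -> R)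
    (b : nat -> nat -> R) : Prop := SquaringFrame {
  frame_gt0 : forall j, 0 < u j ;
  frame_1 : forall j, b j 0%N = 1 ;
  frame_sqr : forall j q, b j q ^+ 2 <= b j q.+1 ;
  frame_sum : exists S : R, forall N, \sum_(0 <= j < N) (b j 1%N)^-1 <= S ;
  frame_le : forall q, exists r (C : R), 0 < C /\ forall j, A j q <= C * (u j * b j r) ;
  frame_ge : forall q, exists r (C : R), 0 < C /\ forall j, u j * b j q <= C * A j r }.

Section frame_theory.
Context {R : realType} (A : koethe_matrix R) (u : nat -> R) (b : nat -> nat -> R).
Context (fr : squaring_frame A u b).

Lemma frame_ge1 j q : 1 <= b j q.
Proof.
elim: q => [|q ih]; first by rewrite (frame_1 fr).
by rewrite (le_trans _ (frame_sqr fr j q))// exprn_ege1.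
Qed.

Lemma frame_pos j q : 0 < b j q.
Proof. exact: lt_le_trans ltr01 (frame_ge1 _ _). Qed.

Lemma frame_homo j q r : (q <= r)%N -> b j q <= b j r.
Proof.
move=> /subnK <-; elim: (r - q)%N => [|k ih]; first by rewrite add0n.
rewrite addSn (le_trans ih)// (le_trans _ (frame_sqr fr _ _))// expr2.
by rewrite ler_peMr ?frame_ge1// ltW// frame_pos.
Qed.

Lemma frame_mul j q r s : (q < s)%N -> (r < s)%N -> b j q * b j r <= b j s.
Proof.
case: s => // s; rewrite !ltnS => qs rs; apply: le_trans (frame_sqr fr j s).
by rewrite expr2 ler_pM ?frame_homo// ltW// frame_pos.
Qed.

Lemma frame_exp j r q : b j r ^+ q <= b j (r + q).
Proof.
elim: q => [|q ih]; first by rewrite expr0 frame_ge1.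
rewrite exprS addnS (@le_trans _ _ (b j r * b j (r + q)))//.
  by rewrite ler_pM2l ?frame_pos.
by apply: frame_mul; rewrite ltnS// leq_addr.
Qed.

(** Nuclearity in the form used below: the l^2 norms of lambda^2(A) are
    dominated by weighted sup norms.  The extra factor b_j1, available since
    b_jr b_j1 is at most an entry of higher level, makes the bounds on the
    coordinates square summable. *)
Lemma frame_norm_le q : exists r (C : R), 0 < C /\ forall (xi : nat -> R[i]) c,
  (forall j, normc (xi j) * u j * b j r <= c) ->
  (wsum (A ^~ q) xi < +oo)%E /\ wnorm (A ^~ q) xi <= C * c.
Proof.
have [r [C [C0 hC]]] := frame_le fr q; have [S hS] := frame_sum fr.
have S0 : 0 <= S by have := hS 0%N; rewrite big_geq.
exists (maxn r 1).+1, (C * (S + 1)); split; first by rewrite mulr_gt0// ltr_wpDl.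
move=> xi c hc; have c0 : 0 <= c.
  by rewrite (le_trans _ (hc 0%N))// !mulr_ge0 ?normc_ge0// ltW// ?(frame_gt0 fr) ?frame_pos.
apply: wsum_bound => [|N]; first by rewrite !mulr_ge0 ?addr_ge0// ltW.
have h j : normc (xi j) * A j q <= C * c * (b j 1%N)^-1.
  rewrite ler_pdivlMr ?frame_pos//.
  rewrite (@le_trans _ _ (C * (normc (xi j) * u j * b j (maxn r 1).+1)))//; last first.
    by rewrite ler_pM2l.
  rewrite (@le_trans _ _ (normc (xi j) * (C * (u j * b j r)) * b j 1%N))//.
    by rewrite ler_pM2r ?frame_pos// ler_wpM2l ?normc_ge0.
  have -> : normc (xi j) * (C * (u j * b j r)) * b j 1%N =
    C * (normc (xi j) * u j * (b j r * b j 1%N)) by ring.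
  rewrite ler_pM2l// ler_wpM2l ?mulr_ge0 ?normc_ge0 ?(ltW (frame_gt0 fr _))//.
  by apply: frame_mul; rewrite ltnS ?leq_maxl ?leq_maxr.
rewrite (@le_trans _ _ (\sum_(0 <= j < N) (C * c) ^+ 2 * (b j 1%N)^-1))//.
  apply: ler_sum => j _; rewrite -exprMn.
  rewrite (@le_trans _ _ ((C * c * (b j 1%N)^-1) ^+ 2))//.
    by rewrite ler_pXn2r ?nnegrE ?mulr_ge0 ?normc_ge0 ?koethe_ge0 ?invr_ge0 ?(ltW C0)
      ?(ltW (frame_pos _ _)).
  rewrite exprMn ler_wpM2l ?sqr_ge0// expr2 ler_piMr ?invr_ge0 ?(ltW (frame_pos _ _))//.
  by rewrite invf_le1 ?frame_pos ?frame_ge1.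
rewrite -mulr_sumr (le_trans (ler_wpM2l (sqr_ge0 _) (hS N)))//.
have -> : (C * (S + 1) * c) ^+ 2 = (C * c) ^+ 2 * (S + 1) ^+ 2 by ring.
by rewrite ler_wpM2l ?sqr_ge0//; nra.
Qed.

Lemma frame_norm_ge q : exists r (C : R), 0 < C /\ forall (x : lambda2 A) j,
  normc (x j) * u j * b j q <= C * lambda2_norm A r x.
Proof.
have [r [C [C0 hC]]] := frame_ge fr q; exists r, C; split=> // x j.
rewrite -mulrA (le_trans (ler_wpM2l (normc_ge0 _) (hC j)))// mulrCA ler_pM2l//.
exact: lambda2_coord.
Qed.

End frame_theory.

Section diagonal_embedding.
Context {R : realType} (A : koethe_matrix R) (u : nat -> R) (b : nat -> nat -> R).
Context (fr : squaring_frame A u b).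
Context {E : preTopologicalLmodType R[i]} {I : choiceType}.
Context (w : I -> R) (co : E -> I -> R[i]) (mE : sup_model w co).
Context (J : I -> option nat) (d : I -> R).

(** The coordinates of sum_j tau_j v_j, where the v_j have disjoint supports:
    J i is the j whose support contains i, if any, and d i is the coordinate
    of v_j at i. *)
Definition pattern (tau : nat -> R[i]) (i : I) : R[i] :=
  if J i is Some j then tau j * (d i)%:C else 0.

Definition pattern_space : set E := [set x | exists tau, forall i, co x i = pattern tau i].

Lemma pattern_lin c s t i :
  pattern (fun j => c * s j + t j) i = c * pattern s i + pattern t i.
Proof.
by rewrite /pattern; case: (J i) => [j|]; [rewrite mulrDl mulrA|rewrite mulr0 addr0].
Qed.

Lemma pattern_space_subspace : is_subspace pattern_space.
Proof.
split.
  exists (fun=> 0) => i; rewrite (model0 mE) /pattern.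
  by case: (J i) => // j; rewrite mul0r.
move=> c x y [s hs] [t ht]; exists (fun j => c * s j + t j) => i.
by rewrite (model_lin mE) hs ht pattern_lin.
Qed.

Context (d_ge0 : forall i, 0 <= d i).
Context (d_le : forall q, exists r (C : R), forall i j, J i = Some j ->
  d i * w i ^+ q <= C * b j r).
Context (d_ge : forall q, exists r (C : R), 0 < C /\ forall j,
  exists2 i, J i = Some j & b j q <= C * (d i * w i ^+ r)).

Lemma pattern_anchor : exists i0 : nat -> I, forall j, J (i0 j) = Some j /\ 0 < d (i0 j).
Proof.
have [r [C [C0 h]]] := d_ge 0.
have ex j : exists i, J i = Some j /\ 0 < d i.
  have [i Ji hi] := h j; exists i; split=> //; rewrite lt_def d_ge0 andbT.
  apply/eqP => di; move: hi; rewrite di mul0r mulr0.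
  by rewrite leNgt (frame_pos fr).
by have [i0 hi0] := boolp.choice ex; exists i0.
Qed.

(** Membership means that coordinates outside all supports vanish and that
    coordinates in the same support are in the ratio prescribed by d; these are
    closed conditions.  One anchor i0 j in each support, with d (i0 j) > 0,
    recovers tau. *)
Lemma pattern_space_closed : closed pattern_space.
Proof.
have [i0 hi0] := pattern_anchor.
move=> x clx; have near_eq e : 0 < e -> exists2 y, pattern_space y &
    forall i, normc (co y i - co x i) <= e.
  move=> e0; have : nbhs x [set y | forall i, normc (co y i - co x i) <= e].
    apply/(model_nbhs mE); exists 0%N, e; split=> // y hy i.
    by have := hy i; rewrite expr0 mulr1.
  by move=> /clx[y [By hy]]; exists y.
have zero (z : R[i]) (K : R) : 0 <= K -> (forall e, 0 < e -> normc z <= e * K) -> z = 0.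
  move=> K0 hz; apply: ComplexField.Normc.eq0_normc; apply/eqP.
  rewrite eq_le normc_ge0 andbT; apply/ler_addgt0Pr => e e0; rewrite add0r.
  have K1 : 0 < K + 1 by rewrite ltr_wpDl.
  rewrite (le_trans (hz (e / (K + 1)) _)) ?divr_gt0// mulrAC ler_pdivrMr//.
  by rewrite ler_wpM2l ?(ltW e0)// lerDl.
exists (fun j => co x (i0 j) / (d (i0 j))%:C) => i.
rewrite /pattern; case Ji : (J i) => [j|].
  have [J0 d0] := hi0 j; have d0' : (d (i0 j))%:C != 0 by rewrite fmorph_eq0 gt_eqF.
  suff : co x i * (d (i0 j))%:C - co x (i0 j) * (d i)%:C = 0.
    move=> /eqP; rewrite subr_eq0 => /eqP h.
    by rewrite mulrAC -h mulfK.
  apply: (zero _ (d (i0 j) + d i)) => [|e e0]; first by rewrite addr_ge0.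
  have [y [t ht] hy] := near_eq e e0.
  have yE : co y i * (d (i0 j))%:C = co y (i0 j) * (d i)%:C.
    by rewrite !ht /pattern Ji J0 mulrAC.
  have -> : co x i * (d (i0 j))%:C - co x (i0 j) * (d i)%:C =
    (co y (i0 j) - co x (i0 j)) * (d i)%:C - (co y i - co x i) * (d (i0 j))%:C.
    by rewrite !mulrBl yE; ring.
  rewrite (le_trans (normcD _ _))// normcN !ComplexField.Normc.normcM !normcR.
  rewrite !ger0_norm// addrC mulrDr lerD// ler_wpM2r ?hy//.
apply: (zero _ 1) => // e e0; have [y [t ht] hy] := near_eq e e0.
by have := hy i; rewrite ht /pattern Ji sub0r normcN mulr1.
Qed.

(** If the q-th norms of the v_j are equivalent to b_jq up to a shift of q, then
    x is mapped to the combination with coefficients x_j u_j.  By disjointness of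
    the supports the sup norm of the image is a supremum over j of
    |x_j| u_j b_jr, which is equivalent to the norms of lambda^2(A). *)
Lemma pattern_isomorphic : isomorphic_onto (lambda2 A) pattern_space.
Proof.
have [i0 hi0] := pattern_anchor.
have up q : exists r (C : R), 0 < C /\ forall (x : lambda2 A) i,
    normc (pattern (fun j => x j * (u j)%:C) i) * w i ^+ q <= C * lambda2_norm A r x.
  have [r [C hC]] := d_le q; have [r' [C' [C'0 hC']]] := frame_norm_ge fr r.
  exists r', ((`|C| + 1) * C'); split; first by rewrite mulr_gt0// ltr_wpDl.
  move=> x i; rewrite /pattern; case Ji : (J i) => [j|]; last first.
    rewrite ComplexField.Normc.normc0 mul0r !mulr_ge0 ?addr_ge0 ?(ltW C'0)//.
    exact: lambda2_norm_ge0.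
  rewrite !ComplexField.Normc.normcM !normcR (ger0_norm (d_ge0 i)).
  rewrite (ger0_norm (ltW (frame_gt0 fr j))) -mulrA.
  rewrite (@le_trans _ _ (normc (x j) * u j * ((`|C| + 1) * b j r)))//.
    rewrite ler_wpM2l ?mulr_ge0 ?normc_ge0 ?(ltW (frame_gt0 fr _))//.
    rewrite (le_trans (hC i j Ji))// ler_wpM2r ?(ltW (frame_pos fr _ _))//.
    by rewrite (le_trans (ler_norm C))// lerDl.
  by rewrite mulrCA -[leRHS]mulrA ler_wpM2l ?addr_ge0.
have lo q : exists r (C : R), 0 < C /\ forall (t : nat -> R[i]) c,
    (forall i, normc (pattern (fun j => t j * (u j)%:C) i) * w i ^+ r <= c) ->
    (wsum (A ^~ q) t < +oo)%E /\ wnorm (A ^~ q) t <= C * c.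
  have [r [C [C0 hC]]] := frame_norm_le fr q; have [r' [C' [C'0 hC']]] := d_ge r.
  exists r', (C * C'); split; first by rewrite mulr_gt0.
  move=> t c hc; rewrite -mulrA; apply: hC => j; have [i Ji hi] := hC' j.
  have := hc i; rewrite /pattern Ji !ComplexField.Normc.normcM !normcR.
  rewrite (ger0_norm (d_ge0 i)) (ger0_norm (ltW (frame_gt0 fr j))) => hci.
  rewrite (@le_trans _ _ (normc (t j) * u j * (C' * (d i * w i ^+ r'))))//.
    by rewrite ler_wpM2l// mulr_ge0 ?normc_ge0// ltW// (frame_gt0 fr).
  by rewrite mulrCA ler_pM2l// mulrA.
have exf (x : lambda2 A) : exists y, forall i, co y i = pattern (fun j => x j * (u j)%:C) i.
  by apply: (model_surj mE) => q; have [r [C [C0 hC]]] := up q; eexists => i; exact: hC.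
have [f fE] := boolp.choice exf.
have fl : linear f.
  move=> c x y; apply: (model_inj mE) => i; rewrite (model_lin mE) !fE -pattern_lin.
  rewrite /pattern; case: (J i) => // j; rewrite lambda2P; ring.
have finj x y : f x = f y -> x = y.
  move=> fxy; apply: lambda2_eqP => j; have [J0 d0] := hi0 j.
  have := congr1 (co ^~ (i0 j)) fxy; rewrite !fE /pattern J0.
  have uj := frame_gt0 fr j.
  by move=> /mulIf; rewrite fmorph_eq0 gt_eqF// => /(_ isT) /mulIf;
    rewrite fmorph_eq0 gt_eqF// => /(_ isT).
have exg y : exists x, pattern_space y -> f x = y.
  have [[t ht]|nB] := pselect (pattern_space y); last by exists 0.
  pose s j := t j / (u j)%:C.
  have sE i : pattern (fun j => s j * (u j)%:C) i = co y i.
    rewrite ht /pattern; case: (J i) => // j; rewrite /s divfK//.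
    by rewrite fmorph_eq0 gt_eqF// (frame_gt0 fr).
  have sfin q : (wsum (A ^~ q) s < +oo)%E.
    have [r [C [C0 hC]]] := lo q; have [D hD] := model_rapid mE y r.
    by have [|//] := hC s D => i; rewrite sE.
  exists (lambda2_of sfin) => _; apply: (model_inj mE) => i.
  by rewrite fE -sE.
have [g gE] := boolp.choice exg.
have fB x : pattern_space (f x) by exists (fun j => x j * (u j)%:C) => i; rewrite fE.
exists f, g; split=> //.
- apply/seteqP; split=> [_ [x _ <-]|y By]; first exact: fB.
  by exists (g y) => //; exact: gE.
- by move=> x; apply: finj; exact: gE.
- move=> x U /(model_nbhs mE)[q [e [e0 hU]]]; have [r [C [C0 hC]]] := up q.
  apply/nbhs_lambda2P; exists r, (e / C); split=> [|y hy]; first by rewrite divr_gt0.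
  apply: hU => i; rewrite -(modelB mE) -(linB fl) fE (le_trans (hC _ _))//.
  by rewrite -ler_pdivlMl// mulrC ltW.
- apply/subspace_continuousP => y By U /nbhs_lambda2P[q [e [e0 hU]]].
  have [r [C [C0 hC]]] := lo q; apply/(model_nbhs mE).
  exists r, (e / 2 / C); split=> [|z hz Bz]; first by rewrite !divr_gt0.
  apply: hU; have [|_ /le_lt_trans] := hC (g z - g y) (e / 2 / C); last apply.
    by move=> i; rewrite -(fE (g z - g y)) (linB fl) (modelB mE) !gE.
  by rewrite mulrC divfK ?gt_eqF// ltr_pdivrMr// ltr_pMr// ltr1n.
Qed.

End diagonal_embedding.

(** * Disjointly supported vectors with prescribed norms *)

Section frame_construction.
Context {R : realType} (A : koethe_matrix R).

(** Level 0 is a_jp / a_jp, level 1 is a_jr / a_jp with r such that the inverses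
    are summable.  From level D a_js / a_jp on, the inequality
    a_js^2 <= C a_jp a_jr shows that D^2 C a_jr / a_jp dominates the square; the
    recursion st produces the pairs (s, D). *)
Lemma koethe_frame : koethe_summable A -> koethe_DN A ->
  exists u b, @squaring_frame R A u b.
Proof.
move=> hs [p hp]; have Ap := koethe_DN_gt0 hp.
have [r1 pr1 [S hS]] := koethe_summable_bound p p hs.
have ex q : exists rC : nat * R, [/\ (q < rC.1)%N, 0 < rC.2 &
    forall j, A j q ^+ 2 <= rC.2 * A j p * A j rC.1].
  have [r [C [C0 hC]]] := hp q; exists (maxn r q.+1, C); split=> //=.
    by rewrite leq_maxr.
  move=> j; apply: (le_trans (hC j)); rewrite ler_wpM2l ?koethe_homo ?leq_maxl//.
  by rewrite mulr_ge0 ?koethe_ge0// ltW.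
have [f hf] := boolp.choice ex.
pose st := fix st n : nat * R := if n is m.+1 then
  ((f (st m).1).1, (st m).2 ^+ 2 * (f (st m).1).2) else (r1, 1).
have st_gt0 n : 0 < (st n).2.
  by elim: n => //= n ih; have [_ h _] := hf (st n).1; rewrite mulr_gt0 ?exprn_gt0.
have st_ge n : (n <= (st n).1)%N.
  by elim: n => //= n ih; have [h _ _] := hf (st n).1; rewrite (leq_ltn_trans ih).
pose b j q := if q is n.+1 then (st n).2 * A j (st n).1 / A j p else 1.
exists (fun j => A j p), b; split=> //.
- move=> j [|n] /=.
    by rewrite expr1n mul1r ler_pdivlMr// mul1r koethe_homo.
  have [_ _ h] := hf (st n).1; rewrite ler_pdivlMr//.
  rewrite (_ : _ ^+ 2 * A j p = (st n).2 ^+ 2 * A j (st n).1 ^+ 2 / A j p); last first.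
    by field; rewrite gt_eqF.
  rewrite ler_pdivrMr//.
  rewrite [leRHS](_ : _ = (st n).2 ^+ 2 * ((f (st n).1).2 * A j p * A j (f (st n).1).1)).
    by apply: ler_wpM2l => //; exact: sqr_ge0.
  ring.
- exists S => N; apply: le_trans (hS N); apply: ler_sum => j _.
  by rewrite /b /= mul1r invf_div.
- move=> q; exists q.+1, (st q).2^-1; rewrite invr_gt0; split=> // j.
  rewrite /b ler_pdivlMl// [leRHS]mulrC divfK ?gt_eqF//.
  by rewrite ler_pM2l// koethe_homo.
- move=> [|q].
    by exists p, 1; split=> // j; rewrite mulr1 mul1r.
  exists (st q).1, (st q).2; split=> // j.
  by rewrite /b mulrC divfK ?gt_eqF.
Qed.

End frame_construction.

(** An injective pairing of polynomial size, so that positions stay comparable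
    with the entries of b. *)
Definition npair (a c : nat) : nat := ((a + c) ^ 2 + a)%N.

Lemma npair_inj a c a' c' : npair a c = npair a' c' -> a = a' /\ c = c'.
Proof.
rewrite /npair => h; have e : (a + c = a' + c')%N.
  have sq_lt m n k l : (k + l < m + n)%N -> ((k + l) ^ 2 + k < (m + n) ^ 2 + m)%N.
    move=> klmn; apply: (@leq_trans ((k + l).+1 ^ 2)); last first.
      by rewrite (leq_trans _ (leq_addr _ _))// leq_exp2r.
    rewrite -[(k + l).+1]addn1 [X in (_ < X)%N]sqrnD -addnA ltn_add2l muln1 exp1n add1n ltnS.
    by rewrite mul2n -addnn -addnA leq_addr.
  by case: (ltngtP (a + c) (a' + c')) => // /sq_lt; rewrite h ltnn.
by move: h; rewrite e => /addnI aa; split=> //; move: e; rewrite aa => /addnI.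
Qed.

Section positions.
Context {R : realType} (A : koethe_matrix R) (u : nat -> R) (b : nat -> nat -> R).
Context (fr : squaring_frame A u b).
Local Notation idx := (@idx R).

(** The index j is not bounded in terms of b_j1, but floor1 j together with
    rank1 j, the number of smaller indices with the same floor, determines j and
    is bounded by a multiple of b_j1. *)
Definition floor1 j : nat := Num.truncn (b j 1%N).
Definition rank1 j : nat := count (fun i => floor1 i == floor1 j) (iota 0 j).
(** The position n(j, k) of the k-th entry of the j-th vector.  Encoding a
    number just above b_jk makes the position at least b_jk. *)
Definition pos j k : nat :=
  npair (npair (floor1 j) (rank1 j)) (npair k (Num.truncn (b j k)).+1).

Lemma rank1_lt i j : (i < j)%N -> floor1 i = floor1 j -> (rank1 i < rank1 j)%N.
Proof.
move=> ij e; rewrite /rank1 (_ : iota 0 j = iota 0 i ++ i :: iota i.+1 (j - i.+1)).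
  by rewrite count_cat /= e eqxx add1n addnS ltnS leq_addr.
by rewrite -[X in _ ++ X]/(iota (0 + i) (j - i.+1).+1) -iotaD addnS -addSn subnKC.
Qed.

Lemma pos_inj j k j' k' : pos j k = pos j' k' -> j = j' /\ k = k'.
Proof.
move=> /npair_inj[/npair_inj[ef er] /npair_inj[-> _]]; split=> //.
by case: (ltngtP j j') => // h; have := rank1_lt h; rewrite ?ef ?er ltnn => /(_ erefl).
Qed.

Lemma pos_ge j k : b j k <= idx (pos j k).
Proof.
rewrite (le_trans (ltW (truncnS_gt (b j k))))// /idx ler_nat /pos.
set c := (Num.truncn _).+1.
have le_npair x y : (y <= npair x y)%N.
  rewrite /npair (@leq_trans ((x + y) ^ 2))// ?leq_addr// -mulnn.
  by case: (posnP (x + y)) => [/eqP|xy]; [rewrite addn_eq0 => /andP[_ /eqP ->]|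
    rewrite (leq_trans (leq_addl x y))// leq_pmull].
exact: leq_trans (le_npair k c) (leq_trans (le_npair _ _) (leqnSn _)).
Qed.

Lemma npair_le (a c : nat) (X : R) : 1 <= X -> a%:R <= X -> c%:R <= X ->
  (npair a c)%:R <= 5 * X ^+ 2.
Proof.
move=> X1 aX cX; have a0 : 0 <= a%:R :> R by []; have c0 : 0 <= c%:R :> R by [].
rewrite /npair natrD natrX natrD; nra.
Qed.

(** The indices counted by rank1 j all have b_i1 < floor1 j + 1, so each of them
    contributes at least 1 / (floor1 j + 1) to the convergent sum of the
    1 / b_i1. *)
Lemma rank1_le : exists2 S : R, 0 <= S & forall j, (rank1 j)%:R <= S * b j 1%N.
Proof.
have [S hS] := frame_sum fr.
have S0 : 0 <= S by have := hS 0%N; rewrite big_geq.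
exists (2 * S) => [|j]; first by rewrite mulr_ge0.
have fj : (floor1 j)%:R <= b j 1%N by rewrite truncn_le// ltW// (frame_pos fr).
have h : (rank1 j)%:R * ((floor1 j).+1%:R)^-1 <= S.
  apply: le_trans (hS j); rewrite /rank1 -sum1_count natr_sum mulr_suml.
  rewrite big_mkcond /= /index_iota subn0; apply: ler_sum => i _; case: eqP => [e|_].
    rewrite mul1r lef_pV2 ?posrE ?(frame_pos fr)// -e ltW// truncnS_gt//.
  by rewrite invr_ge0 ltW// (frame_pos fr).
rewrite ler_pdivrMr// in h; apply: (le_trans h).
rewrite [2 * S]mulrC -mulrA ler_wpM2l// -natr1 mulr_natl mulr2n lerD//.
exact: (frame_ge1 fr).
Qed.

Lemma pos_le : exists D : nat -> R, (forall k, 0 <= D k) /\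
  forall j k, idx (pos j k) <= D k * b j (k + 3)%N.
Proof.
have [S S0 hS] := rank1_le.
pose E k : R := 5 * (1 + S) ^+ 2 + 5 * (k%:R + 2) ^+ 2.
exists (fun k => 6 * E k ^+ 2); split=> [k|j k]; first by rewrite mulr_ge0 ?sqr_ge0.
have b1 q : 1 <= b j q := frame_ge1 fr j q.
have b0 q : 0 <= b j q := le_trans ler01 (b1 q).
have trunc_le q : (Num.truncn (b j q))%:R <= b j q by rewrite truncn_le.
have k0 : 0 <= k%:R :> R by [].
have B1 : (npair (floor1 j) (rank1 j))%:R <= E k * b j (k + 2)%N.
  rewrite (le_trans (@npair_le _ _ ((1 + S) * b j 1%N) _ _ _))//.
  - by have := b1 1%N; nra.
  - by rewrite (le_trans (trunc_le _))//; have := b0 1%N; nra.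
  - by rewrite (le_trans (hS j))//; have := b0 1%N; nra.
  rewrite exprMn (@le_trans _ _ (5 * ((1 + S) ^+ 2 * b j (k + 2)%N)))//.
    rewrite ler_pM2l// ler_wpM2l ?sqr_ge0// (le_trans (frame_sqr fr _ _))//.
    by rewrite (frame_homo fr)// leq_addl.
  by rewrite mulrA [leRHS]mulrDl lerDl !mulr_ge0 ?sqr_ge0.
have B2 : (npair k (Num.truncn (b j k)).+1)%:R <= E k * b j (k + 2)%N.
  rewrite (le_trans (@npair_le _ _ ((k%:R + 2) * b j k) _ _ _))//.
  - by have := b1 k; nra.
  - by have := b1 k; nra.
  - by rewrite -natr1; have := trunc_le k; have := b1 k; nra.
  rewrite exprMn (@le_trans _ _ (5 * ((k%:R + 2) ^+ 2 * b j (k + 2)%N)))//.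
    rewrite ler_pM2l// ler_wpM2l ?sqr_ge0// (le_trans (frame_sqr fr _ _))//.
    by rewrite (frame_homo fr)// addn2.
  by rewrite mulrA [leRHS]mulrDl lerDr !mulr_ge0 ?addr_ge0.
have E1 : 1 <= E k by rewrite /E; nra.
have X1 : 1 <= E k * b j (k + 2)%N by rewrite mulr_ege1.
rewrite /idx /pos -natr1 (le_trans (lerD (npair_le X1 B1 B2) (lexx _)))//.
have sq1 : 1 <= (E k * b j (k + 2)%N) ^+ 2 by rewrite exprn_ege1.
rewrite (@le_trans _ _ (6 * (E k * b j (k + 2)%N) ^+ 2))//; first by lra.
rewrite exprMn mulrA ler_wpM2l ?mulr_ge0 ?(le_trans ler01 E1)//.
by rewrite (le_trans (frame_sqr fr _ _))// addn2 addn3.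
Qed.

(** The k-th entry of the j-th vector.  With n = n(j, k), its contribution to
    the q-th norm is 2^-k b_jk n^(q-k): it is comparable with b_jq for k = q,
    and at most 1 for k > q because b_jk <= n.  For the finitely many k < q it is
    at most a power of n, hence of b_j(k+3), and powers of entries of b are
    dominated by entries of higher level. *)
Definition coef j k : R := 2^-1 ^+ k * b j k / idx (pos j k) ^+ k.

Lemma coef_gt0 j k : 0 < coef j k.
Proof.
by rewrite /coef divr_gt0 ?idxX_gt0// mulr_gt0 ?(frame_pos fr)// exprn_gt0// invr_gt0.
Qed.

Lemma coef_ge j q : b j q = 2 ^+ q * (coef j q * idx (pos j q) ^+ q).
Proof.
rewrite /coef divfK ?gt_eqF ?idxX_gt0// exprVn mulrA mulfV ?mul1r//.
Qed.

Lemma coef_le q : exists (r : nat) (C : R), 0 <= C /\ forall j k,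
  coef j k * idx (pos j k) ^+ q <= C * b j r.
Proof.
have [D [D0 hD]] := pos_le.
exists (q + q + 4)%N, (1 + \sum_(0 <= k < q) D k ^+ q).
have Dq k : 0 <= D k ^+ q by rewrite exprn_ge0.
have SD : 0 <= \sum_(0 <= k < q) D k ^+ q by exact: sumr_ge0.
split=> [|j k]; first by rewrite addr_ge0.
set n := idx (pos j k); have n0 r : 0 < n ^+ r by exact: idxX_gt0.
have n1 r : 1 <= n ^+ r by rewrite exprn_ege1// idx_ge1.
have half : 2^-1 ^+ k <= 1 :> R by rewrite exprn_ile1 ?invr_ge0// invf_le1// ler1n.
have half0 : 0 <= 2^-1 ^+ k :> R by rewrite exprn_ge0// invr_ge0.
have bk := frame_pos fr j k; have b0 r := ltW (frame_pos fr j r).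
have [kq|qk] := ltnP k q; last first.
  have -> : coef j k * n ^+ q = 2^-1 ^+ k * (b j k / n ^+ (k - q)).
    rewrite /coef -/n -{3}(subnK qk) exprD.
    by field; rewrite !gt_eqF.
  rewrite (@le_trans _ _ (b j k / n ^+ (k - q)))//.
    by rewrite ler_piMl// divr_ge0// ltW.
  rewrite (@le_trans _ _ (b j q))//; last first.
    rewrite (@le_trans _ _ (b j (q + q + 4)%N)) ?(frame_homo fr) -?addnA ?leq_addr//.
    by rewrite ler_peMl// lerDl.
  rewrite ler_pdivrMr//; move: qk; rewrite leq_eqVlt => /orP[/eqP ->|qk].
    by rewrite subnn expr0 mulr1.
  rewrite (@le_trans _ _ n) ?pos_ge//.
  rewrite (@le_trans _ _ (n ^+ (k - q)))// ?ler_peMl ?(frame_ge1 fr)// ?(ltW (n0 _))//.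
  by rewrite -[leLHS]expr1 ler_weXn2l ?idx_ge1// subn_gt0.
rewrite (@le_trans _ _ (b j k * n ^+ q))//.
  rewrite ler_pM2r// /coef -/n ler_pdivrMr// (@le_trans _ _ (b j k))//.
    by rewrite ler_piMl// ltW.
  by rewrite ler_peMr// ltW.
rewrite (@le_trans _ _ (D k ^+ q * b j (q + q + 4)%N))//; last first.
  rewrite ler_wpM2r// (bigD1_seq k)/= ?iota_uniq ?mem_index_iota//.
  by rewrite addrCA lerDl addr_ge0// sumr_ge0.
rewrite (@le_trans _ _ (b j k * (D k * b j (k + 3)%N) ^+ q))//.
  by rewrite ler_pM2l// lerXn2r ?nnegrE ?mulr_ge0 ?(ltW (idx_gt0 _))//; exact: hD.
rewrite exprMn mulrCA ler_wpM2l//.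
rewrite (@le_trans _ _ (b j k * b j (k + 3 + q)%N))//.
  by rewrite ler_pM2l// (frame_exp fr).
apply: (frame_mul fr); first by rewrite -addnA (leq_trans kq)// leq_addr.
by rewrite addn3 addn4 !addSn !ltnS leq_add2r ltnW.
Qed.

End positions.

(** * The commutative *-algebra spanned by the rank one operators *)

Section basis_pattern.
Context {R : realType} (A : koethe_matrix R) (u : nat -> R) (b : nat -> nat -> R).
Context (fr : squaring_frame A u b).
Local Notation idx := (@idx R).

Lemma realcM (x y : R) : (x * y)%:C = x%:C * y%:C :> R[i].
Proof. exact: rmorphM. Qed.

Lemma conjcM (x y : R[i]) : ((x * y)^*)%C = (x^*)%C * (y^*)%C.
Proof. exact: rmorphM. Qed.

Lemma conjcB (x y : R[i]) : ((x - y)^*)%C = (x^*)%C - (y^*)%C.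
Proof. exact: rmorphB. Qed.

Lemma conjc_sum (K : nat) (F : nat -> R[i]) :
  ((\sum_(0 <= k < K) F k)^*)%C = \sum_(0 <= k < K) ((F k)^*)%C.
Proof. exact: rmorph_sum. Qed.

(** A partial inverse of the map (j, k) |-> n(j, k). *)
Definition locate (i : nat) : option (nat * nat) :=
  if pselect (exists p : nat * nat, pos b p.1 p.2 = i) is left h
  then Some (projT1 (cid h)) else None.

Lemma locateP i p : locate i = Some p -> pos b p.1 p.2 = i.
Proof. by rewrite /locate; case: pselect => // h [<-]; case: cid. Qed.

Lemma locate_pos j k : locate (pos b j k) = Some (j, k).
Proof.
rewrite /locate; case: pselect => [h|]; last by case; exists (j, k).
by case: cid => -[j' k'] /= /pos_inj[-> ->].
Qed.

Definition owner i : option nat := omap fst (locate i).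
Definition profile i : R := if locate i is Some p then coef b p.1 p.2 else 0.

Lemma owner_pos j k : owner (pos b j k) = Some j.
Proof. by rewrite /owner locate_pos. Qed.

Lemma profile_pos j k : profile (pos b j k) = coef b j k.
Proof. by rewrite /profile locate_pos. Qed.

Lemma profile_ge0 i : 0 <= profile i.
Proof. by rewrite /profile; case: locate => // p; exact: ltW (coef_gt0 fr _ _). Qed.

Lemma profile_le q : exists r (C : R), 0 <= C /\ forall i j, owner i = Some j ->
  profile i * idx i ^+ q <= C * b j r.
Proof.
have [r [C [C0 hC]]] := coef_le fr q; exists r, C; split=> // i j.
rewrite /owner /profile; case E: (locate i) => [p|]//= [<-].
by rewrite -(locateP E).
Qed.

Lemma profile_ge q j : b j q = 2 ^+ q * (profile (pos b j q) * idx (pos b j q) ^+ q).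
Proof. by rewrite profile_pos; exact: coef_ge. Qed.

Lemma sspace_pattern : exists B : set (sspace R),
  [/\ is_subspace B, closed B & isomorphic_onto (lambda2 A) B].
Proof.
pose m := @sspace_model R.
have hle q : exists r (C : R), forall i j, owner i = Some j ->
    profile i * idx i ^+ q <= C * b j r.
  by have [r [C [_ hC]]] := profile_le q; exists r, C.
have hge q : exists r (C : R), 0 < C /\ forall j,
    exists2 i, owner i = Some j & b j q <= C * (profile i * idx i ^+ r).
  exists q, (2 ^+ q); split=> [|j]; first by rewrite exprn_gt0.
  by exists (pos b j q); rewrite ?owner_pos// -profile_ge.
exists (pattern_space (fun x : sspace R => lambda2_val x) owner profile); split.
- exact: (pattern_space_subspace m).
- exact: (pattern_space_closed fr m profile_ge0 hge).
- exact: (pattern_isomorphic fr m profile_ge0 hle hge).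
Qed.

Definition owner2 (p : nat * nat) : option nat :=
  if owner p.1 == owner p.2 then owner p.1 else None.
Definition profile2 (p : nat * nat) : R := profile p.1 * profile p.2.

Lemma owner2P m n j : owner2 (m, n) = Some j -> owner m = Some j /\ owner n = Some j.
Proof. by rewrite /owner2 /=; case: eqP => // <-. Qed.

Lemma owner2_eq m n j : owner m = Some j -> owner n = Some j -> owner2 (m, n) = Some j.
Proof. by rewrite /owner2 /= => -> ->; rewrite eqxx. Qed.

(** The operators sum_j t_j f_j (x) f_j: the entry at (m, n) is
    t_j f_j(m) f_j(n) if m and n both lie in the support of f_j, and 0 if they do
    not lie in a common support. *)
Definition diagonal_algebra : set (Lss R) := pattern_space (@Lss_co R) owner2 profile2.

Lemma diagonal_algebra_isomorphic :
  [/\ is_subspace diagonal_algebra, closed diagonal_algebra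
    & isomorphic_onto (lambda2 A) diagonal_algebra].
Proof.
pose m := @Lss_model R.
have h0 p : 0 <= profile2 p by rewrite mulr_ge0 ?profile_ge0.
have hle q : exists r (C : R), forall p j, owner2 p = Some j ->
    profile2 p * @idx2 R p ^+ q <= C * b j r.
  have [r [C [C0 hC]]] := profile_le q; exists r.+1, (C ^+ 2) => -[k l] j /owner2P[hk hl].
  rewrite /profile2 /idx2 /= exprMn mulrACA.
  rewrite (@le_trans _ _ (C * b j r * (C * b j r)))//.
    by rewrite ler_pM ?mulr_ge0 ?profile_ge0 ?(ltW (idxX_gt0 _ _))//; exact: hC.
  by rewrite -expr2 exprMn ler_wpM2l ?sqr_ge0 ?(frame_sqr fr).
have hge q : exists r (C : R), 0 < C /\ forall j,
    exists2 p, owner2 p = Some j & b j q <= C * (profile2 p * @idx2 R p ^+ r).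
  exists q, (2 ^+ q * 2 ^+ q); split=> [|j]; first by rewrite mulr_gt0// exprn_gt0.
  exists (pos b j q, pos b j q); first exact: owner2_eq (owner_pos _ _) (owner_pos _ _).
  have := frame_ge1 fr j q; rewrite -(@ler_pM2r _ (b j q)) ?mul1r; last exact: frame_pos fr _ _.
  move=> /le_trans; apply; rewrite le_eqVlt; apply/orP; left; apply/eqP.
  by rewrite [in LHS](profile_ge q j) /profile2 /idx2 /= exprMn; ring.
split.
- exact: (pattern_space_subspace m).
- exact: (pattern_space_closed fr m h0 hge).
- exact: (pattern_isomorphic fr m h0 hle hge).
Qed.

Lemma s_incl_linear : linear (@s_incl R).
Proof. by move=> c x y; apply: sdual_eqP. Qed.

Lemma s_incl_continuous : continuous (@s_incl R).
Proof.
move=> x U /nbhs_sdualP[M [e [bM e0 hU]]]; have [D hD] := bM 2%N.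
have D1 : 0 < `|D| + 1 by rewrite ltr_wpDl.
apply/(model_nbhs (@sspace_model R)); exists 0%N, (e / 2 / (`|D| + 1)).
split=> [|y hy]; first by rewrite !divr_gt0.
apply: hU => z Mz.
rewrite (le_trans (@pairing_le _ _ z 0 (e / 2 / (`|D| + 1)) (`|D| + 1) _ _ _))//.
- by rewrite !divr_ge0// ltW.
- by move=> n; rewrite expr0 mulr1; have := hy n; rewrite expr0 mulr1.
- by move=> n; rewrite (le_trans (hD z Mz n))// (le_trans (ler_norm _))// lerDl.
- by rewrite divfK ?gt_eqF// mulrC divfK.
Qed.

Section composition.
Context (S T : Lss R).

Definition comp_fun (xi : sdual R) : sspace R := S (s_incl (T xi)).

Lemma comp_linear : linear comp_fun.
Proof.
by move=> c x y; rewrite /comp_fun (@Lss_linear _ T) s_incl_linear (@Lss_linear _ S).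
Qed.

Lemma comp_continuous : continuous comp_fun.
Proof.
move=> xi; apply: (@continuous_comp _ _ _ T (fun x => S (s_incl x))).
  exact: Lss_continuous.
apply: (@continuous_comp _ _ _ (@s_incl R) S); first exact: s_incl_continuous.
exact: Lss_continuous.
Qed.

Definition Lss_comp : Lss R :=
  MkLss (mem_set (conj comp_linear comp_continuous) : comp_fun \in @Lss_pred R).

Lemma Lss_compE m n :
  ssum (fun l => entry S m l * entry T l n) (entry Lss_comp m n).
Proof. exact: (operator_ssum (@Lss_linear _ S) (@Lss_continuous _ S)). Qed.

End composition.

(** A nonzero product forces m, l and n into the support of the same f_j, where
    both sides are s_j t_j f_j(m) f_j(l)^2 f_j(n). *)
Lemma pattern2_comm s t m l n :
  pattern owner2 profile2 s (m, l) * pattern owner2 profile2 t (l, n) =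
  pattern owner2 profile2 t (m, l) * pattern owner2 profile2 s (l, n).
Proof.
rewrite /pattern; case E1 : (owner2 (m, l)) => [j|]; last by rewrite !mul0r.
case E2 : (owner2 (l, n)) => [j'|]; last by rewrite !mulr0.
have [_ l1] := owner2P E1; have [l2 _] := owner2P E2.
by move: l2; rewrite l1 => -[<-]; ring.
Qed.

Lemma diagonal_algebra_commutative : is_commutative diagonal_algebra.
Proof.
move=> S T [s hs] [t ht] xi.
suff : comp_fun S T = comp_fun T S by move/(congr1 (@^~ xi)).
apply: operator_eqP; try exact: comp_linear; try exact: comp_continuous.
move=> m n; apply: ssum_uniq (Lss_compE S T m n) _.
apply: eq_ssum (Lss_compE T S m n) => l.
rewrite -[entry T m l]/(Lss_co T (m, l)) -[entry S l n]/(Lss_co S (l, n)).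
rewrite -[entry S m l]/(Lss_co S (m, l)) -[entry T l n]/(Lss_co T (l, n)).
by rewrite !hs !ht pattern2_comm.
Qed.

(** The coefficients of the product are read off at the anchor a j = n(j, 0).
    At another entry of the same block, the series defining the entry of the
    product is termwise the multiple by f_j(m) f_j(n) / f_j(a j)^2 of the one at
    the anchor; across blocks all its terms vanish. *)
Lemma diagonal_algebra_comp S T : diagonal_algebra S -> diagonal_algebra T ->
  exists2 U, diagonal_algebra U & is_comp S T U.
Proof.
move=> [s hs] [t ht]; exists (Lss_comp S T) => //.
pose U := Lss_comp S T; pose a j := pos b j 0.
have oa j : owner (a j) = Some j by exact: owner_pos.
have pa j : (profile (a j))%:C != 0.
  by rewrite fmorph_eq0 gt_eqF// /a profile_pos (coef_gt0 fr).
exists (fun j => entry U (a j) (a j) / ((profile (a j))%:C * (profile (a j))%:C)).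
move=> [m n]; rewrite -[LHS]/(entry U m n) /pattern.
have term k l q : entry S k q * entry T q l =
    pattern owner2 profile2 s (k, q) * pattern owner2 profile2 t (q, l).
  by rewrite -hs -ht.
case E : (owner2 (m, n)) => [j|].
  have [om on] := owner2P E.
  pose c := (profile m)%:C * (profile n)%:C / ((profile (a j))%:C * (profile (a j))%:C).
  have := ssum_lin c (Lss_compE S T (a j) (a j)) (@ssum0 R (fun=> 0) (fun=> erefl)).
  rewrite addr0 => hc; apply: ssum_uniq (Lss_compE S T m n) _.
  have -> : entry U (a j) (a j) / ((profile (a j))%:C * (profile (a j))%:C) *
      (profile2 (m, n))%:C = c * entry U (a j) (a j).
    by rewrite /c /profile2 /= realcM; have := pa j => paj; field.
  apply: eq_ssum hc => q; rewrite addr0 !term /pattern.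
  have [oq|oq] := eqVneq (owner q) (Some j); last first.
    have on1 k : owner k = Some j -> owner2 (k, q) = None.
      by move=> ok; rewrite /owner2 /= ok eq_sym (negbTE oq).
    by rewrite !on1// !mul0r mulr0.
  rewrite !(owner2_eq _ oq)// !(owner2_eq oq)// /profile2 /= !realcM /c.
  by have := pa j => paj; field.
apply: ssum_uniq (Lss_compE S T m n) _; apply: ssum0 => q; rewrite term /pattern.
case E1 : (owner2 (m, q)) => [j|]; last by rewrite mul0r.
case E2 : (owner2 (q, n)) => [j'|]; last by rewrite mulr0.
have [h1 h2] := owner2P E1; have [h3 h4] := owner2P E2.
by move: E; rewrite (owner2_eq h1)// h4 -h2 h3.
Qed.

(** The scalar product is the limit of the square partial sums of the double
    series.  The decay of the entries of T beats the growth of xi and eta, which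
    gives the rate. *)
Lemma l2_dot_approx (T : Lss R) (xi eta : sdual R) :
  ssum (fun m => T xi m * ((eta m)^*)%C) (l2_dot (T xi) eta) /\
  exists C : R, forall K, normc (l2_dot (T xi) eta -
    \sum_(0 <= m < K) \sum_(0 <= n < K) entry T m n * xi n * ((eta m)^*)%C)
    <= C / K.+1%:R.
Proof.
have [r [D [D0 hD]]] := sdual_growth eta.
have [r' [D' [D'0 hD']]] := sdual_growth xi.
have hD2 m : normc ((eta m)^*)%C <= D * idx m ^+ r by rewrite normc_conj.
have [G hG] := sspace_rapid (T xi) r.+2.
have hT m : normc (T xi m * ((eta m)^*)%C) * m.+1%:R ^+ 2 <= D * G.
  by rewrite mulrC [T xi m * _]mulrC mulrC; exact: growth_mul D0 hD2 hG m.
have sT : ssum (fun m => T xi m * ((eta m)^*)%C) (l2_dot (T xi) eta).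
  exact: ssum_limn hT.
split=> //.
have ht := operator_rapid (@Lss_linear _ T) (@Lss_continuous _ T).
have [C [C0 hC]] := entries_two ht r.+2 r'.+2.
have tail m K : normc (T xi m - \sum_(0 <= n < K) entry T m n * xi n) * idx m ^+ r.+2
    <= 2 * (D' * C) / K.+1%:R.
  rewrite -ler_pdivlMr ?idxX_gt0// mulrAC -[_ * (D' * C) / _]mulrA.
  apply: (ssum_tail _ (operator_ssum (@Lss_linear _ T) (@Lss_continuous _ T) xi m)) => n.
  rewrite [entry T m n * _]mulrC.
  have hm k : normc (entry T m k) * idx k ^+ r'.+2 <= C / idx m ^+ r.+2.
    by rewrite ler_pdivlMr ?idxX_gt0// mulrAC.
  by rewrite -mulrA; exact: (growth_mul D'0 hD' hm n).
exists (2 * (D * G) + D * (2 * (D' * C)) * 2) => K.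
have C1 : 0 <= D * (2 * (D' * C)) by rewrite !mulr_ge0.
rewrite -(subrKA (\sum_(0 <= m < K) T xi m * ((eta m)^*)%C)) (le_trans (normcD _ _))//.
rewrite mulrDl lerD//; first exact: ssum_tail hT sT K.
rewrite -sumrB (le_trans (normc_sum _ _))//.
rewrite (@le_trans _ _ (\sum_(0 <= m < K) D * (2 * (D' * C)) / K.+1%:R * (m.+1%:R ^+ 2)^-1))//.
  apply: ler_sum => m _; rewrite -mulr_suml -mulrBl ComplexField.Normc.normcM.
  rewrite ler_pdivlMr ?exprn_gt0//.
  set X := normc (_ - _); have X0 : 0 <= X by exact: normc_ge0.
  rewrite (@le_trans _ _ (X * (D * idx m ^+ r) * idx m ^+ 2))//.
    by rewrite ler_wpM2r ?(ltW (idxX_gt0 _ _))// ler_wpM2l.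
  have -> : X * (D * idx m ^+ r) * idx m ^+ 2 = D * (X * idx m ^+ r.+2).
    by rewrite -(addn2 r) exprD; ring.
  by rewrite -mulrA ler_wpM2l// tail.
rewrite -mulr_sumr (le_trans (ler_wpM2l _ (sum_inv_sq 0 K))) ?divr_ge0//.
by rewrite divr1 mulrAC.
Qed.

(** Conjugation and exchange of finite sums identify the square partial sums of
    both sides, hence their limits. *)
Lemma adjoint_of_entries (T S : Lss R) :
  (forall m n, entry S n m = ((entry T m n)^*)%C) -> is_adjoint T S.
Proof.
move=> hST xi eta _ _.
have [_ [C hC]] := l2_dot_approx T xi eta.
have [sS [C' hC']] := l2_dot_approx S eta xi.
have -> : l2_dot xi (S eta) = ((l2_dot (S eta) xi)^*)%C.
  apply: ssum_lim; apply: eq_ssum (ssum_conj sS) => n.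
  by rewrite conjcM conjcK mulrC.
apply: (approx_uniq hC (C' := C')) => K; apply: le_trans (hC' K).
rewrite -[leRHS]normc_conj conjcB.
rewrite le_eqVlt; apply/orP; left; apply/eqP; congr (normc (_ - _)).
rewrite conjc_sum exchange_big; apply: eq_bigr => n _.
rewrite conjc_sum; apply: eq_bigr => m _.
by rewrite !conjcM hST !conjcK; ring.
Qed.

Lemma diagonal_algebra_adjoint T : diagonal_algebra T ->
  exists2 S, diagonal_algebra S & is_adjoint T S.
Proof.
move=> [t ht]; pose t' j := ((t j)^*)%C.
have conjE p : pattern owner2 profile2 t' p = ((Lss_co T p)^*)%C.
  rewrite ht /pattern; case: (owner2 p) => [j|]; last by rewrite rmorph0.
  by rewrite conjcM conjc_real.
have [q|S hS] := model_surj (@Lss_model R) (t := pattern owner2 profile2 t').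
  have [C hC] := model_rapid (@Lss_model R) T q; exists C => p.
  by rewrite conjE normc_conj.
exists S; first by exists t'.
apply: adjoint_of_entries => m n.
rewrite -[LHS]/(Lss_co S (n, m)) hS -[entry T m n]/(Lss_co T (m, n)) ht /pattern.
have -> : owner2 (n, m) = owner2 (m, n).
  by rewrite /owner2 /= eq_sym; case: eqP => // ->.
case: (owner2 (m, n)) => [j|]; last by rewrite rmorph0.
by rewrite conjcM conjc_real /profile2 /= [profile n * _]mulrC.
Qed.

Lemma diagonal_algebra_star : is_star_subalgebra diagonal_algebra.
Proof.
split; [by have [] := diagonal_algebra_isomorphic|exact: diagonal_algebra_comp|
  exact: diagonal_algebra_adjoint].
Qed.

End basis_pattern.

(** * From nuclearity and (DN) to the matrix *)

Section nuclear_DN_conditions.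
Context {R : realType} (A : koethe_matrix R).

(** By continuity the dominating norm nu is bounded by a multiple of some norm of
    index p; evaluate the inequality of (DN) on unit vectors. *)
Lemma property_DN_koethe : property_DN (lambda2_norm A) -> koethe_DN A.
Proof.
move=> [nu [[[nuD nuZ] nu0] nuc hDN]].
have nu00 : nu 0 = 0 by rewrite -(scale0r 0) nuZ ComplexField.Normc.normc0 mul0r.
have : nbhs (nu 0) (ball (nu 0) (1 : R)) by exact: nbhsx_ballx.
move=> /nuc /nbhs_lambda2P[p [e [e0 h]]]; exists p => q.
have nule x : nu x <= e^-1 * lambda2_norm A p x.
  apply/ler_addgt0Pr => d d0; set P := lambda2_norm A p x.
  have P0 : 0 <= P by exact: lambda2_norm_ge0.
  have t0 : 0 < P + d * e by rewrite ltr_wpDl// mulr_gt0.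
  have := h ((e / (P + d * e))%:C *: x); rewrite subr0 lambda2_normZ normcR.
  rewrite gtr0_norm ?divr_gt0// -/P.
  have -> : e / (P + d * e) * P < e.
    by rewrite -mulrA gtr_pMr// mulrC ltr_pdivrMr// mul1r ltrDl mulr_gt0.
  move=> /(_ isT); rewrite /ball/= nu00 sub0r normrN nuZ normcR (gtr0_norm (divr_gt0 e0 t0)) => H.
  have := ltW (le_lt_trans (ler_norm _) H); rewrite -ler_pdivlMl ?divr_gt0//.
  rewrite mulr1 invf_div => /le_trans; apply.
  by rewrite mulrDl mulfK ?gt_eqF// mulrC.
have [r [C [C0 hC]]] := hDN q; exists r, (C * e^-1); split.
  by rewrite mulr_gt0// invr_gt0.
move=> j; have := hC (lambda2_delta A j); rewrite !lambda2_norm_delta => /le_trans; apply.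
rewrite ler_wpM2r ?koethe_ge0// -mulrA ler_wpM2l ?(ltW C0)//.
by have := nule (lambda2_delta A j); rewrite lambda2_norm_delta.
Qed.

Lemma dense_approx (V : lmodType R[i]) (F : normedModType R[i]) (iota : V -> F) (y : F) (e : R) :
  dense (range iota) -> 0 < e -> exists x, `|y - iota x| <= e%:C.
Proof.
move=> di e0; have e0' : 0 < e%:C by rewrite ltcR.
have [z [yx [x _ xE]]] := di (interior (ball y e%:C)) (ex_intro _ y (nbhsx_ballx y e%:C e0'))
  (@open_interior _ _).
exists x; rewrite xE; have := interior_subset yx.
by rewrite -ball_normE /= => /ltW.
Qed.

(** The trace argument.  Let ehat j be e_j normalised in the norm r.  The
    canonical map sends it to e_j / a_jr, whose j-th coordinate in the norm q is
    a_jq / a_jr; by the nuclear representation this is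
    sum_k lam_k phi_k(ehat j) times the j-th coordinate of y_k.  Summing over j,
    Bessel's inequality for phi_k and the norm of y_k bound the contribution of
    each k by a multiple of |lam_k|.  As the y_k live in an abstract completion,
    they are first approximated by images of vectors x_k. *)
Lemma nuclear_koethe : nuclear (lambda2_norm A) -> koethe_summable A.
Proof.
move=> hnuc q; have [r qr [Er [Eq [ir [iq [T [[irl irn _] [iql iqn iqd] hT hTi]]]]]]] := hnuc q.
have [lam [phi [y [lamS phil yb hser]]]] := hT.
pose L := fine (\sum_(0 <= k <oo) (normc (lam k))%:E)%E.
have lam0 k : (0 <= (normc (lam k))%:E)%E by rewrite lee_fin normc_ge0.
have hL K : \sum_(0 <= k < K) normc (lam k) <= L.
  rewrite -lee_fin fineK ?ge0_fin_numE ?nneseries_ge0// -sumEFin.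
  exact: nneseries_lim_ge.
have L0 : 0 <= L by have := hL 0%N; rewrite big_geq.
pose ehat j : lambda2 A := ((A j r)^-1)%:C *: lambda2_delta A j.
have phin k x : normc (phi k (ir x)) <= lambda2_norm A r x.
  by have [_ /(_ (ir x))] := phil k; rewrite irn norm_normc lecR.
have ehatn j : lambda2_norm A r (ehat j) <= 1.
  rewrite lambda2_normZ lambda2_norm_delta normcR ger0_norm ?invr_ge0 ?koethe_ge0//.
  by have [->|a0] := eqVneq (A j r) 0; [rewrite mulr0|rewrite mulVf].
(* Bessel's inequality, by testing phi k on the combination of the ehat j whose
   coefficients are the conjugates of its values: S <= sqrt S. *)
have bessel k N : \sum_(0 <= j < N) normc (phi k (ir (ehat j))) ^+ 2 <= 1.
  set S := \sum_(_ <= _ < _) _.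
  have S0 : 0 <= S by apply: sumr_ge0 => j _; exact: sqr_ge0.
  have [pl _] := phil k.
  pose z j := ((phi k (ir (ehat j)))^*)%C * ((A j r)^-1)%:C.
  have phiE M : phi k (ir (lambda2_trunc A z M)) =
      \sum_(0 <= j < M) (normc (phi k (ir (ehat j))) ^+ 2)%:C.
    rewrite lambda2_truncE; elim: M => [|M ih].
      by rewrite !big_geq// (lin0 irl) (lin0 pl).
    rewrite !big_nat_recr//= (linD irl) (linD pl) ih; congr (_ + _).
    by rewrite /z -scalerA (linZ irl) (linZ pl) -/(ehat M) -mulc_conj mulrC.
  have := phin k (lambda2_trunc A z N).
  have -> : phi k (ir (lambda2_trunc A z N)) = S%:C by rewrite phiE -rmorph_sum.
  rewrite normcR ger0_norm// => hS.
  have : S <= Num.sqrt S.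
    apply: (le_trans hS).
    rewrite -(@ler_pXn2r _ 2)// ?nnegrE ?sqrtr_ge0 ?lambda2_norm_ge0//.
    rewrite (sqr_sqrtr S0) lambda2_norm_trunc ler_sum// => j _.
    rewrite /z ComplexField.Normc.normcM normcR normc_conj -exprMn -mulrA.
    rewrite ger0_norm ?invr_ge0 ?koethe_ge0//.
    have [->|a0] := eqVneq (A j r) 0; first by rewrite !mulr0 expr0n sqr_ge0.
    by rewrite mulVf// mulr1.
  move=> /(@lerXn2r _ 2); rewrite !nnegrE S0 sqrtr_ge0 (sqr_sqrtr S0).
  move=> /(_ isT isT) SS; rewrite leNgt; apply/negP => S1.
  by move: SS S1; nra.
exists r; apply: (@koethe_quot_bound _ _ _ (1 + L + L * (5 / 2))) => [j|j aq|N].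
- exact: koethe_ge0.
- by rewrite (lt_le_trans _ (koethe_homo A j qr))// lt_def aq koethe_ge0.
(* The error e occurs once for each of the N indices j, so it is chosen with
   N e <= 1. *)
pose e : R := N.+1%:R^-1; have e0 : 0 < e by rewrite invr_gt0.
have e1 : e <= 1 by rewrite invf_le1// ler1n.
have [K hK] : exists K, forall j, (j < N)%N ->
    `|\sum_(0 <= k < K) (lam k * phi k (ir (ehat j))) *: y k - iq (ehat j)| <= e%:C.
  have e0' : 0 < e%:C by rewrite ltcR.
  have : \forall K \near \oo, forall j, (j < N)%N ->
    `|\sum_(0 <= k < K) (lam k * phi k (ir (ehat j))) *: y k - iq (ehat j)| <= e%:C.
    elim: (N) => [|M ih]; first by apply: nearW => K j.
    have /cvgrPdist_le/(_ _ e0') := hser (ir (ehat M)); rewrite hTi => hM.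
    apply: filterS2 ih hM => K hj hM j; rewrite ltnS leq_eqVlt => /orP[/eqP ->|/hj//].
    by rewrite distrC.
  by move=> [K _ hK]; exists K; exact: hK (leqnn K).
have exx k : exists x, `|y k - iq x| <= e%:C by exact: dense_approx.
have [x hx] := boolp.choice exx.
have xn k : lambda2_norm A q (x k) <= 2.
  rewrite -lecR -iqn -[iq (x k)](subKr (y k)) (le_trans (ler_normB _ _))//.
  rewrite (_ : 2%:C = 1%:C + 1%:C) ?lerD//; last by rewrite -rmorphD.
  by rewrite (le_trans (hx k))// lecR.
pose c j k := lam k * phi k (ir (ehat j)).
have main j : (j < N)%N -> A j q / A j r <= e * (1 + L) +
    \sum_(0 <= k < K) normc (lam k) * (normc (phi k (ir (ehat j))) * (normc (x k j) * A j q)).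
  move=> jN; pose v := ehat j - \sum_(0 <= k < K) c j k *: x k.
  have vn : lambda2_norm A q v <= e * (1 + L).
    rewrite -lecR -iqn /v.
    have -> : iq (ehat j - \sum_(0 <= k < K) c j k *: x k) =
      \sum_(0 <= k < K) c j k *: (y k - iq (x k)) -
      (\sum_(0 <= k < K) c j k *: y k - iq (ehat j)).
      have -> : \sum_(0 <= k < K) c j k *: (y k - iq (x k)) =
          \sum_(0 <= k < K) c j k *: y k - \sum_(0 <= k < K) c j k *: iq (x k).
        by rewrite -sumrB; apply: eq_bigr => k _; rewrite scalerBr.
      by rewrite (linB iql) (linsum iql) opprB [RHS]addrC [RHS]addrA subrK.
    rewrite (le_trans (ler_normB _ _))// (_ : (e * (1 + L))%:C = (e * L)%:C + e%:C); last first.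
      by rewrite -rmorphD /=; congr (_%:C); ring.
    rewrite lerD//; last exact: hK.
    rewrite (le_trans (ler_norm_sum _ _ _))//.
    rewrite (@le_trans _ _ (\sum_(0 <= k < K) (e * normc (lam k))%:C))//; last first.
      by rewrite -rmorph_sum lecR -mulr_sumr ler_wpM2l// ltW.
    apply: ler_sum => k _; rewrite normrZ norm_normc (_ : (e * _)%:C = (normc (lam k))%:C * e%:C).
      rewrite ler_pM ?hx// lecR ?normc_ge0//.
      rewrite ComplexField.Normc.normcM ler_piMr ?normc_ge0//.
      exact: le_trans (phin _ _) (ehatn _).
    by rewrite -rmorphM /= mulrC.
  have vj : v j = ((A j r)^-1)%:C - \sum_(0 <= k < K) c j k * x k j.
    have ejj : ehat j j = ((A j r)^-1)%:C.
      by rewrite -[LHS]/(((A j r)^-1)%:C * lambda2_delta A j j) lambda2_deltaE eqxx mulr1.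
    rewrite /v lambda2B ejj.
    congr (_ - _); elim: (K) => [|K' ih]; first by rewrite !big_geq.
    by rewrite [in LHS]big_nat_recr// [in RHS]big_nat_recr//= -ih.
  have := le_trans (lambda2_coord q v j) vn => hv.
  have -> : A j q / A j r = normc (v j + \sum_(0 <= k < K) c j k * x k j) * A j q.
    by rewrite vj subrK normcR ger0_norm ?invr_ge0 ?koethe_ge0// mulrC.
  rewrite (le_trans (ler_wpM2r (koethe_ge0 A j q) (normcD _ _)))// mulrDl lerD//.
  rewrite (le_trans (ler_wpM2r (koethe_ge0 A j q) (normc_sum _ _)))// mulr_suml.
  by apply: ler_sum => k _; rewrite !ComplexField.Normc.normcM !mulrA.
rewrite (le_trans (ler_sum_nat (fun j => fun h => main j (andP h).2)))//.
rewrite big_split /= lerD//.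
  rewrite sumr_const_nat subn0 -mulr_natr mulrAC ler_piMl ?addr_ge0//.
  by rewrite /e mulrC ler_pdivrMr// mul1r ler_nat.
rewrite exchange_big /=.
rewrite (@le_trans _ _ (\sum_(0 <= k < K) normc (lam k) * (5 / 2)))//; last first.
  by rewrite -mulr_suml ler_wpM2r// divr_ge0.
apply: ler_sum => k _; rewrite -mulr_sumr ler_wpM2l ?normc_ge0//.
have hX : \sum_(0 <= j < N) (normc (x k j) * A j q) ^+ 2 <= 4.
  rewrite (eq_bigr (fun j => normc (x k j) ^+ 2 * A j q ^+ 2)); last by move=> j _; rewrite exprMn.
  rewrite (le_trans (psum_le_wnorm N (lambda2_fin q (x k))))//.
  by have := xn k; have := lambda2_norm_ge0 q (x k); rewrite /lambda2_norm; nra.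
apply: (@le_trans _ _ ((1 + 4) / 2)); last by lra.
rewrite ler_pdivlMr// (le_trans _ (lerD (bessel k N) hX))// -big_split /= mulr_suml.
apply: ler_sum => j _; set a := normc _; set t := _ * A j q.
by have := sqr_ge0 (a - t); nra.
Qed.

End nuclear_DN_conditions.

(** * Local Banach spaces *)

Section local_banach_space.
Context {R : realType} (w : nat -> R).

Local Notation one := (fun=> 1 : R).

(** The completion of the quotient by the kernel of the seminorm with weight w is
    l^2 over the indices of nonzero weight, the class of x being (x_j w_j)_j. *)
Definition l2supp_pred : {pred nat -> R[i]} :=
  mem [set xi | (wsum one xi < +oo)%E /\ forall j, w j = 0 -> xi j = 0].

Record l2supp : Type := L2supp {
  l2supp_val :> nat -> R[i];
  l2supp_valP : l2supp_val \in l2supp_pred }.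

HB.instance Definition _ := [isSub for l2supp_val].
HB.instance Definition _ := [Choice of l2supp by <:].

Let l2supp_submod_closed : submod_closed l2supp_pred.
Proof.
split=> [|c x y]; rewrite !inE; first by split=> //; rewrite wsum0 ltry.
move=> [hx x0] [hy y0]; split=> [|j wj]; first by rewrite wsumD_lty// wsumZ_lty.
by rewrite -[LHS]/(c * x j + y j) x0// y0// mulr0 addr0.
Qed.
HB.instance Definition _ := GRing.isSubmodClosed.Build _ _ l2supp_pred
  l2supp_submod_closed.
HB.instance Definition _ := [SubChoice_isSubLmodule of l2supp by <:].

Lemma l2supp_fin (x : l2supp) : (wsum one x < +oo)%E.
Proof. by have := l2supp_valP x; rewrite inE => -[]. Qed.

Lemma l2supp_eq0 (x : l2supp) j : w j = 0 -> x j = 0.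
Proof. by have := l2supp_valP x; rewrite inE => -[_]; apply. Qed.

Lemma l2supp_eqP (x y : l2supp) : (forall j, x j = y j) -> x = y.
Proof. by move=> h; apply: val_inj; apply/funext => j; exact: h. Qed.

Lemma l2supp_coord (x : l2supp) j : normc (x j) <= wnorm one x.
Proof. by have := @wnorm_coord R one x j (l2supp_fin x) ler01; rewrite mulr1. Qed.

Let norm (x : l2supp) : R[i] := (wnorm one x)%:C.

Let normD x y : norm (x + y) <= norm x + norm y.
Proof. by rewrite /norm -rmorphD lecR; apply: wnormD; exact: l2supp_fin. Qed.

Let normZ (c : R[i]) x : norm (c *: x) = `|c| * norm x.
Proof.
by rewrite /norm norm_normc -rmorphM; congr (_%:C); apply: wnormZ; exact: l2supp_fin.
Qed.

Let norm_eq0 x : norm x = 0 -> x = 0.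
Proof.
move=> /(congr1 (@complex.Re R))/= h; apply: l2supp_eqP => j.
apply: ComplexField.Normc.eq0_normc; apply/eqP; rewrite eq_le normc_ge0 andbT.
by have := l2supp_coord x j; rewrite h.
Qed.

HB.instance Definition _ := Lmodule_isNormed.Build R[i] l2supp normD normZ norm_eq0.

Lemma l2supp_normE (x : l2supp) : `|x| = (wnorm one x)%:C.
Proof. by []. Qed.

Let l2supp_complete (F : set_system l2supp) : ProperFilter F -> cauchy F -> cvg F.
Proof.
move=> FF /cauchy_ballP Fc.
have hC (e : R) : 0 < e -> exists2 B, F B & forall x y : l2supp, B x -> B y ->
    wnorm one (x - y) <= e.
  move=> e0; have e0' : 0 < e%:C by rewrite ltcR.
  have [[B1 B2] /= [FB1 FB2] hB] := Fc _ e0'.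
  exists (B1 `&` B2); first exact: filterI.
  move=> x y [x1 _] [_ y2]; have := hB (x, y) (conj x1 y2).
  by rewrite /= -ball_normE /= l2supp_normE ltcR => /ltW.
have coord j : exists l : R[i], forall e : R, 0 < e ->
    \forall x \near F, normc (l2supp_val x j - l) <= e.
  apply: cauchy_complex => e e0; have [B FB hB] := hC e e0; exists B => // x y Bx By.
  apply: le_trans (hB x y Bx By).
  exact: (l2supp_coord (x - y) j).
have [l hl] := boolp.choice coord.
have lim (e : R) : 0 < e -> exists2 B, F B & forall x : l2supp, B x ->
    (wsum one (l2supp_val x - l)%R < +oo)%E /\ wnorm one (l2supp_val x - l) <= e.
  move=> e0; have [B FB hB] := hC e e0; exists B => //.
  apply: (@wsum_cvg R _ F FF (@l2supp_val) l one B e) => //.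
  by move=> x y Bx By; split; [exact: l2supp_fin (x - y)|exact: hB].
have lP : l \in l2supp_pred.
  rewrite inE; split=> [|j wj].
    have [B FB hB] := lim 1 ltr01; have [x Bx] := filter_ex FB.
    have [hx _] := hB x Bx; rewrite (_ : l = l2supp_val x + (-1) *: (l2supp_val x - l)).
      by apply: wsumD_lty; [exact: (l2supp_fin x)|exact: wsumZ_lty hx].
    by rewrite scaleN1r opprB addrC subrK.
  apply: ComplexField.Normc.eq0_normc; apply/eqP; rewrite eq_le normc_ge0 andbT.
  apply/ler_addgt0Pr => e e0; have /filter_ex[x] := hl j e e0.
  by rewrite l2supp_eq0// sub0r normcN add0r.
apply/cvg_ex; exists (L2supp lP); apply/cvgrPdist_le => -[e e'].
rewrite ltcE /= => /andP[/eqP -> e0]; have [B FB hB] := lim e e0.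
apply: filterS FB => x /hB[_ hx]; rewrite distrC l2supp_normE lecR.
exact: hx.
Qed.

HB.instance Definition _ := Uniform_isComplete.Build l2supp l2supp_complete.

Definition local_banach_type : completeNormedModType R[i] := l2supp.

Let trunc_in (y : nat -> R[i]) N : (forall j, w j = 0 -> y j = 0) ->
  (fun j => if (j < N)%N then y j else 0) \in l2supp_pred.
Proof.
move=> y0; rewrite inE; split=> [|j wj]; last by case: ifP => // _; exact: y0.
by rewrite (@wsum_finite _ _ _ N) ?ltry// => j; rewrite leqNgt => /negbTE ->.
Qed.

Definition l2supp_trunc (y : l2supp) N : l2supp :=
  L2supp (trunc_in N (@l2supp_eq0 y)).

(** The square norm of a tail is the square norm of y minus a partial sum; if it
    stayed above e^2, all partial sums would be at most |y|^2 - e^2. *)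
Lemma l2supp_trunc_cvg (y : l2supp) : l2supp_trunc y N @[N --> \oo] --> y.
Proof.
apply/cvgrPdist_le => -[e e']; rewrite ltcE /= => /andP[/eqP -> e0].
have fy := l2supp_fin y; pose S N := \sum_(0 <= j < N) normc (y j) ^+ 2 * one j ^+ 2.
have Smono N M : (N <= M)%N -> S N <= S M.
  move=> NM; rewrite /S [leRHS](big_cat_nat (n := N))//= lerDl.
  by apply: sumr_ge0 => j _; rewrite mulr_ge0 ?sqr_ge0.
have [N0 hN0] : exists N0, wnorm one y ^+ 2 - S N0 <= e ^+ 2.
  apply: contrapT => /forallNP nex.
  have lt N : S N <= wnorm one y ^+ 2 - e ^+ 2.
    by have /negP := nex N; rewrite -ltNge => /ltW; rewrite lerBrDr addrC -lerBrDr.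
  have d0 : 0 <= wnorm one y ^+ 2 - e ^+ 2 by have := lt 0%N; rewrite /S big_geq.
  have [|_] := @wsum_bound _ one y (Num.sqrt (wnorm one y ^+ 2 - e ^+ 2)) (sqrtr_ge0 _).
    by move=> N; rewrite (sqr_sqrtr d0); exact: lt.
  move=> /(@lerXn2r _ 2); rewrite !nnegrE wnorm_ge0 sqrtr_ge0 (sqr_sqrtr d0).
  by move=> /(_ isT isT); rewrite leNgt gtrBl exprn_gt0.
exists N0 => // N /= NN; rewrite l2supp_normE lecR.
have [|//] := @wsum_bound _ one (y - l2supp_trunc y N) e (ltW e0) => M.
apply: le_trans hN0.
have -> : \sum_(0 <= j < M) normc ((l2supp_val (y - l2supp_trunc y N)) j) ^+ 2 * one j ^+ 2 =
    \sum_(0 <= j < M | (N <= j)%N) normc (y j) ^+ 2 * one j ^+ 2.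
  rewrite [RHS]big_mkcond; apply: eq_bigr => j _.
  rewrite -[X in normc X]/(y j - (if (j < N)%N then y j else 0)).
  case: ltnP => _; last by rewrite subr0.
  by rewrite subrr ComplexField.Normc.normc0 expr0n mul0r.
rewrite lerBrDr (le_trans _ (psum_le_wnorm (maxn M N) fy))//.
rewrite -/(S (maxn M N)) /S [leRHS](bigID (fun j => (N <= j)%N))/= lerD//.
  rewrite [leRHS](big_cat_nat (n := M)) ?leq_maxl//= lerDl.
  by apply: sumr_ge0 => j _; rewrite mulr_ge0 ?sqr_ge0.
rewrite (le_trans (Smono _ _ NN))// /S [leRHS](big_cat_nat (n := N)) ?leq_maxr//=.
rewrite ler_wpDr//.
  by apply: sumr_ge0 => j _; rewrite mulr_ge0 ?sqr_ge0.
rewrite [leRHS]big_nat_cond [leLHS]big_nat_cond.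
rewrite le_eqVlt; apply/orP; left; apply/eqP; apply: eq_bigl => j.
by rewrite andbT /= -ltnNge; case: (j < N)%N.
Qed.

End local_banach_space.

(** * Completeness, nuclearity and (DN) of lambda^2(A) *)

Lemma min_subadd (R : realDomainType) (a b c t : R) : 0 <= a -> 0 <= b -> 0 <= c ->
  t <= a + b -> Num.min t c <= Num.min a c + Num.min b c.
Proof.
move=> a0 b0 c0 tab; rewrite ge_min; have [ac|/ltW ca] := leP a c; last first.
  by rewrite lerDl le_min b0 c0 orbT.
have [bc|/ltW cb] := leP b c; last by rewrite lerDr a0 orbT.
by rewrite tab.
Qed.

Lemma min_lt_cancel (R : realDomainType) (a e i : R) :
  Num.min a i < Num.min e i -> a < e.
Proof.
rewrite lt_min !gt_min ltxx orbF => /andP[/orP[//|ie] ai]; exact: lt_trans ai ie.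
Qed.

Section frechet_nuclear.
Context {R : realType} (A : koethe_matrix R).

Section local.
Context (q : nat).
Local Notation B := (local_banach_type (A ^~ q)).

Let class_in (x : lambda2 A) : (fun j => x j * (A j q)%:C) \in l2supp_pred (A ^~ q).
Proof.
rewrite inE; split=> [|j ->]; last by rewrite mulr0.
have := lambda2_fin q x; rewrite (_ : wsum _ _ = wsum (A ^~ q) x)//.
apply: eq_eseriesr => j _; rewrite ComplexField.Normc.normcM normcR.
by rewrite ger0_norm ?koethe_ge0// expr1n mulr1 exprMn.
Qed.

Definition local_class (x : lambda2 A) : B := L2supp (class_in x).

Lemma local_class_banach : local_banach (lambda2_norm A q) local_class.
Proof.
split.
- move=> c x y; apply: l2supp_eqP => j.
  by rewrite -[LHS]/((c * x j + y j) * _) mulrDl -mulrA.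
- move=> x; rewrite l2supp_normE /lambda2_norm /wnorm; congr ((Num.sqrt (fine _))%:C).
  apply: eq_eseriesr => j _; rewrite ComplexField.Normc.normcM normcR.
  by rewrite ger0_norm ?koethe_ge0// expr1n mulr1 exprMn.
- move=> O [y Oy] oO.
  have /(l2supp_trunc_cvg (y := y)) [N _ hN] : nbhs (y : B) O by exact: open_nbhs_nbhs.
  pose x := lambda2_trunc A (fun j => y j / (A j q)%:C) N.
  exists (local_class x); split; last by exists x.
  suff -> : local_class x = l2supp_trunc y N :> l2supp (A ^~ q) by exact: hN N (leqnn N).
  apply: l2supp_eqP => j /=; case: ifP => _; last by rewrite mul0r.
  have [a0|a0] := eqVneq (A j q) 0; first by rewrite (l2supp_eq0 y a0) !mul0r.
  by rewrite divfK// fmorph_eq0.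
Qed.

End local.

(** Between the local Banach spaces the canonical map is the diagonal operator
    with entries a_jq / a_jr, which are summable for suitable r.  Its nuclear
    representation uses the coordinate functionals and the unit vectors; y k is
    replaced by 0 when a_kq = 0, as then the unit vector is not in the space. *)
Lemma koethe_nuclear p : (forall j, 0 < A j p) -> koethe_summable A ->
  nuclear (lambda2_norm A).
Proof.
move=> Ap hs q; have [r pr [K hK]] := koethe_summable_bound (maxn p q) q hs.
have qr : (q <= r)%N by rewrite (leq_trans _ pr)// leq_maxr.
have Ar j : 0 < A j r.
  by rewrite (lt_le_trans (Ap j))// koethe_homo// (leq_trans _ pr)// leq_maxl.
exists r => //.
pose a j := A j q / A j r.
have a01 j : 0 <= a j <= 1.
  by rewrite divr_ge0 ?koethe_ge0//= ler_pdivrMr// mul1r koethe_homo.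
have Tin (x : local_banach_type (A ^~ r)) : (fun j => x j * (a j)%:C) \in l2supp_pred (A ^~ q).
  rewrite inE; split=> [|j aj]; last by rewrite /a aj mul0r mulr0.
  apply: le_lt_trans (l2supp_fin x); apply: lee_nneseries => [j _ _|j _].
    by rewrite lee_fin mulr_ge0 ?sqr_ge0.
  rewrite lee_fin expr1n !mulr1 ler_pXn2r ?nnegrE ?normc_ge0//.
  have /andP[h0 h1] := a01 j.
  by rewrite ComplexField.Normc.normcM normcR ger0_norm// ler_piMr ?normc_ge0.
pose T (x : local_banach_type (A ^~ r)) : local_banach_type (A ^~ q) := L2supp (Tin x).
exists (local_banach_type (A ^~ r)), (local_banach_type (A ^~ q)).
exists (local_class r), (local_class q), T.
split; [exact: local_class_banach|exact: local_class_banach| |]; last first.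
  move=> x; apply: l2supp_eqP => j; rewrite /= -mulrA -rmorphM /=.
  by rewrite /a [A j r * _]mulrC divfK ?gt_eqF.
pose y k : nat -> R[i] := fun j => if j == k then (A k q != 0)%:R else 0.
have yin k : y k \in l2supp_pred (A ^~ q).
  rewrite inE /y; split=> [|j aj]; last by case: eqVneq => // <-; rewrite aj eqxx.
  by rewrite (@wsum_finite _ _ _ k.+1) ?ltry// => j; case: ltngtP.
exists (fun k => (a k)%:C), (fun k (x : local_banach_type (A ^~ r)) => x k),
  (fun k => L2supp (yin k) : local_banach_type (A ^~ q)); split.
- apply: (@le_lt_trans _ _ K%:E); last exact: ltry.
  apply: lime_le; first by apply: is_cvg_nneseries => j _ _; rewrite lee_fin normc_ge0.
  apply: nearW => N; rewrite sumEFin lee_fin; apply: le_trans (hK N).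
  by apply: ler_sum => j _; rewrite normcR ger0_norm//; case/andP: (a01 j).
- move=> k; split=> // x; rewrite l2supp_normE norm_normc lecR.
  exact: l2supp_coord.
- move=> k; suff : (wnorm (fun=> 1 : R) (y k))%:C <= (1%:C : R[i]) by []; rewrite lecR.
  have [|//] := @wsum_bound _ (fun=> 1) (y k) 1 ler01 => N.
  have term j : normc (y k j) ^+ 2 * 1 ^+ 2 <= (j == k)%:R.
    rewrite /y expr1n mulr1; case: eqVneq => _; last by rewrite ComplexField.Normc.normc0 expr0n.
    case: (A k q != 0); first by rewrite ComplexField.Normc.normc1 expr1n.
    by rewrite ComplexField.Normc.normc0 expr0n.
  rewrite [leRHS]expr1n (le_trans (ler_sum _ (fun j _ => term j)))//.
  have [kN|Nk] := ltnP k N.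
    rewrite (bigD1_seq k) ?iota_uniq ?mem_index_iota//= eqxx big1 ?addr0// => j.
    by move=> /negbTE ->.
  rewrite big_nat_cond big1// => j; rewrite andbT => /andP[_ jN].
  by rewrite ltn_eqF// (leq_trans jN).
- move=> x; have := @l2supp_trunc_cvg R (A ^~ q) (T x).
  apply: cvg_trans; apply: near_eq_cvg; apply: nearW => N.
  apply: l2supp_eqP => j; symmetry; rewrite /series /=.
  elim: N => [|N ih]; first by rewrite big_geq.
  transitivity ((if (j < N)%N then x j * (a j)%:C else 0) + (a N)%:C * x N * y N j).
    by rewrite -ih big_nat_recr.
  rewrite /y [in RHS]ltnS [in RHS]leq_eqVlt.
  case: (eqVneq j N) => [->|_] /=; last by rewrite mulr0 addr0.
  rewrite ltnn add0r; have [a0|a0] := eqVneq (A N q) 0.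
    by rewrite /a a0 mul0r !mulr0.
  by rewrite mulr1 mulrC.
Qed.

(** The norm of index p is dominating: by a_jq^2 <= C a_jp a_jr, the square of
    the q-th norm is at most C times the sum of the products
    (|x_j| a_jp) (|x_j| a_jr), to which the Cauchy-Schwarz inequality applies. *)
Lemma koethe_property_DN : koethe_DN A -> property_DN (lambda2_norm A).
Proof.
move=> [p hp]; have Ap := koethe_DN_gt0 hp.
exists (lambda2_norm A p); split.
- split; first by have [/(_ p)] := lambda2_graded A.
  move=> x hx; apply: lambda2_eqP => j.
  apply: ComplexField.Normc.eq0_normc; apply/eqP; rewrite eq_le normc_ge0 andbT.
  by have := lambda2_coord p x j; rewrite hx pmulr_lle0.
- move=> x U /nbhs_ballP[e /= e0 hU]; apply/nbhs_lambda2P; exists p, e; split=> // y hy.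
  have D z t : lambda2_norm A p (z + t) <= lambda2_norm A p z + lambda2_norm A p t.
    exact: (gradedD (lambda2_graded A)).
  have hxy : lambda2_norm A p (x - y) < e.
    by rewrite -opprB (gradedN (lambda2_graded A)).
  apply: hU; rewrite /ball /= ltr_norml; apply/andP; split.
    by have := D (y - x) x; rewrite subrK; lra.
  by have := D (x - y) y; rewrite subrK; lra.
- move=> q; have [r0 [C [C0 hC0]]] := hp q; pose r := maxn p r0.
  have hC j : A j q ^+ 2 <= C * A j p * A j r.
    apply: (le_trans (hC0 j)); rewrite ler_wpM2l ?koethe_homo ?leq_maxr//.
    by rewrite mulr_ge0 ?koethe_ge0// ltW.
  exists r, C; split=> // x.
  set P := lambda2_norm A p x; set Q := lambda2_norm A r x.
  have P0 : 0 <= P by exact: lambda2_norm_ge0.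
  have PQ : P <= Q by apply: lambda2_norm_le; exact: leq_maxl.
  have Q0 : 0 <= Q by exact: le_trans PQ.
  have CPQ : 0 <= C * P * Q by rewrite !mulr_ge0// ltW.
  have [|_ hle] := @wsum_bound _ (A ^~ q) x (Num.sqrt (C * P * Q)) (sqrtr_ge0 _).
    move=> N; rewrite (sqr_sqrtr CPQ).
    pose a j := normc (x j) * A j p; pose c j := normc (x j) * A j r.
    have Sa : \sum_(0 <= j < N) a j ^+ 2 <= P ^+ 2.
      rewrite (le_trans _ (psum_le_wnorm N (lambda2_fin p x)))//.
      by apply: ler_sum => j _; rewrite /a exprMn.
    have Sc : \sum_(0 <= j < N) c j ^+ 2 <= Q ^+ 2.
      rewrite (le_trans _ (psum_le_wnorm N (lambda2_fin r x)))//.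
      by apply: ler_sum => j _; rewrite /c exprMn.
    rewrite (@le_trans _ _ (\sum_(0 <= j < N) C * (a j * c j)))//.
      apply: ler_sum => j _; rewrite /a /c.
      rewrite (@le_trans _ _ (normc (x j) ^+ 2 * (C * A j p * A j r)))//.
        by rewrite ler_wpM2l ?sqr_ge0.
      by rewrite le_eqVlt; apply/orP; left; apply/eqP; ring.
    rewrite -mulr_sumr -mulrA ler_pM2l//.
    have [P00|P00] := eqVneq P 0.
      rewrite P00 mul0r big1// => j _; rewrite /a.
      have : normc (x j) * A j p <= 0 by rewrite -P00; exact: lambda2_coord.
      rewrite pmulr_lle0// => h; have -> : normc (x j) = 0.
        by apply/eqP; rewrite eq_le h normc_ge0.
      by rewrite !mul0r.
    have P1 : 0 < P by rewrite lt_def P00.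
    have Q1 : 0 < Q by exact: lt_le_trans PQ.
    (* Cauchy-Schwarz: sum the inequalities 0 <= (Q a_j - P c_j)^2. *)
    rewrite -(@ler_pM2l _ (2 * P * Q)) ?mulr_gt0// mulr_sumr.
    rewrite (@le_trans _ _ (\sum_(0 <= j < N) (Q ^+ 2 * a j ^+ 2 + P ^+ 2 * c j ^+ 2)))//.
      apply: ler_sum => j _; rewrite -subr_ge0.
      rewrite (_ : _ - _ = (Q * a j - P * c j) ^+ 2) ?sqr_ge0//; ring.
    rewrite big_split /= -!mulr_sumr.
    rewrite (le_trans (lerD (ler_wpM2l (sqr_ge0 _) Sa) (ler_wpM2l (sqr_ge0 _) Sc)))//.
    by rewrite le_eqVlt; apply/orP; left; apply/eqP; ring.
  by rewrite -(sqr_sqrtr CPQ) ler_pXn2r ?nnegrE ?sqrtr_ge0 ?lambda2_norm_ge0.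
Qed.

(** A Cauchy filter converges coordinatewise, each coordinate having a positive
    weight at some level; the limit is then a limit in every norm. *)
Lemma lambda2_complete : complete_space (lambda2 A).
Proof.
move=> F FF Fc.
have hC q (e : R) : 0 < e -> exists2 B, F B & forall x y : lambda2 A, B x -> B y ->
    lambda2_norm A q (x - y) <= e.
  move=> e0; have : entourage [set xy : lambda2 A * lambda2 A | lambda2_norm A q (xy.1 - xy.2) < e].
    by apply/entourage_lambda2P; exists q, e.
  move=> /Fc[[B1 B2] /= [FB1 FB2] hB].
  exists (B1 `&` B2); first exact: filterI.
  by move=> x y [x1 _] [_ y2]; exact: ltW (hB (x, y) (conj x1 y2)).
have coord j : exists l : R[i], forall e : R, 0 < e ->
    \forall x \near F, normc (lambda2_val x j - l) <= e.
  apply: cauchy_complex => e e0; have [q aq] := koethe_gt0 A j.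
  have [|B FB hB] := hC q (e * A j q); first by rewrite mulr_gt0.
  exists B => // x y Bx By; rewrite -(@ler_pM2r _ (A j q))//.
  exact: le_trans (lambda2_coord q (x - y) j) (hB x y Bx By).
have [l hl] := boolp.choice coord.
have lim q (e : R) : 0 < e -> exists2 B, F B & forall x : lambda2 A, B x ->
    (wsum (A ^~ q) (lambda2_val x - l)%R < +oo)%E /\ wnorm (A ^~ q) (lambda2_val x - l) <= e.
  move=> e0; have [B FB hB] := hC q e e0; exists B => //.
  apply: (@wsum_cvg R _ F FF (@lambda2_val R A) l (A ^~ q) B e) => //.
  - by move=> j; exact: koethe_ge0.
  - by move=> x y Bx By; split; [exact: lambda2_fin q (x - y)|exact: hB].
have lfin q : (wsum (A ^~ q) l < +oo)%E.
  have [B FB hB] := lim q 1 ltr01; have [x Bx] := filter_ex FB.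
  have [hx _] := hB x Bx; rewrite (_ : l = lambda2_val x + (-1) *: (lambda2_val x - l)).
    by apply: wsumD_lty; [exact: (lambda2_fin q x)|exact: wsumZ_lty hx].
  by rewrite scaleN1r opprB addrC subrK.
exists (lambda2_of lfin) => U /nbhs_lambda2P[q [e [e0 hU]]].
have [|B FB hB] := lim q (e / 2); first by rewrite divr_gt0.
apply: filterS FB => x /hB[_ hx]; apply: hU; apply: le_lt_trans hx _.
by rewrite ltr_pdivrMr// ltr_pMr// ltr1n.
Qed.

(** The metric sup_q min(|x - y|_q, 1 / (q + 1)): truncating the q-th norm at
    1 / (q + 1) leaves only finitely many norms to control at each scale. *)
Lemma lambda2_metrizable : @metrizable R (lambda2 A).
Proof.
pose p q (x y : lambda2 A) := lambda2_norm A q (x - y).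
pose D (x y : lambda2 A) := [set Num.min (p q x y) (q.+1%:R^-1) | q in [set: nat]].
pose d (x y : lambda2 A) : R := sup (D x y).
have p0 q x y : 0 <= p q x y by exact: lambda2_norm_ge0.
have i0 q : 0 < q.+1%:R^-1 :> R by rewrite invr_gt0.
have Dub x y : ubound (D x y) 1.
  by move=> _ [q _ <-]; rewrite ge_min invf_le1// ler1n orbT.
have Dsup x y : has_sup (D x y).
  by split; [exists (Num.min (p 0%N x y) 1%:R^-1); exists 0%N|exists 1].
have dle x y q : Num.min (p q x y) (q.+1%:R^-1) <= d x y.
  by apply: sup_upper_bound => //; exists q.
have dge x y c : (forall q, Num.min (p q x y) (q.+1%:R^-1) <= c) -> d x y <= c.
  by move=> h; apply: ge_sup; [exact: (Dsup x y).1|move=> _ [q _ <-]; exact: h].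
have d0 x y : 0 <= d x y.
  by rewrite (le_trans _ (dle x y 0%N))// le_min p0 ltW.
exists d; split.
- move=> x y; split=> [dxy|->].
    apply: lambda2_eqP => j; have [q aq] := koethe_gt0 A j.
    have : p q x y <= 0.
      by have := dle x y q; rewrite dxy ge_min => /orP[//|]; rewrite leNgt i0.
    move=> h; apply/eqP; rewrite -subr_eq0; apply/eqP; apply: ComplexField.Normc.eq0_normc.
    apply/eqP; rewrite eq_le normc_ge0 andbT.
    by have := le_trans (lambda2_coord q (x - y) j) h; rewrite pmulr_lle0.
  apply/eqP; rewrite eq_le d0 andbT; apply: dge => q.
  by rewrite /p subrr lambda2_norm0 ge_min lexx.
- move=> x y; congr (sup _); apply/seteqP; split=> _ [q _ <-]; exists q => //;
    by rewrite /p -opprB (gradedN (lambda2_graded A)).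
- move=> x y z; apply: dge => q.
  have := lerD (dle x y q) (dle y z q); apply: le_trans.
  have tri : p q x z <= p q x y + p q y z.
    have e : x - z = (x - y) + (y - z) by rewrite addrA subrK.
    by rewrite /p e; exact: (gradedD (lambda2_graded A)).
  exact: min_subadd (p0 _ _ _) (p0 _ _ _) (ltW (i0 q)) tri.
- move=> x; apply/seteqP; split=> U.
    move=> /nbhs_lambda2P[q [e [e0 hU]]].
    exists (Num.min e (q.+1%:R^-1)); first by rewrite /= lt_min e0 i0.
    move=> y /= hy; apply: hU; rewrite -opprB (gradedN (lambda2_graded A)) -/(p q x y).
    exact: min_lt_cancel (le_lt_trans (dle x y q) hy).
  move=> [e e0 hU]; have [N hN] := small_inv 1 (divr_gt0 e0 (ltr0Sn R 1)).
  apply/nbhs_lambda2P; exists N, (e / 2); split=> [|y hy]; first by rewrite divr_gt0.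
  apply: hU => /=; apply: (@le_lt_trans _ _ (e / 2)); last first.
    by rewrite ltr_pdivrMr// ltr_pMr// ltr1n.
  apply: dge => q; rewrite ge_min; have [qN|Nq] := leqP q N.
    apply/orP; left; rewrite /p -opprB (gradedN (lambda2_graded A)).
    exact: le_trans (lambda2_norm_le _ qN) (ltW hy).
  apply/orP; right; apply: le_trans hN; rewrite div1r lef_pV2 ?posrE// ler_nat.
  by rewrite ltnS ltnW.
Qed.

End frechet_nuclear.

(** * The equivalence *)

Unset Implicit Arguments.

Theorem theorem7 (R : realType) (A : koethe_matrix R) :
  [<-> (exists B : set (Lss R),
          [/\ is_star_subalgebra B, is_commutative B, closed B
            & isomorphic_onto (lambda2 A) B]);
       (forall q : nat, exists r : nat,
          (\sum_(0 <= j <oo) koethe_quot (A j q) (A j r) < +oo)%E) /\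
       (exists p : nat, forall q : nat, exists (r : nat) (C : R), 0 < C /\
          forall j, A j q ^+ 2 <= C * A j p * A j r);
       [/\ is_frechet (lambda2 A), nuclear (lambda2_norm A)
         & property_DN (lambda2_norm A)];
       (exists B : set (sspace R),
          [/\ is_subspace B, closed B & isomorphic_onto (lambda2 A) B])].
Proof.
split=> [[B [_ _ _ iB]]|].
  exact: (isomorphic_onto_koethe (0%N, 0%N) (@Lss_model R) iB).
split=> [[hs hp]|].
  have [p hDN] := hp; split.
  - by split; [exact: lambda2_metrizable|exact: lambda2_complete].
  - exact: koethe_nuclear (koethe_DN_gt0 hDN) hs.
  - exact: koethe_property_DN hp.
split=> [[_ hn hDN]|[B [_ _ iB]]].
  have [u [b fr]] := koethe_frame (nuclear_koethe hn) (property_DN_koethe hDN).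
  exact: sspace_pattern fr.
have [hs hp] := isomorphic_onto_koethe 0%N (@sspace_model R) iB.
have [u [b fr]] := koethe_frame hs hp; exists (diagonal_algebra b).
have [_ clB isoB] := diagonal_algebra_isomorphic fr.
split=> //; [exact: diagonal_algebra_star fr|exact: diagonal_algebra_commutative].
Qed.
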